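(* Let $p_1\in\mathbb{R}$ with $p_1\le m_0$. Assume that there exist $C>0$, $k_0>0$ and $T>0$ such that $$\|u^k\|_{D(\mathsf{A}^{p_1})}\le C\int_0^T\|\mathsf{L}u^k(t)\|_K\,dt$$ holds for every $U=(u^k)_{k\in\mathbb{N}^*}\in B^S$ and every $k\ge k_0$. Assume the unique continuation property: if $v$ is an eigenvector of $\mathsf{A}$ such that $\mathsf{L}v=0$, then $v=0$ (i.e. no eigenvector of $\mathsf{A}$ is annihilated by $\mathsf{L}$). Then for every $T'>T$ there exists $C'>0$ such that for every $\underline{u}^0\in D(\mathsf{A}^{m_0})$ the solution $u$ of $\partial_tu-i\mathsf{A}u=0$, $u|_{t=0}=\underline{u}^0$, satisfies $$\|\underline{u}^0\|_{D(\mathsf{A}^{p_1})}\le C'\int_0^{T'}\|\mathsf{L}u(t)\|_K\,dt.$$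
   Context: Let $E$ be a (complex) Hilbert space and $\mathsf{A}$ a positive unbounded selfadjoint operator on $E$ with dense domain. Assume there is a real Hilbert basis $(e_\nu)_{\nu\in\mathbb{N}}$ of $E$ made of eigenvectors of $\mathsf{A}$, associated with a nondecreasing sequence of eigenvalues $\lambda_\nu>0$, $\lambda_\nu\to+\infty$. Write $u=\sum_\nu u_\nu e_\nu$, $u_\nu=(u,e_\nu)_E$. For $s\ge0$, $D(\mathsf{A}^s)=\{u\in E: (\lambda_\nu^su_\nu)_\nu\in\ell^2(\mathbb{C})\}$; for $s<0$, $D(\mathsf{A}^s)$ is the dual of $D(\mathsf{A}^{|s|})$ with $E$ as pivot space, its elements being the series $u=\sum_\nu u_\nu e_\nu$ with $(\lambda_\nu^su_\nu)_\nu\in\ell^2(\mathbb{C})$. In all cases $\mathsf{A}^su=\sum_\nu\lambda_\nu^su_\nu e_\nu$ and $\|u\|_{D(\mathsf{A}^s)}^2=\sum_\nu\lambda_\nu^{2s}|u_\nu|^2$. Schrödinger equation: for $\underline{u}^0\in D(\mathsf{A}^p)$, $p\in\mathbb{R}$, the equation $\partial_tu-i\mathsf{A}u=0$, $u|_{t=0}=\underline{u}^0$ has the unique solution $u(t)=\sum_\nu e^{it\lambda_\nu}\underline{u}^0_\nu e_\nu$ in $\mathscr{C}^0(\mathbb{R};D(\mathsf{A}^p))\cap\mathscr{C}^1(\mathbb{R};D(\mathsf{A}^{p-1}))$; $\|u(t)\|_{D(\mathsf{A}^p)}$ is independent of $t$. Dyadic decomposition: fix $0<\alpha<1$ and $\rho\in\,]1,1/\alpha[$.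 For $k\in\mathbb{N}^*$ let $J^S_k=\{\nu:\alpha\rho^{k}\le\lambda_\nu<\rho^{k}/\alpha\}$ (a finite set) and $E^S_k=\mathrm{span}\{e_\nu:\nu\in J^S_k\}$ with the norm of $E$. An element $u=\sum_{\nu\in J^S_k}u_\nu e_\nu\in E^S_k$ is identified with the solution of the Schrödinger equation $u(t)=\sum_{\nu\in J^S_k}e^{it\lambda_\nu}u_\nu e_\nu$. Set $B^S=\{(u^k)_{k\in\mathbb{N}^*}:u^k\in E^S_k,\ \|u^k\|_E\le1\}$. Observation operator: $K$ is a Hilbert space and $\mathsf{L}:E\to K$ is a possibly unbounded linear operator with domain $D(\mathsf{L})=D(\mathsf{A}^{m_0})$ for some $m_0\in\mathbb{R}$, with $\|\mathsf{L}u\|_K\le C_0\|u\|_{D(\mathsf{A}^{m_0})}$ for some constant $C_0$. *)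

(* Defs.v *)
From HB Require Import structures.
From mathcomp Require Import all_boot all_order all_algebra sesquilinear.
From mathcomp Require Import complex.
From mathcomp Require Import all_classical all_reals all_analysis.
From mathcomp Require Import ring lra.

Set Implicit Arguments.
Unset Strict Implicit.
Unset Printing Implicit Defensive.

Import Order.TTheory GRing.Theory Num.Theory.
Import numFieldNormedType.Exports.

Local Open Scope classical_set_scope.
Local Open Scope ring_scope.
Local Open Scope complex_scope.

(* In a normed module over R[i] the norm `|x| has type R[i]. *)
Definition rnorm (R : realType) (V : normedZmodType R[i]) (x : V) : R :=
  complex.Re `|x|.

Definition expi (R : realType) (x : R) : R[i] := cos x +i* sin x.

(* The form is linear in its first argument. Together with the completeness of
   E, this makes (E, dotp) a complex Hilbert space. *)
Definition hilbert_dot (R : realType) (E : completeNormedModType R[i])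
    (dotp : {dot E for (@Num.conj R[i])}) : Prop :=
  forall x : E, `|x| ^+ 2 = dotp x x.

Definition lspan (R : realType) (E : lmodType R[i]) (e : nat -> E)
    (J : pred nat) : set E :=
  [set u | exists (N : nat) (c : nat -> R[i]),
     u = \sum_(n < N | J n) c n *: e n].

Definition hilbert_basis (R : realType) (E : completeNormedModType R[i])
    (dotp : {dot E for (@Num.conj R[i])}) (e : nat -> E) : Prop :=
  (forall m n, dotp (e m) (e n) = (m == n)%:R) /\
  closure (lspan e xpredT) = setT.

Section UnboundedOperators.
Variables (R : realType) (E : completeNormedModType R[i]).
Variable dotp : {dot E for (@Num.conj R[i])}.

(* An unbounded operator is a function A that is meaningful on domA only. *)
Implicit Types (domA : set E) (A : E -> E).

Definition linear_on domA A : Prop :=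
  domA 0 /\
  forall (a : R[i]) (u v : E), domA u -> domA v ->
    domA (a *: u + v) /\ A (a *: u + v) = a *: A u + A v.

(* Equality of the graphs of A and of its adjoint. *)
Definition selfadjoint domA A : Prop :=
  forall v w : E,
    (domA v /\ A v = w) <-> (forall u, domA u -> dotp (A u) v = dotp u w).

Definition positive_operator domA A : Prop :=
  forall u, domA u -> 0 <= dotp (A u) u.

Definition eigenvector domA A (v : E) : Prop :=
  [/\ domA v, v != 0 & exists mu : R[i], A v = mu *: v].

End UnboundedOperators.

Section Scale.
Variables (R : realType) (lam : nat -> R).
Implicit Types (s p : R) (u v : nat -> R[i]).

(* Elements of D(A^s), s of either sign, are represented by the coefficients of
   their series sum_n u_n e_n. *)
Definition coef (E : completeNormedModType R[i])
    (dotp : {dot E for (@Num.conj R[i])}) (e : nat -> E) (u : E) :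
  nat -> R[i] := fun n => dotp u (e n).

Definition sqnormDA s u : \bar R :=
  \sum_(0 <= n <oo) (lam n `^ (2 * s) * rnorm (u n) ^+ 2)%:E.

Definition DA s : set (nat -> R[i]) := [set u | (sqnormDA s u < +oo)%E].

Definition normDA s u : R := Num.sqrt (fine (sqnormDA s u)).

Definition powA s u : nat -> R[i] := fun n => (lam n `^ s)%:C * u n.

Definition continuous_in s (u : R -> nat -> R[i]) : Prop :=
  (forall t, DA s (u t)) /\
  forall t, normDA s (u t' - u t) @[t' --> t] --> (0 : R).

Definition has_derivative_in s (u v : R -> nat -> R[i]) : Prop :=
  forall t,
    normDA s ((h^-1)%:C *: (u (t + h) - u t) - v t) @[h --> (0 : R)^'] -->
    (0 : R).

(* u belongs to C^0(R; D(A^p)) and C^1(R; D(A^(p-1))). *)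
Definition schrodinger_solution p (u0 : nat -> R[i])
    (u : R -> nat -> R[i]) : Prop :=
  [/\ u 0 = u0,
      continuous_in p u &
      exists du : R -> nat -> R[i],
        [/\ continuous_in (p - 1) du,
            has_derivative_in (p - 1) u du &
            forall t, du t - 'i *: powA 1 (u t) = 0]].

Definition schrodinger_flow (u0 : nat -> R[i]) (t : R) : nat -> R[i] :=
  fun n => expi (t * lam n) * u0 n.

Definition JS (alpha rho : R) (k : nat) : pred nat :=
  fun n => alpha * rho ^+ k <= lam n < rho ^+ k / alpha.

(* The index set of the family is k >= 1; U 0 plays no role. *)
Definition BS (E : completeNormedModType R[i]) (e : nat -> E)
    (alpha rho : R) : set (nat -> E) :=
  [set U | forall k, (0 < k)%N ->
     lspan e (JS alpha rho k) (U k) /\ rnorm (U k) <= 1].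

Definition bounded_observation (K : completeNormedModType R[i])
    (m0 : R) (L : (nat -> R[i]) -> K) : Prop :=
  (forall (a : R[i]) u v, DA m0 u -> DA m0 v ->
     L (a *: u + v) = a *: L u + L v) /\
  exists C0 : R, forall u, DA m0 u -> rnorm (L u) <= C0 * normDA m0 u.

End Scale.

Definition observed (R : realType) (K : completeNormedModType R[i])
    (L : (nat -> R[i]) -> K) (T : R) (u : R -> nat -> R[i]) : \bar R :=
  \int[@lebesgue_measure R]_(t in `[0, T]) (rnorm (L (u t)))%:E.

Section Flow.
Variables (R : realType).
Lemma rnorm_sqr (z : R[i]) :
  rnorm z ^+ 2 = complex.Re z ^+ 2 + complex.Im z ^+ 2.
Proof.
by rewrite /rnorm normc_def /= sqr_sqrtr // addr_ge0 ?sqr_ge0.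
Qed.

Lemma rnorm_sqrM (z w : R[i]) : rnorm (z * w) ^+ 2 = rnorm z ^+ 2 * rnorm w ^+ 2.
Proof. by case: z w => [a b] [c d]; rewrite !rnorm_sqr /=; ring. Qed.

Lemma sin_le_id (x : R) : sin x ^+ 2 <= x ^+ 2.
Proof.
have H (y : R) : 0 <= y -> sin y ^+ 2 <= y ^+ 2.
  move=> y0.
  have ds : forall x, x \in `]0, y[%R -> is_derive x 1 (@sin R) (cos x).
    by move=> x' _; exact: is_derive_sin.
  have cs : {within `[0, y], continuous (@sin R)}.
    by apply: continuous_subspaceT; exact: continuous_sin.
  have [c _] := MVT_segment y0 ds cs.
  rewrite sin0 !subr0 => ->; rewrite exprMn ler_piMl ?sqr_ge0 //.
have [x0|x0] := leP 0 x; first exact: H.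
by rewrite -sqrrN -sinN -(sqrrN x) H // oppr_ge0 ltW.
Qed.

Lemma expi_dist (a b : R) :
  (cos a - cos b) ^+ 2 + (sin a - sin b) ^+ 2 <= (a - b) ^+ 2.
Proof.
have -> : (cos a - cos b) ^+ 2 + (sin a - sin b) ^+ 2 =
    2 - 2 * cos (a - b).
  by rewrite cosB; have := cos2Dsin2 a; have := cos2Dsin2 b; lra.
have -> : a - b = ((a - b) / 2) *+ 2 by rewrite -mulr_natr; field.
rewrite cos_mulr2n; set y := (a - b) / 2.
have := sin_le_id y; have := cos2Dsin2 y.
have -> : (y *+ 2) ^+ 2 = 4 * y ^+ 2 by rewrite -mulr_natr; ring.
by lra.
Qed.

Variable lam : nat -> R.
Hypothesis lam0 : forall n, 0 < lam n.

Lemma sqnormDA_term_ge0 s (u : nat -> R[i]) n :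
  (0 <= (lam n `^ (2 * s) * rnorm (u n) ^+ 2)%:E)%E.
Proof. by rewrite lee_fin mulr_ge0 ?powR_ge0 ?sqr_ge0. Qed.

Lemma sqnormDA_ge0 s u : (0 <= sqnormDA lam s u)%E.
Proof. by apply: nneseries_ge0 => n _ _; exact: sqnormDA_term_ge0. Qed.

Lemma normDA_cvg0 (F : set_system R) (FF : Filter F) s
    (w : R -> nat -> R[i]) (g : nat -> R) :
  (\forall h \near F, forall n, lam n `^ (2 * s) * rnorm (w h n) ^+ 2 <= g n) ->
  (forall n, 0 <= g n) ->
  (\sum_(0 <= n <oo) (g n)%:E < +oo)%E ->
  (forall n, rnorm (w h n) ^+ 2 @[h --> F] --> (0 : R)) ->
  normDA lam s (w h) @[h --> F] --> (0 : R).
Proof.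
move=> wg g0 goo w0.
suff H : fine (sqnormDA lam s (w h)) @[h --> F] --> (0 : R).
  rewrite -(@sqrtr0 R).
  exact: (cvg_comp _ _ H (@sqrt_continuous R 0)).
apply/cvgr0Pnorm_lt => eps eps0.
have e20 : 0 < eps / 2 by rewrite divr_gt0.
have tl : \forall N \near \oo, (\sum_(N <= n <oo) (g n)%:E < (eps / 2)%:E)%E.
  have := @nneseries_tail_cvg R (fun n => (g n)%:E) xpredT goo
     (fun n _ => g0 n).
  move/(_ [set x | (x < (eps / 2)%:E)%E]); apply.
  by apply: open_nbhs_nbhs; split; [exact: open_ereal_lt_ereal|rewrite /= lte_fin].
have [N _ /(_ N (leqnn N)) tN] := tl.
have fs : \sum_(0 <= n < N) lam n `^ (2 * s) * rnorm (w h n) ^+ 2 @[h --> F] -->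
   (0 : R).
  rewrite [X in _ --> X](_ : _ = \sum_(0 <= n < N) (0 : R)); last by rewrite big1.
  apply: cvg_big; first exact: add_continuous.
  move=> n _; rewrite -(mulr0 (lam n `^ (2 * s))).
  by apply: cvgM; [exact: cvg_cst|exact: w0].
move: fs => /cvgr0Pnorm_lt /(_ _ e20) fs.
near=> h.
have hg : forall n, lam n `^ (2 * s) * rnorm (w h n) ^+ 2 <= g n by near: h.
have hs : `|\sum_(0 <= n < N) lam n `^ (2 * s) * rnorm (w h n) ^+ 2| < eps / 2.
  by near: h.
have lt : (sqnormDA lam s (w h) < eps%:E)%E.
  rewrite /sqnormDA (nneseries_split 0 N) //; last first.
    by move=> k _; exact: sqnormDA_term_ge0.
  rewrite add0n (splitr eps) EFinD; apply: lteD.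
    by rewrite sumEFin lte_fin; apply: le_lt_trans hs; exact: ler_norm.
  apply: le_lt_trans tN; apply: lee_nneseries => n _.
    by move=> _; exact: sqnormDA_term_ge0.
  by rewrite lee_fin hg.
have ge := sqnormDA_ge0 s (w h).
have fn : sqnormDA lam s (w h) \is a fin_num.
  by rewrite ge0_fin_numE // (lt_trans lt) // ltry.
rewrite ger0_norm; last by rewrite fine_ge0.
by rewrite -lte_fin fineK.
Unshelve. all: by end_near.
Qed.

Lemma cvg0M (F : set_system R) (FF : Filter F) (f : R -> R) (c : R) :
  f x @[x --> F] --> (0 : R) -> c * f x @[x --> F] --> (0 : R).
Proof.
move=> f0; rewrite [X in _ --> X](_ : _ = c * 0); last by rewrite mulr0.
by apply: cvgM; [exact: cvg_cst|].
Qed.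

Lemma cvg0DX (F : set_system R) (FF : Filter F) (f g : R -> R) :
  f x @[x --> F] --> (0 : R) -> g x @[x --> F] --> (0 : R) ->
  f x ^+ 2 + g x ^+ 2 @[x --> F] --> (0 : R).
Proof.
move=> f0 g0; rewrite [X in _ --> X](_ : _ = 0 * 0 + 0 * 0); last first.
  by rewrite mulr0 addr0.
by apply: cvgD; apply: cvgM.
Qed.

Lemma cvg0B (F : set_system R) (FF : Filter F) (f : R -> R) (c : R) :
  f x @[x --> F] --> c -> f x - c @[x --> F] --> (0 : R).
Proof.
move=> f0; rewrite [X in _ --> X](_ : _ = c - c); last by rewrite subrr.
by apply: cvgB => //; exact: cvg_cst.
Qed.

Lemma cvg0D (F : set_system R) (FF : Filter F) (f : R -> R) (c : R) :
  f x @[x --> F] --> - c -> f x + c @[x --> F] --> (0 : R).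
Proof. by move=> /cvg0B; rewrite opprK. Qed.

Lemma deriv_quotient (f : R -> R) (df t : R) : is_derive t 1 f df ->
  h^-1 * (f (t + h) - f t) @[h --> (0 : R)^'] --> df.
Proof.
move=> [dc <-]; move: dc; rewrite /derivable /derive => dc.
suff -> : (fun h => h^-1 * (f (t + h) - f t)) =
  (fun h => h^-1 *: ((f \o shift t) (h *: (1 : R)) - f t)) by exact: dc.
by apply/funext => h /=; rewrite [h *: _]mulr1 [t + h]addrC.
Qed.

Lemma expi_cvg (l t : R) : cos (t' * l) @[t' --> t] --> cos (t * l) /\
  sin (t' * l) @[t' --> t] --> sin (t * l).
Proof.
have H : (t' * l) @[t' --> t] --> t * l by apply: cvgM; [exact: cvg_id|exact: cvg_cst].
split.
  exact: (cvg_comp _ _ H (@continuous_cos R _)).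
exact: (cvg_comp _ _ H (@continuous_sin R _)).
Qed.

Lemma rnorm_expi (x : R) : rnorm (expi x) ^+ 2 = 1.
Proof. by rewrite rnorm_sqr /= cos2Dsin2. Qed.

Lemma rnorm_flow u0 t n : rnorm (schrodinger_flow lam u0 t n) ^+ 2 = rnorm (u0 n) ^+ 2.
Proof. by rewrite rnorm_sqrM rnorm_expi mul1r. Qed.

Lemma DA_Z (s : R) u (c : R) : 0 <= c -> DA lam s u ->
  (\sum_(0 <= n <oo) (c * (lam n `^ (2 * s) * rnorm (u n) ^+ 2))%:E < +oo)%E.
Proof.
move=> c0 Du.
under eq_eseriesr do rewrite EFinM.
rewrite nneseriesZl; last by move=> n _; exact: sqnormDA_term_ge0.
by rewrite lte_mul_pinfty // lee_fin.
Qed.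

Lemma rnorm_flowB u0 t t' n :
  rnorm ((schrodinger_flow lam u0 t' - schrodinger_flow lam u0 t) n) ^+ 2 =
  ((cos (t' * lam n) - cos (t * lam n)) ^+ 2 +
   (sin (t' * lam n) - sin (t * lam n)) ^+ 2) * rnorm (u0 n) ^+ 2.
Proof.
rewrite !fctE /schrodinger_flow /= -mulrBl rnorm_sqrM; congr (_ * _).
by rewrite rnorm_sqr.
Qed.

Lemma flow_continuous_aux s (w : R -> nat -> R[i]) u0 (c : nat -> R) p :
  (forall t n, rnorm (w t n) ^+ 2 = c n * rnorm (u0 n) ^+ 2) ->
  (forall n, 0 <= c n) ->
  (forall t t' n, rnorm ((w t' - w t) n) ^+ 2 =
     c n * rnorm ((schrodinger_flow lam u0 t' - schrodinger_flow lam u0 t) n) ^+ 2) ->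
  (forall n, lam n `^ (2 * s) * c n = lam n `^ (2 * p)) ->
  DA lam p u0 -> continuous_in lam s w.
Proof.
move=> wE c0 wB wt Du; split=> t.
  rewrite /DA /= /sqnormDA; under eq_eseriesr do rewrite wE mulrA wt.
  exact: Du.
apply: (@normDA_cvg0 _ _ s (fun t' => w t' - w t)
  (fun n => 4 * (lam n `^ (2 * p) * rnorm (u0 n) ^+ 2))).
- near=> t' => n; rewrite wB mulrA wt rnorm_flowB mulrCA.
  rewrite ler_wpM2r ?(mulr_ge0 (powR_ge0 _ _) (sqr_ge0 _)) //.
  have := cos2Dsin2 (t * lam n); have := cos2Dsin2 (t' * lam n).
  have := sqr_ge0 (cos (t' * lam n) + cos (t * lam n)).
  by have := sqr_ge0 (sin (t' * lam n) + sin (t * lam n)); lra.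
- by move=> n; rewrite mulr_ge0 ?(mulr_ge0 (powR_ge0 _ _) (sqr_ge0 _)).
- exact: DA_Z.
- move=> n; under eq_fun do rewrite wB rnorm_flowB.
  under eq_fun do rewrite mulrA mulrAC.
  apply: cvg0M; have [H1 H2] := expi_cvg (lam n) t.
  by apply: cvg0DX; apply: cvg0B.
Unshelve. all: by end_near.
Qed.

Lemma schrodinger_flow_solution p u0 : DA lam p u0 ->
  schrodinger_solution lam p u0 (schrodinger_flow lam u0).
Proof.
move=> Du; have wt n : lam n `^ (2 * (p - 1)) * lam n ^+ 2 = lam n `^ (2 * p).
  rewrite -powR_mulrn ?ltW // -powRD; last by apply/implyP => _; rewrite gt_eqF.
  by congr (_ `^ _); ring.
split.
- apply/funext => n; rewrite /schrodinger_flow /expi mul0r cos0 sin0.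
  exact: mul1r.
- apply: (@flow_continuous_aux p _ u0 (fun=> 1) p) => //= *;
    by rewrite ?mul1r ?mulr1 // rnorm_flow.
exists (fun t => 'i *: powA lam 1 (schrodinger_flow lam u0 t)); split.
- have iE n (z : R[i]) : rnorm ('i * ((lam n `^ 1)%:C * z)) ^+ 2 =
      lam n ^+ 2 * rnorm z ^+ 2.
    rewrite !rnorm_sqrM (rnorm_sqr 'i) /= (rnorm_sqr (_%:C)) /= powRr1 ?ltW //.
    by ring.
  apply: (@flow_continuous_aux (p - 1) _ u0 (fun n => lam n ^+ 2) p) => //.
  + by move=> t n; rewrite !fctE /powA iE rnorm_flow.
  + by move=> n; rewrite sqr_ge0.
  + by move=> t t' n; rewrite !fctE /powA -!mulrBr iE.
- move=> t.
  pose a n h := (h^-1 * (cos ((t + h) * lam n) - cos (t * lam n))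
    + lam n * sin (t * lam n)).
  pose b n h := (h^-1 * (sin ((t + h) * lam n) - sin (t * lam n))
    - lam n * cos (t * lam n)).
  have E h n : rnorm (((h^-1)%:C *: (schrodinger_flow lam u0 (t + h) -
      schrodinger_flow lam u0 t) -
      'i *: powA lam 1 (schrodinger_flow lam u0 t)) n) ^+ 2 =
      (a n h ^+ 2 + b n h ^+ 2) * rnorm (u0 n) ^+ 2.
    rewrite !fctE /powA /schrodinger_flow.
    have -> : (h^-1)%:C *: (expi ((t + h) * lam n) * u0 n -
        expi (t * lam n) * u0 n) -
        'i *: ((lam n `^ 1)%:C * (expi (t * lam n) * u0 n)) =
        ((h^-1)%:C * (expi ((t + h) * lam n) - expi (t * lam n)) -
        'i * ((lam n `^ 1)%:C * expi (t * lam n))) * u0 n :> R[i].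
      by rewrite mulrBl -!mulrA mulrBl.
    rewrite rnorm_sqrM; congr (_ * _).
    rewrite rnorm_sqr /= powRr1 ?ltW // /a /b.
    by congr (_ ^+ 2 + _ ^+ 2); ring.
  apply: (@normDA_cvg0 _ _ _ (fun h => (h^-1)%:C *:
      (schrodinger_flow lam u0 (t + h) - schrodinger_flow lam u0 t) -
      'i *: powA lam 1 (schrodinger_flow lam u0 t))
    (fun n => 4 * (lam n `^ (2 * p) * rnorm (u0 n) ^+ 2))).
  + near=> h => n; rewrite E.
    have h0 : h != 0 by near: h; exact: nbhs_dnbhs_neq.
    have -> : 4 * (lam n `^ (2 * p) * rnorm (u0 n) ^+ 2) =
        lam n `^ (2 * (p - 1)) * (4 * lam n ^+ 2 * rnorm (u0 n) ^+ 2).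
      by rewrite -(wt n); ring.
    rewrite ler_wpM2l ?powR_ge0 // ler_wpM2r ?sqr_ge0 //.
      have := expi_dist ((t + h) * lam n) (t * lam n).
      move=> /(ler_wpM2l (sqr_ge0 h^-1)); rewrite mulrDr -!exprMn.
      have -> : h^-1 * ((t + h) * lam n - t * lam n) = lam n by field.
      rewrite /a /b; move: (h^-1 * _) (h^-1 * _) => x y xy.
      have := cos2Dsin2 (t * lam n).
      move: (cos _) (sin _) => c d cd.
      have : (lam n * c) ^+ 2 + (lam n * d) ^+ 2 = lam n ^+ 2.
        by rewrite !exprMn -mulrDr cd mulr1.
      move: (lam n * c) (lam n * d) => {cd} c' d'.
      by have := sqr_ge0 (x + c'); have := sqr_ge0 (y - d'); lra.
  + by move=> n; rewrite mulr_ge0 ?(mulr_ge0 (powR_ge0 _ _) (sqr_ge0 _)).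
  + exact: DA_Z.
  + move=> n; under eq_fun do rewrite E.
    under eq_fun do rewrite mulrC.
    apply: cvg0M.
    have dl : is_derive t (1 : R) (fun t : R => t * lam n) (lam n).
      by apply: is_derive_eq; rewrite scaler0 add0r /GRing.scale /= mulr1.
    apply: cvg0DX.
    * rewrite /a; apply: cvg0D.
      have := deriv_quotient (@is_derive1_comp R (@cos R)
        (fun t : R => t * lam n) t _ _ (is_derive_cos _) dl).
      by rewrite mulNr mulrC.
    * rewrite /b; apply: cvg0B.
      have := deriv_quotient (@is_derive1_comp R (@sin R)
        (fun t : R => t * lam n) t _ _ (is_derive_sin _) dl).
      by rewrite mulrC.
- by move=> t; rewrite subrr.
Unshelve. all: by end_near.
Qed.
End Flow.

(* Main.v *)
Require Import Defs.
From mathcomp Require Import all_boot all_order all_algebra sesquilinear.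
From mathcomp Require Import complex.
From mathcomp Require Import all_classical all_reals all_analysis.
From mathcomp Require Import ring lra.
Import Order.TTheory GRing.Theory Num.Theory.
Import numFieldNormedType.Exports.
Local Open Scope classical_set_scope.
Local Open Scope ring_scope.
Local Open Scope complex_scope.
Set Implicit Arguments.
Unset Strict Implicit.
Unset Printing Implicit Defensive.

(** Put d_n = lam_n^p1 u0_n and b_n = lam_n^(-p1) L(e_n), so that the observed
    solution is the exponential sum f(t) = sum_n e^(i t lam_n) d_n b_n and the
    claim reads |d| <= C' int_0^T' |f| with |d| the l2 norm. Truncating the
    series reduces it to finite sums, with a constant that does not depend on
    the number of terms ([observable_flow]).

    High frequencies. A partition of the frequencies is useless by itself: in
    L^1 in time, the norms of the dyadic pieces of f are not controlled by the
    norm of f. But all frequencies are positive, so f extends to a holomorphic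
    function F(z) = sum_n e^(i z lam_n) d_n b_n that is small high in the upper
    half plane, and H^1 replaces L^1: the square function of F is controlled by
    int |f|. This part of the theory of Hardy spaces is proved in the strip
    [0, S] x [0, 1], with S a little larger than T. Let
    G(z) = (z (S - z))^(e+1) F(z), g = sqrt (v^2 + |G|^2), and let N(y), D(y)
    and M(y) be the integrals over [0, S] of g, |G'|^2 / g and |G'| at height y
    against x (S - x). Since Lap g >= |G'|^2 / g ([reg_laplacian]), Green's
    formula gives N'' >= D - s, where s bounds the values of g on the vertical
    sides, and integrating y N'' gives a bound on the integral of y D(y)
    ([reg_green]). If all frequencies exceed Lam, the boundary terms at the
    sides and at the top are O(|d| / Lam): the exponential decay beats the
    unboundedness of the observation, except near the two lower corners, where
    the polynomial factor of G vanishes ([hext_side], [hext_top]).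

    Conversely, at a height y <= 1/c, averaging F' in time with a kernel whose
    symbol is concentrated near c ([band_kernel]) leaves essentially the part
    d' of d with frequencies in [c, (1 + ep) c], to which the dyadic hypothesis
    applies: c |d'| <= A (M(y) + N(y) + |d|) ([window_bound]). Moreover
    M^2 <= D N. Taking c = (1 + ep)^j and y close to 1/c, squaring and summing
    over j, one gets |d|^2 <= C ((int |f|)^2 + |d|^2 / Lam^2), and the last term
    is absorbed when Lam is large ([high_frequency]).

    Low frequencies are recovered by Haraux's method, one eigenvalue mu at a
    time and at the cost of an arbitrarily small time ([haraux_step]): a time
    average whose symbol vanishes at mu removes the corresponding terms, and
    these are then estimated because unique continuation makes
    d |-> sum_(lam_n = mu) d_n b_n injective, hence bounded below, on a finite
    dimensional space.

    All time averages are finite sums of translates, with symbols built from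
    Vieta's cosine products. Only finitely many frequencies occur at a time and
    the bounds do not see how many factors are taken, so that no integral of a
    vector-valued function is needed. *)

(** * Norms, phases, integrals *)

Section RealNorm.
Variables (R : realType) (V : completeNormedModType R[i]).
Implicit Types (x y : V) (z w : R[i]).

Lemma rnormE x : `|x| = (rnorm x)%:C.
Proof.
have := normr_ge0 x; rewrite /rnorm; case: (`|x|) => a b /=.
by rewrite lecE /= => /andP[/eqP -> _].
Qed.

Lemma rnormcE z : `|z| = (rnorm z)%:C.
Proof. by rewrite /rnorm normc_def. Qed.

Lemma rnorm_ge0 x : 0 <= rnorm x.
Proof. by have := normr_ge0 x; rewrite rnormE lecR. Qed.

Lemma rnormc_ge0 z : 0 <= rnorm z.
Proof. by have := normr_ge0 z; rewrite rnormcE lecR. Qed.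

Lemma rnormD x y : rnorm (x + y) <= rnorm x + rnorm y.
Proof. by have := ler_normD x y; rewrite !rnormE -rmorphD lecR. Qed.

Lemma rnormN x : rnorm (- x) = rnorm x.
Proof. by rewrite /rnorm normrN. Qed.

Lemma rnormB_sym x y : rnorm (x - y) = rnorm (y - x).
Proof. by rewrite /rnorm distrC. Qed.

Lemma rnorm0 : rnorm (0 : V) = 0.
Proof. by rewrite /rnorm normr0. Qed.

Lemma rnorm_eq0 x : (rnorm x == 0) = (x == 0).
Proof. by rewrite -[RHS]normr_eq0 rnormE (inj_eq (@complexI R)). Qed.

Lemma rnormM z w : rnorm (z * w) = rnorm z * rnorm w.
Proof. by apply: complexI; rewrite rmorphM /= -!rnormcE normrM. Qed.

Lemma rnormZ z x : rnorm (z *: x) = rnorm z * rnorm x.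
Proof. by apply: complexI; rewrite rmorphM /= -rnormE -rnormcE -rnormE normrZ. Qed.

Lemma rnormcD z w : rnorm (z + w) <= rnorm z + rnorm w.
Proof. by have := ler_normD z w; rewrite !rnormcE -rmorphD lecR. Qed.

Lemma rnormc0 : rnorm (0 : R[i]) = 0.
Proof. by rewrite /rnorm normr0. Qed.

Lemma rnormc1 : rnorm (1 : R[i]) = 1.
Proof. by rewrite /rnorm normr1. Qed.

Lemma rnormX z n : rnorm (z ^+ n) = rnorm z ^+ n.
Proof. by elim: n => [|n IH]; rewrite ?expr0 ?rnormc1 // !exprS rnormM IH. Qed.

Lemma rnorm_real (a : R) : rnorm a%:C = `|a|.
Proof. by rewrite /rnorm normc_def /= expr0n /= addr0 sqrtr_sqr. Qed.

Lemma rnormc_expi (a : R) : rnorm (expi a) = 1.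
Proof. by rewrite /rnorm normc_def /= cos2Dsin2 sqrtr1. Qed.

Lemma rnorm_i : rnorm ('i : R[i]) = 1.
Proof. by rewrite /rnorm normc_def /= expr0n expr1n add0r sqrtr1. Qed.

Lemma rnorm_sum (I : Type) (r : seq I) (P : pred I) (F : I -> V) :
  rnorm (\sum_(i <- r | P i) F i) <= \sum_(i <- r | P i) rnorm (F i).
Proof.
elim/big_rec2: _ => [|i a x _ IH]; first by rewrite rnorm0.
by rewrite (le_trans (rnormD _ _)) // lerD2l.
Qed.

Lemma rnormc_sum (I : Type) (r : seq I) (P : pred I) (F : I -> R[i]) :
  rnorm (\sum_(i <- r | P i) F i) <= \sum_(i <- r | P i) rnorm (F i).
Proof.
elim/big_rec2: _ => [|i a x _ IH]; first by rewrite rnormc0.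
by rewrite (le_trans (rnormcD _ _)) // lerD2l.
Qed.

Lemma rnorm_dist x y : `|rnorm x - rnorm y| <= rnorm (x - y).
Proof.
rewrite ler_norml; apply/andP; split.
  rewrite lerNl opprB lerBlDr rnormB_sym (le_trans _ (rnormD _ _)) //.
  by rewrite subrK.
by rewrite lerBlDr (le_trans _ (rnormD _ _)) // subrK.
Qed.

End RealNorm.

Section Components.
Variable R : realType.
Implicit Type z : R[i].

Lemma abs_Re_le_rnorm z : `|complex.Re z| <= rnorm z.
Proof.
rewrite -(@ler_pXn2r _ 2) ?nnegrE ?rnormc_ge0 // rnorm_sqr.
by rewrite real_normK ?num_real // lerDl sqr_ge0.
Qed.

Lemma abs_Im_le_rnorm z : `|complex.Im z| <= rnorm z.
Proof.
rewrite -(@ler_pXn2r _ 2) ?nnegrE ?rnormc_ge0 // rnorm_sqr.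
by rewrite real_normK ?num_real // lerDr sqr_ge0.
Qed.

Lemma rnorm_le_ReIm z : rnorm z <= `|complex.Re z| + `|complex.Im z|.
Proof.
rewrite -(@ler_pXn2r _ 2) ?nnegrE ?rnormc_ge0 ?addr_ge0 //.
rewrite rnorm_sqr sqrrD !real_normK ?num_real //.
by rewrite lerD2r lerDl mulrn_wge0 // mulr_ge0 ?normr_ge0.
Qed.

End Components.

Section Expi.
Variable R : realType.
Implicit Types x y : R.

Lemma expiD x y : expi (x + y) = expi x * expi y.
Proof.
rewrite /expi cosD sinD; apply/eqP; rewrite eq_complex /=; apply/andP; split=> //.
by rewrite addrC.
Qed.

Lemma expi0 : expi (0 : R) = 1.
Proof. by rewrite /expi cos0 sin0. Qed.

End Expi.

Section RealContinuity.
Variable R : realType.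
Implicit Types f h : R -> R.

Lemma continuous_derive (f df : R -> R) :
  (forall x, is_derive x (1 : R) f (df x)) -> continuous f.
Proof.
move=> H x; apply: differentiable_continuous; apply/derivable1_diffP.
by have [] := H x.
Qed.

Lemma continuousMc (f h : R -> R) : continuous f -> continuous h ->
  continuous (fun x => f x * h x).
Proof. by move=> cf ch x; apply: cvgM; [exact: cf|exact: ch]. Qed.

Lemma continuousDc (f h : R -> R) : continuous f -> continuous h ->
  continuous (fun x => f x + h x).
Proof. by move=> cf ch x; apply: cvgD; [exact: cf|exact: ch]. Qed.

Lemma continuousBc (f h : R -> R) : continuous f -> continuous h ->
  continuous (fun x => f x - h x).
Proof. by move=> cf ch x; apply: cvgB; [exact: cf|exact: ch]. Qed.

Lemma continuous_cstc (c : R) : continuous (fun _ : R => c).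
Proof. by move=> x; exact: cvg_cst. Qed.

Lemma continuousXc (f : R -> R) n : continuous f -> continuous (fun x => f x ^+ n).
Proof.
move=> cf; elim: n => [|n IH]; first exact: continuous_cstc.
by under eq_fun do rewrite exprS; exact: continuousMc.
Qed.

Lemma continuous_div (f h : R -> R) : continuous f -> continuous h ->
  (forall x, h x != 0) -> continuous (fun x => f x / h x).
Proof.
by move=> cf ch h0 x; apply: cvgM; [exact: cf|apply: cvgV; [exact: h0|exact: ch]].
Qed.

End RealContinuity.

Section Integral.
Variable R : realType.
Implicit Types (f g : R -> R) (a b s : R).

Definition integ a b f : R := (\int[@lebesgue_measure R]_(x in `[a, b]) f x)%R.

Lemma continuous_integrable a b f : continuous f ->
  (@lebesgue_measure R).-integrable `[a, b] (EFin \o f).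
Proof.
move=> cf; apply: continuous_compact_integrable; first exact: segment_compact.
exact: continuous_subspaceT.
Qed.

Lemma integD a b f g : continuous f -> continuous g ->
  integ a b (fun x => f x + g x) = integ a b f + integ a b g.
Proof.
by move=> cf cg; rewrite /integ RintegralD //; exact: continuous_integrable.
Qed.

Lemma integZ a b f c : continuous f ->
  integ a b (fun x => c * f x) = c * integ a b f.
Proof.
by move=> cf; rewrite /integ RintegralZl //; exact: continuous_integrable.
Qed.

Lemma le_integ a b f g : continuous f -> continuous g ->
  (forall x, a <= x <= b -> f x <= g x) -> integ a b f <= integ a b g.
Proof.
move=> cf cg fg; apply: le_Rintegral => //; try exact: continuous_integrable.
Qed.

Lemma eq_integ a b f g : (forall x, a <= x <= b -> f x = g x) ->
  integ a b f = integ a b g.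
Proof.
by move=> fg; apply: eq_Rintegral => x; rewrite inE /= in_itv /=; exact: fg.
Qed.

Lemma integ_ge0 a b f : (forall x, a <= x <= b -> 0 <= f x) -> 0 <= integ a b f.
Proof.
by move=> f0; apply: Rintegral_ge0 => x /=; rewrite in_itv /=; exact: f0.
Qed.

Lemma integ_cst a b c : a <= b -> integ a b (fun=> c) = c * (b - a).
Proof.
move=> ab; rewrite /integ Rintegral_cst //= lebesgue_measure_itv /= lte_fin.
by move: ab; rewrite le_eqVlt => /predU1P[->|->] //; rewrite ltxx subrr.
Qed.

Lemma integE a b f : continuous f ->
  (\int[@lebesgue_measure R]_(x in `[a, b]) (f x)%:E)%E = (integ a b f)%:E.
Proof.
move=> cf; rewrite /integ /Rintegral fineK //.
by apply: integrable_fin_num => //; exact: continuous_integrable.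
Qed.

Lemma integ_FTC a b f (F : R -> R) : a <= b -> continuous f ->
  (forall x, is_derive x (1 : R) F (f x)) -> integ a b f = F b - F a.
Proof.
rewrite le_eqVlt => /predU1P[<- _ _|ab cf dF].
  by rewrite subrr /integ set_itv1 Rintegral_set1.
have cF : continuous F.
  by move=> x; apply: differentiable_continuous; apply/derivable1_diffP; have [] := dF x.
apply: EFin_inj; rewrite -integE // EFinB (@continuous_FTC2 _ f F) //.
- exact: continuous_subspaceT.
- split=> [x _||]; first by have [] := dF x.
  + by apply: cvg_at_right_filter; exact: cF.
  + by apply: cvg_at_left_filter; exact: cF.
- by move=> x _; rewrite derive1E; have [] := dF x.
Qed.

Lemma sub_integ a b a' b' f : continuous f ->
  (forall x, a' <= x <= b' -> 0 <= f x) ->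
  a' <= a -> b <= b' -> integ a b f <= integ a' b' f.
Proof.
move=> cf f0 aa bb; rewrite -lee_fin -!integE //.
apply: ge0_subset_integral => //=.
- by apply/measurable_realfun.measurable_EFinP; apply: measurable_funTS; exact: measurable_realfun.continuous_measurable_fun.
- by apply: subset_itv; rewrite bnd_simp.
Qed.

Lemma integ_shift a b f s : continuous f -> (forall x, 0 <= f x) ->
  integ a b (fun x => f (x + s)) = integ (a + s) (b + s) f.
Proof.
move=> cf f0.
have [ab|ba] := leP a b; last first.
  by rewrite /integ !set_itv_ge ?Rintegral_set0 // bnd_simp -ltNge ?ltrD2r.
have dS x : is_derive x (1 : R) (fun t : R => t + s) 1.
  by apply: is_derive_eq; rewrite addr0.
have S' : ((fun t : R => t + s)^`())%classic = cst 1.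
  by apply/funext => x; rewrite derive1E; have [] := dS x.
have cS : continuous (fun t : R => t + s).
  by move=> x; apply: cvgD; [exact: cvg_id|exact: cvg_cst].
apply: EFin_inj; rewrite -!integE //; last first.
  by move=> x; apply: continuous_comp; [exact: cS|exact: cf].
rewrite (@integration_by_substitution_increasing _ (fun t => t + s) f) //.
- by apply: eq_integral => x _; rewrite fctE /= S' /= mulr1.
- by move=> x y _ _; rewrite ltrD2r.
- by move=> x _; rewrite S'; exact: cvg_cst.
- by rewrite S'; exact: is_cvg_cst.
- by rewrite S'; exact: is_cvg_cst.
- split=> [x _||]; first by have [] := dS x.
  + by apply: cvg_at_right_filter; exact: cS.
  + by apply: cvg_at_left_filter; exact: cS.
- exact: continuous_subspaceT.
Qed.

End Integral.

(** * Exponential sums and time averages *)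

Section Cont.
Variable R : realType.

Definition ccont (c : R -> R[i]) :=
  forall x, rnorm (c y - c x) @[y --> x] --> (0 : R).

Lemma ccontP (c : R -> R[i]) : continuous (fun x => complex.Re (c x)) ->
  continuous (fun x => complex.Im (c x)) -> ccont c.
Proof.
move=> cr ci x.
apply: (@squeeze_cvgr _ _ _ _ (fun=> 0)
  (fun y => `|complex.Re (c y) - complex.Re (c x)| + `|complex.Im (c y) - complex.Im (c x)|)).
- near=> y; rewrite rnormc_ge0 /= (le_trans (rnorm_le_ReIm _)) //.
  by case: (c y) (c x) => [? ?] [? ?] /=.
- exact: cvg_cst.
- rewrite [X in _ --> X](_ : _ = `|complex.Re (c x) - complex.Re (c x)| + `|complex.Im (c x) - complex.Im (c x)|);
    last by rewrite !subrr normr0 addr0.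
  apply: cvgD; apply: cvg_norm; apply: cvgB; try exact: cvg_cst.
    exact: cr.
  exact: ci.
Unshelve. all: by end_near.
Qed.

Variables (K : completeNormedModType R[i]) (b : nat -> K).

Definition lcomb N (c : nat -> R[i]) : K := \sum_(n < N) c n *: b n.

Lemma lcombD N c c' : lcomb N (fun n => c n + c' n) = lcomb N c + lcomb N c'.
Proof. by rewrite /lcomb -big_split; apply: eq_bigr => n _; rewrite scalerDl. Qed.

Lemma lcombB N c c' : lcomb N (fun n => c n - c' n) = lcomb N c - lcomb N c'.
Proof. by rewrite /lcomb -sumrB; apply: eq_bigr => n _; rewrite scalerBl. Qed.

Lemma lcombZ N a c : lcomb N (fun n => a * c n) = a *: lcomb N c.
Proof. by rewrite /lcomb scaler_sumr; apply: eq_bigr => n _; rewrite scalerA. Qed.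

Lemma eq_lcomb N c c' : (forall n, (n < N)%N -> c n = c' n) ->
  lcomb N c = lcomb N c'.
Proof. by move=> cc; apply: eq_bigr => n _; rewrite cc. Qed.

Lemma rnorm_lcomb_le N c :
  rnorm (lcomb N c) <= \sum_(n < N) rnorm (c n) * rnorm (b n).
Proof.
rewrite (le_trans (rnorm_sum _ _ _)) //.
by apply: ler_sum => n _; rewrite rnormZ.
Qed.

Lemma continuous_rnorm_lcomb N (c : nat -> R -> R[i]) :
  (forall n, (n < N)%N -> ccont (c n)) ->
  continuous (fun x => rnorm (lcomb N (c ^~ x))).
Proof.
move=> cc x; apply/cvgrPdist_le => eps eps0.
have H : \sum_(n < N) rnorm (c n y - c n x) * rnorm (b n) @[y --> x] --> (0 : R).
  rewrite [X in _ --> X](_ : _ = \sum_(n < N) 0 * rnorm (b n)); last first.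
    by rewrite big1 // => n _; rewrite mul0r.
  apply: cvg_big; first exact: add_continuous.
  by move=> n _; apply: cvgM; [exact: cc|exact: cvg_cst].
move/cvgr0Pnorm_le: H => /(_ _ eps0) H.
near=> y.
rewrite (le_trans (rnorm_dist _ _)) // rnormB_sym -lcombB.
rewrite (le_trans (rnorm_lcomb_le _ _)) // (le_trans (ler_norm _)) //.
by near: y.
Unshelve. all: by end_near.
Qed.

End Cont.

Section Wave.
Variables (R : realType) (K : completeNormedModType R[i]) (b : nat -> K).
Variable lam : nat -> R.
Implicit Types (d : nat -> R[i]) (N : nat).

(** The observed solution, as an exponential sum with values in [K]; [obs] is its
    L^1 norm in time. *)
Definition wave N d (t : R) : K := lcomb b N (fun n => expi (t * lam n) * d n).

Definition obs N d (a c : R) : R := integ a c (fun t => rnorm (wave N d t)).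

Definition ell2 N d : R := Num.sqrt (\sum_(n < N) rnorm (d n) ^+ 2).

Lemma ell2_ge0 N d : 0 <= ell2 N d. Proof. exact: sqrtr_ge0. Qed.

Lemma sum_rnorm2_ge0 N d : 0 <= \sum_(n < N) rnorm (d n) ^+ 2.
Proof. by apply: sumr_ge0 => n _; exact: sqr_ge0. Qed.

Lemma ell2_sqr N d : ell2 N d ^+ 2 = \sum_(n < N) rnorm (d n) ^+ 2.
Proof. by rewrite sqr_sqrtr // sum_rnorm2_ge0. Qed.

Lemma le_ell2 N d d' (k : R) : 0 <= k ->
  (forall n, (n < N)%N -> rnorm (d n) <= k * rnorm (d' n)) ->
  ell2 N d <= k * ell2 N d'.
Proof.
move=> k0 dd; rewrite -(@ler_pXn2r _ 2) ?nnegrE ?mulr_ge0 ?ell2_ge0 //.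
rewrite exprMn !ell2_sqr mulr_sumr; apply: ler_sum => n _.
by rewrite -exprMn ler_pXn2r ?nnegrE ?mulr_ge0 ?rnormc_ge0 ?dd.
Qed.

Lemma ell2_eq N d d' : (forall n, (n < N)%N -> rnorm (d n) = rnorm (d' n)) ->
  ell2 N d = ell2 N d'.
Proof. by move=> dd; congr Num.sqrt; apply: eq_bigr => n _; rewrite dd. Qed.

Lemma ccont_expi (l : R) (z : R[i]) : ccont (fun t => expi (t * l) * z).
Proof.
have [H1 H2] := (fun t => (expi_cvg l t).1, fun t => (expi_cvg l t).2).
apply: ccontP => t; case: z => zr zi /=.
  by apply: cvgB; apply: cvgM; try exact: cvg_cst; [exact: H1|exact: H2].
by apply: cvgD; apply: cvgM; try exact: cvg_cst; [exact: H1|exact: H2].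
Qed.

Lemma continuous_wave N d : continuous (fun t => rnorm (wave N d t)).
Proof. by apply: continuous_rnorm_lcomb => n _; exact: ccont_expi. Qed.

Lemma obs_ge0 N d a c : 0 <= obs N d a c.
Proof. by apply: integ_ge0 => x _; exact: rnorm_ge0. Qed.

Lemma sub_obs N d a c a' c' : a' <= a -> c <= c' -> obs N d a c <= obs N d a' c'.
Proof.
by move=> *; apply: sub_integ => // [|x _]; [exact: continuous_wave|exact: rnorm_ge0].
Qed.

Lemma eq_wave N d d' t : (forall n, (n < N)%N -> d n = d' n) ->
  wave N d t = wave N d' t.
Proof. by move=> dd; apply: eq_lcomb => n nN; rewrite dd. Qed.

Lemma eq_obs N d d' a c : (forall n, (n < N)%N -> d n = d' n) ->
  obs N d a c = obs N d' a c.
Proof. by move=> dd; apply: eq_integ => t _; rewrite (eq_wave _ dd). Qed.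

Lemma wave_shift N d s t :
  wave N (fun n => expi (s * lam n) * d n) t = wave N d (t + s).
Proof. by apply: eq_lcomb => n _; rewrite mulrA -expiD mulrDl. Qed.

Lemma obs_shift N d s a c :
  obs N (fun n => expi (s * lam n) * d n) a c = obs N d (a + s) (c + s).
Proof.
rewrite /obs -[RHS]integ_shift; [|exact: continuous_wave|by move=> x; exact: rnorm_ge0].
by apply: eq_integ => t _; rewrite wave_shift.
Qed.

Lemma ell2Z N (a : R) d : 0 <= a -> ell2 N (fun n => a%:C * d n) = a * ell2 N d.
Proof.
move=> a0; rewrite /ell2.
under eq_bigr do rewrite rnormM exprMn rnorm_real ger0_norm //.
by rewrite -mulr_sumr sqrtrM ?sqr_ge0 // sqrtr_sqr ger0_norm.
Qed.

Lemma obsZ N (a : R) d S T : 0 <= a ->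
  obs N (fun n => a%:C * d n) S T = a * obs N d S T.
Proof.
move=> a0; rewrite -integZ; last exact: continuous_wave.
apply: eq_integ => t _; rewrite -[in RHS](ger0_norm a0) -rnorm_real -rnormZ.
by congr rnorm; rewrite /wave -lcombZ; apply: eq_lcomb => n _; rewrite mulrCA.
Qed.

(** The symbol of a measure with finitely many atoms. Averaging a wave against it
    costs the factor [B] and the time [del] on both sides of the interval. *)
Definition multiplier (del B : R) (m : R -> R[i]) := exists l : seq (R * R[i]),
  [/\ forall p, p \in l -> `|p.1| <= del,
      \sum_(p <- l) rnorm p.2 <= B &
      forall x, m x = \sum_(p <- l) p.2 * expi (p.1 * x)].

Lemma continuous_sum (l : seq (R * R[i])) (f : R * R[i] -> R -> R) :
  (forall p, continuous (f p)) -> continuous (fun x => \sum_(p <- l) f p x).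
Proof.
move=> cf x; apply: cvg_big; first exact: add_continuous.
by move=> p _; exact: cf.
Qed.

Lemma integ_sum (l : seq (R * R[i])) (f : R * R[i] -> R -> R) a c :
  (forall p, continuous (f p)) ->
  integ a c (fun x => \sum_(p <- l) f p x) = \sum_(p <- l) integ a c (f p).
Proof.
move=> cf; elim: l => [|p l IH].
  rewrite big_nil (@eq_integ _ _ _ _ (fun=> 0)) => [|x _]; last by rewrite big_nil.
  by rewrite /integ Rintegral_cst //= mul0r.
rewrite big_cons -IH -integD //; last exact: continuous_sum.
by apply: eq_integ => x _; rewrite big_cons.
Qed.

(** Averaging a wave multiplies its coefficients by the symbol; the bound is the
    triangle inequality in L^1, and each translate stays in the enlarged interval. *)
Lemma multiplier_obs N d del B m a c : multiplier del B m ->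
  obs N (fun n => m (lam n) * d n) a c <= B * obs N d (a - del) (c + del).
Proof.
move=> [l [ls lB lm]].
have cw (p : R * R[i]) : continuous (fun t => rnorm p.2 * rnorm (wave N d (t + p.1))).
  move=> t; apply: cvgM; first exact: cvg_cst.
  apply: (@continuous_comp _ _ _ (fun t => t + p.1) (fun t => rnorm (wave N d t))).
    by apply: cvgD; [exact: cvg_id|exact: cvg_cst].
  exact: continuous_wave.
apply: (@le_trans _ _ (integ a c
    (fun t => \sum_(p <- l) rnorm p.2 * rnorm (wave N d (t + p.1))))).
  apply: le_integ => [||t _]; [exact: continuous_wave|exact: continuous_sum|].
  have -> : wave N (fun n => m (lam n) * d n) t =
      \sum_(p <- l) p.2 *: wave N d (t + p.1).
    rewrite (eq_bigr (fun p : R * R[i] =>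
      lcomb b N (fun n => p.2 * (expi ((t + p.1) * lam n) * d n)))); last first.
      by move=> p _; rewrite lcombZ.
    rewrite exchange_big /=; apply: eq_bigr => n _.
    rewrite -scaler_suml; congr (_ *: _).
    rewrite lm mulr_suml mulr_sumr; apply: eq_bigr => p _.
    by rewrite mulrDl expiD; ring.
  rewrite (le_trans (rnorm_sum _ _ _)) //.
  by apply: ler_sum => p _; rewrite rnormZ.
rewrite integ_sum // (@le_trans _ _ (\sum_(p <- l) rnorm p.2 * obs N d (a - del) (c + del))) //.
  rewrite !big_seq; apply: ler_sum => p pl.
  rewrite integZ; last first.
    move=> t; apply: (@continuous_comp _ _ _ (fun t => t + p.1) (fun t => rnorm (wave N d t))).
      by apply: cvgD; [exact: cvg_id|exact: cvg_cst].
    exact: continuous_wave.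
  rewrite ler_wpM2l ?rnormc_ge0 // (@integ_shift _ _ _ (fun t => rnorm (wave N d t))).
  - have := ls _ pl; rewrite ler_norml => /andP[? ?].
    by apply: sub_obs; rewrite lerD2l.
  - exact: continuous_wave.
  - by move=> x; exact: rnorm_ge0.
by rewrite -mulr_suml ler_wpM2r ?obs_ge0.
Qed.

Lemma multiplier1 : multiplier 0 1 (fun=> 1).
Proof.
exists [:: (0, 1)]; split=> [p|| x].
- by rewrite inE => /eqP -> /=; rewrite normr0.
- by rewrite big_seq1 /= rnormc1.
- by rewrite big_seq1 /= mul0r expi0 mulr1.
Qed.

Lemma multiplierB del B m B' m' :
  multiplier del B m -> multiplier del B' m' ->
  multiplier del (B + B') (fun x => m x - m' x).
Proof.
move=> [l [ls lB lm]] [l' [ls' lB' lm']].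
exists (l ++ [seq (q.1, - q.2) | q <- l']); split.
- move=> p; rewrite mem_cat => /orP[/ls //|/mapP[q /ls' ? -> //]].
- rewrite big_cat big_map /= lerD //.
  by under eq_bigr do rewrite /rnorm normrN.
- move=> x; rewrite big_cat big_map /= lm lm'; congr (_ + _).
  by rewrite -sumrN; apply: eq_bigr => q _; rewrite mulNr.
Qed.

Lemma multiplierW del del' B m : del <= del' -> multiplier del B m ->
  multiplier del' B m.
Proof.
by move=> dd [l [ls lB lm]]; exists l; split=> // p /ls /le_trans; apply.
Qed.

End Wave.

(** * Vieta's cosine products *)

Section CosGap.
Variable R : realType.
Implicit Types x t : R.

Definition cosgap : R := Num.min (cos 1 ^+ 2 / 2) ((1 - cos 1) / 16).

Lemma cosgap_gt0 : 0 < cosgap.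
Proof.
rewrite lt_min; apply/andP; split.
  by rewrite divr_gt0 // exprn_gt0 // cos1_gt0.
rewrite divr_gt0 // subr_gt0 -[ltRHS]cos0 ltr_cos ?in_itv /= ?lexx ?pi_ge0 //.
by rewrite ler01 /= (le_trans _ (pi_ge2 R)) // (ler_nat _ 1 2).
Qed.

Lemma cosgap_le : cosgap <= 1 / 2.
Proof.
by rewrite ge_min; apply/orP; left; rewrite ler_pM2r // expr_le1 ?cos_le1 // ltW // cos1_gt0.
Qed.

Lemma cos_ub t : 1 - cos t <= t ^+ 2 / 2.
Proof.
have := expi_dist t 0; rewrite cos0 sin0 !subr0.
by have := cos2Dsin2 t; nra.
Qed.

(** On [0, 1] this is the mean value theorem for the sine; beyond, the cosine
    stays below [cos 1] up to [pi], and t^2 is at most 16. *)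
Lemma cos_lb t : `|t| <= pi -> cosgap * t ^+ 2 <= 1 - cos t.
Proof.
rewrite -(cos_norm t) -(real_normK (num_real t)); move: `|t| (normr_ge0 t) => {}t t0 tpi.
have pi4 : (pi : R) < 4 by have := pihalf_lt2 R; lra.
have [t1|t1] := leP t 1.
  have st : t / 2 * cos 1 <= sin (t / 2).
    have ds : forall x, x \in `]0, (t / 2)[%R -> is_derive x 1 (@sin R) (cos x).
      by move=> x' _; exact: is_derive_sin.
    have cs : {within `[0, t / 2], continuous (@sin R)}.
      by apply: continuous_subspaceT; exact: continuous_sin.
    have t20 : 0 <= t / 2 by lra.
    have [c] := MVT_segment t20 ds cs.
    rewrite in_itv /= => /andP[c0 ct]; rewrite sin0 !subr0 => ->.
    rewrite mulrC ler_wpM2r // -?(ler_cos) //.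
    have pi2 := pi_ge2 R.
    case: (ltgtP c 1) => [c1|c1|-> //]; last by exfalso; lra.
    by rewrite ltW // ltr_cos // in_itv /=; apply/andP; split; lra.
  have st0 : 0 <= t / 2 * cos 1 by rewrite mulr_ge0 ?(ltW (cos1_gt0 R)) //; lra.
  have -> : 1 - cos t = 2 * sin (t / 2) ^+ 2.
    have {1}-> : t = (t / 2) *+ 2 by rewrite -mulr_natr; field.
    by rewrite cos_mulr2n; have := cos2Dsin2 (t / 2); lra.
  have H : (t / 2 * cos 1) ^+ 2 <= sin (t / 2) ^+ 2.
    by rewrite ler_pXn2r ?nnegrE // (le_trans st0).
  have c1 : cosgap <= cos 1 ^+ 2 / 2 by rewrite ge_min lexx.
  have : cosgap * t ^+ 2 <= cos 1 ^+ 2 / 2 * t ^+ 2 by rewrite ler_wpM2r ?sqr_ge0.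
  by move: H; rewrite exprMn => H; nra.
have c1 : cosgap <= (1 - cos 1) / 16 by rewrite ge_min lexx orbT.
have ct : cos t <= cos 1.
  by rewrite ltW // ltr_cos // in_itv /=; apply/andP; split; lra.
have : cosgap * t ^+ 2 <= (1 - cos 1) / 16 * t ^+ 2 by rewrite ler_wpM2r ?sqr_ge0.
have t16 : t ^+ 2 <= 16 by nra.
have := cos_le1 (1 : R); nra.
Qed.

(** The infinite product is (sin (x / 2) / (x / 2))^2. Each factor is the symbol of
    a positive measure with three atoms, so the finite product has the same sign
    and decay as this Fejer-type symbol on a range that grows with [p], and is the
    symbol of a finite measure of mass 1 whose support does not grow with [p]. *)
Definition vieta p x : R := \prod_(i < p) ((1 + cos (x / 2 ^+ i.+1)) / 2).

Lemma vietaS p x : vieta p.+1 x = vieta p x * ((1 + cos (x / 2 ^+ p.+1)) / 2).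
Proof. by rewrite /vieta big_ord_recr. Qed.

(** Iterating 1 - cos (2 t) = 2 (1 - cos t) (1 + cos t). *)
Lemma vieta_telescope p x :
  (1 - cos (x / 2 ^+ p)) * (4 ^+ p * vieta p x) = 1 - cos x.
Proof.
elim: p => [|p IH]; first by rewrite /vieta big_ord0 !expr0 divr1 !mulr1.
rewrite -{}[RHS]IH vietaS.
have -> : x / 2 ^+ p = (x / 2 ^+ p.+1) *+ 2.
  by rewrite -mulr_natr exprS; field; rewrite expf_neq0.
by rewrite cos_mulr2n (exprS 4); move: (cos _) (vieta _ _) (4 ^+ p) => *; field.
Qed.

Lemma vieta_factor_ge0 x : 0 <= (1 + cos x) / 2.
Proof. by have := cos_geN1 x; lra. Qed.

Lemma vieta_factor_le1 x : (1 + cos x) / 2 <= 1.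
Proof. by have := cos_le1 x; lra. Qed.

Lemma vieta_ge0 p x : 0 <= vieta p x.
Proof. by apply: prodr_ge0 => i _; exact: vieta_factor_ge0. Qed.

Lemma vieta_le1 p x : vieta p x <= 1.
Proof.
by apply: prodr_ile1 => i _; rewrite vieta_factor_ge0 vieta_factor_le1.
Qed.

Lemma vieta0 p : vieta p 0 = 1.
Proof. by rewrite /vieta big1 // => i _; rewrite mul0r cos0; field. Qed.

Lemma vieta_le_factor p x i : (i < p)%N ->
  vieta p x <= (1 + cos (x / 2 ^+ i.+1)) / 2.
Proof.
move=> ip; rewrite /vieta (bigD1 (Ordinal ip)) //= ler_piMr ?vieta_factor_ge0 //.
by apply: prodr_ile1 => j _; rewrite vieta_factor_ge0 vieta_factor_le1.
Qed.

(** The finite product is periodic, so the quadratic decay can only hold on a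
    bounded range; [p] is chosen once the frequencies of a finite sum are known,
    and the bound itself does not depend on [p]. *)
Lemma vieta_decay p x : `|x| <= 2 ^+ p * pi -> cosgap * x ^+ 2 * vieta p x <= 2.
Proof.
move=> xp; have := vieta_telescope p x.
have p0 : 0 < 2 ^+ p :> R by rewrite exprn_gt0.
have : cosgap * (x / 2 ^+ p) ^+ 2 <= 1 - cos (x / 2 ^+ p).
  by apply: cos_lb; rewrite normrM normfV (gtr0_norm p0) ler_pdivrMr // mulrC.
have -> : (x / 2 ^+ p) ^+ 2 = x ^+ 2 / 4 ^+ p.
  by rewrite exprMn exprVn -exprM mulnC exprM; congr (_ / _ ^+ _); ring.
move=> H E; have := cos_geN1 x => cx.
have q0 : 0 < 4 ^+ p :> R by rewrite exprn_gt0.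
have : cosgap * (x ^+ 2 / 4 ^+ p) * (4 ^+ p * vieta p x) <= 2.
  apply: (@le_trans _ _ (1 - cos x)); last by lra.
  by rewrite -E ler_wpM2r // mulr_ge0 ?vieta_ge0 // ltW.
by rewrite (_ : _ * _ = cosgap * x ^+ 2 * vieta p x) //; field; rewrite lt0r_neq0.
Qed.

Lemma vieta_lb p x : `|x| <= pi -> 2 * cosgap <= vieta p x.
Proof.
move=> xp; have [->|x0] := eqVneq x 0.
  by rewrite vieta0; have := cosgap_le; lra.
have := vieta_telescope p x; have := cos_lb xp; have := cos_ub (x / 2 ^+ p).
have -> : (x / 2 ^+ p) ^+ 2 = x ^+ 2 / 4 ^+ p.
  by rewrite exprMn exprVn -exprM mulnC exprM; congr (_ / _ ^+ _); ring.
have q0 : 0 < 4 ^+ p :> R by rewrite exprn_gt0.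
move=> H1 H2 E; have x20 : 0 < x ^+ 2 by rewrite exprn_even_gt0.
have H : 1 - cos x <= x ^+ 2 / 2 * vieta p x.
  rewrite -E (_ : _ / 2 * _ = x ^+ 2 / 4 ^+ p / 2 * (4 ^+ p * vieta p x)).
    by rewrite ler_wpM2r // mulr_ge0 ?vieta_ge0 // ltW.
  by field; rewrite lt0r_neq0.
have : x ^+ 2 * (2 * cosgap) <= x ^+ 2 * vieta p x by lra.
by rewrite ler_pM2l.
Qed.

(** By [vieta_telescope] the product vanishes where [cos x] is 1, as long as the
    denominator does not, which is the case before the first period ends. *)
Lemma vieta_zero p x (k : nat) : (0 < k)%N -> (2 * k <= 2 ^ p)%N ->
  `|x| = 2 * pi * k%:R -> vieta p x = 0.
Proof.
move=> k0 kp xE; have := vieta_telescope p x.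
have p0 : 0 < 2 ^+ p :> R by rewrite exprn_gt0.
have q0 : 0 < 4 ^+ p :> R by rewrite exprn_gt0.
have -> : cos x = 1.
  rewrite -cos_norm xE (_ : 2 * pi * k%:R = 0 + (pi *+ 2) *+ k); last first.
    by rewrite add0r -(mulr_natr (pi *+ 2)) -(mulr_natl pi).
  rewrite (@periodicn _ _ (@cos R)) ?cos0 //; exact: cosD2pi.
rewrite subrr => /eqP; rewrite mulf_eq0 => /orP[/eqP E|]; last first.
  by rewrite mulf_eq0 => /orP[|/eqP //]; rewrite gt_eqF.
exfalso; have : cosgap * (x / 2 ^+ p) ^+ 2 <= 1 - cos (x / 2 ^+ p).
  apply: cos_lb; rewrite normrM normfV (gtr0_norm p0) ler_pdivrMr // xE.
  rewrite mulrAC [leRHS]mulrC ler_wpM2r ?pi_ge0 //.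
  by rewrite -natrM -natrX ler_nat.
rewrite E leNgt mulr_gt0 ?cosgap_gt0 //.
rewrite exprn_even_gt0 //= mulf_neq0 ?invr_eq0 ?(gt_eqF p0) //.
rewrite -normr_eq0 xE !mulf_neq0 ?pnatr_eq0 -?lt0n //.
by rewrite gt_eqF // pi_gt0.
Qed.

Lemma exists_pow2 x : exists p, x <= 2 ^+ p.
Proof.
exists (Num.Def.archi_bound `|x|).
have := archi_boundP (normr_ge0 x) => /ltW; set m := Num.Def.archi_bound _ => xm.
rewrite (le_trans (ler_norm x)) // (le_trans xm) //.
by rewrite -natrX ler_nat ltnW // ltn_expl.
Qed.

(** A bound that is uniform in [p]: far from 0 it comes from the quadratic decay,
    and on the remaining bounded range one well chosen factor, whose argument
    lies in the basic interval, is already away from 1. *)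
Lemma vieta_gap (eta : R) : 0 < eta -> exists g i0, [/\ 0 < g, g <= 1 &
  forall p x, (i0 <= p)%N -> eta <= `|x| -> `|x| <= 2 ^+ p * pi ->
    vieta p x <= 1 - g].
Proof.
move=> eta0; have c0 := cosgap_gt0; have cle := cosgap_le.
have [i0 i0P] := exists_pow2 (2 / cosgap).
have q0 : 0 < 4 ^+ i0.+1 :> R by rewrite exprn_gt0.
have p0 : 0 < 2 ^+ i0.+1 :> R by rewrite exprn_gt0.
(* Half of the lower bound for 1 - cos at eta / 2 ^ i0.+1. *)
pose g0 := cosgap * eta ^+ 2 / 4 ^+ i0.+1 / 2.
have g00 : 0 < g0 by rewrite !divr_gt0 // mulr_gt0 // exprn_gt0.
exists (Num.min g0 (1 / 2)), i0.+1; split.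
- by rewrite lt_min g00; lra.
- by rewrite ge_min; apply/orP; right; lra.
move=> p x pi0 ex xp.
have [xb|xb] := leP (2 / cosgap) `|x|.
  have H : vieta p x <= 1 / 2.
    have := vieta_decay xp.
    have : 4 <= cosgap * x ^+ 2.
      rewrite -(real_normK (num_real x)).
      have : (2 / cosgap) ^+ 2 <= `|x| ^+ 2.
        by rewrite ler_pXn2r ?nnegrE // divr_ge0 // ltW.
      move=> /(ler_wpM2l (ltW c0)); apply: le_trans.
      rewrite (_ : cosgap * (2 / cosgap) ^+ 2 = 4 / cosgap); last first.
        by move: (cosgap) c0 => c c0; field; rewrite lt0r_neq0.
      by rewrite ler_pdivlMr //; lra.
    by have := vieta_ge0 p x; nra.
  have : Num.min g0 (1 / 2) <= 1 / 2 by rewrite ge_min lexx orbT.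
  by lra.
have H := vieta_le_factor x pi0.
have xs : `|x / 2 ^+ i0.+1| <= pi.
  rewrite normrM normfV (gtr0_norm p0) ler_pdivrMr //.
  rewrite (le_trans (ltW xb)) // (le_trans i0P) //.
  rewrite exprS; have := pi_ge2 R.
  have : 0 < 2 ^+ i0 :> R by rewrite exprn_gt0.
  by nra.
have := cos_lb xs.
have -> : (x / 2 ^+ i0.+1) ^+ 2 = x ^+ 2 / 4 ^+ i0.+1.
  by rewrite exprMn exprVn -exprM mulnC exprM; congr (_ / _ ^+ _); ring.
have : cosgap * eta ^+ 2 / 4 ^+ i0.+1 <= cosgap * (x ^+ 2 / 4 ^+ i0.+1).
  rewrite -mulrA ler_wpM2l ?(ltW c0) // ler_pM2r ?invr_gt0 //.
  by rewrite -(real_normK (num_real x)) ler_pXn2r ?nnegrE // ltW.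
have : Num.min g0 (1 / 2) <= g0 by rewrite ge_min lexx.
by rewrite /g0; lra.
Qed.

End CosGap.

(** * Positive kernels and plateaus *)

Section Fejer.
Variable R : realType.
Implicit Types (X Y : R -> R) (del x : R).

(** Symbols of positive finite measures: positivity makes the mass equal to the
    value of the symbol at 0. *)
Definition pkernel del X := exists l : seq (R * R),
  (forall p, p \in l -> `|p.1| <= del /\ 0 <= p.2) /\
  forall x, (X x)%:C = \sum_(p <- l) p.2%:C * expi (p.1 * x).

Lemma pkernel_factor (s : R) : 0 <= s ->
  pkernel s (fun x => (1 + cos (s * x)) / 2).
Proof.
move=> s0; exists [:: (- s, 1 / 4); (0, 1 / 2); (s, 1 / 4)]; split.
  by move=> p; rewrite !inE => /or3P[] /eqP -> /=; rewrite ?normrN ?normr0 ?ger0_norm.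
move=> x; rewrite !big_cons big_nil /= mul0r expi0 mulNr /expi cosN sinN.
by apply/eqP; rewrite eq_complex /=; apply/andP; split; apply/eqP; field.
Qed.

Lemma pkernelM del X del' Y : pkernel del X -> pkernel del' Y ->
  pkernel (del + del') (fun x => X x * Y x).
Proof.
move=> [l [ls lX]] [l' [ls' lY]].
exists [seq (p.1 + q.1, p.2 * q.2) | p <- l, q <- l']; split.
  move=> p /allpairsP[[u v] /= [/ls[u1 u2] /ls'[v1 v2] ->]] /=; split.
    by rewrite (le_trans (ler_normD _ _)) // lerD.
  exact: mulr_ge0.
move=> x; rewrite big_allpairs_dep rmorphM /= lX lY mulr_suml; apply: eq_bigr => p _.
rewrite mulr_sumr; apply: eq_bigr => q _ /=.
by rewrite mulrDl expiD rmorphM /=; ring.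
Qed.

Lemma pkernelW del del' X : del <= del' -> pkernel del X -> pkernel del' X.
Proof.
by move=> dd [l [ls lX]]; exists l; split=> // p /ls[p1 p2]; split=> //; exact: le_trans dd.
Qed.

Lemma pkernel1 : pkernel 0 (fun=> 1).
Proof.
exists [:: (0, 1)]; split=> [p|x].
  by rewrite inE => /eqP -> /=; rewrite normr0.
by rewrite big_seq1 /= mul0r expi0 mulr1.
Qed.

Lemma pkernelX del X m : pkernel del X -> pkernel (m%:R * del) (fun x => X x ^+ m).
Proof.
move=> kX; elim: m => [|m IH].
  by rewrite mul0r; exact: pkernel1.
rewrite -natr1 mulrDl mul1r addrC.
under eq_fun do rewrite exprS.
exact: pkernelM.
Qed.

Lemma pkernel_vieta p h : 0 <= h -> pkernel h (fun x => vieta p (h * x)).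
Proof.
move=> h0; apply: (@pkernelW (h * (1 - (2 ^+ p)^-1))).
  by rewrite ler_piMr // gerBl invr_ge0 exprn_ge0.
elim: p => [|p IH].
  rewrite expr0 invr1 subrr mulr0; under eq_fun do rewrite /vieta big_ord0.
  exact: pkernel1.
have -> : h * (1 - (2 ^+ p.+1)^-1) = h * (1 - (2 ^+ p)^-1) + h / 2 ^+ p.+1.
  by rewrite exprS; field; rewrite expf_neq0.
under eq_fun do rewrite vietaS mulrAC.
by apply: pkernelM => //; apply: pkernel_factor; rewrite divr_ge0 ?exprn_ge0.
Qed.

(** Averaging the translates of a symbol over the differences of a grid of step
    [w] and size [J] spreads its bump into a plateau of width about [J * w]. *)
Definition fejer X J (x w : R) : R :=
  J%:R^-1 * \sum_(j < J) \sum_(l < J) X (x + (j%:R - l%:R) * w).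

Lemma expi_natM (s w : R) (j l : nat) :
  expi (s * ((j%:R - l%:R) * w)) = expi (s * (j%:R * w)) * (expi (s * (l%:R * w)))^*%C.
Proof.
rewrite mulrBl mulrBr expiD; congr (_ * _).
by rewrite /expi cosN sinN.
Qed.

(** On the side of the measure, this averaging multiplies each atom by the squared
    modulus of a geometric sum divided by [J], which is nonnegative. The mass is
    therefore still the value at 0, and the modulation by [c] does not change it. *)
Lemma fejer_multiplier del X J w c : pkernel del X ->
  multiplier del (fejer X J 0 w) (fun x => (fejer X J (x - c) w)%:C).
Proof.
move=> [l [ls lX]].
pose S (s : R) : R[i] := \sum_(j < J) expi (s * (j%:R * w)).
pose F (s : R) : R := J%:R^-1 * rnorm (S s) ^+ 2.
have F0 s : 0 <= F s by rewrite mulr_ge0 ?invr_ge0 ?sqr_ge0.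
have FE s : (F s)%:C = J%:R^-1%:C *
    \sum_(j < J) \sum_(k < J) expi (s * ((j%:R - k%:R) * w)).
  rewrite /F rmorphM /= rmorphXn /= -rnormcE; congr (_ * _).
  rewrite sqr_normc /S rmorph_sum mulr_suml; apply: eq_bigr => j _.
  rewrite mulr_sumr; apply: eq_bigr => k _.
  by rewrite expi_natM.
have key x : (fejer X J x w)%:C = \sum_(p <- l) p.2%:C * expi (p.1 * x) * (F p.1)%:C.
  rewrite /fejer rmorphM /= rmorph_sum /=.
  under eq_bigr do rewrite rmorph_sum /=.
  under eq_bigr do under eq_bigr do rewrite lX.
  under [in RHS]eq_bigr do rewrite FE.
  under eq_bigr do rewrite exchange_big.
  rewrite exchange_big /= mulr_sumr; apply: eq_bigr => p _.
  rewrite [in RHS]mulrCA; congr (_ * _).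
  rewrite mulr_sumr; apply: eq_bigr => j _; rewrite mulr_sumr; apply: eq_bigr => k _.
  by rewrite mulrDr expiD mulrA.
exists [seq (p.1, p.2%:C * expi (- (p.1 * c)) * (F p.1)%:C) | p <- l]; split.
- by move=> p /mapP[q /ls[q1 _] ->].
- rewrite big_map /= -lecR key rmorph_sum /= le_eqVlt; apply/orP; left; apply/eqP.
  rewrite !big_seq; apply: eq_bigr => p /ls[_ p2].
  rewrite mulr0 expi0 mulr1 !rnormM rnormc_expi mulr1 !rnorm_real !ger0_norm //.
  by rewrite rmorphM.
- move=> x; rewrite key big_map /=; apply: eq_bigr => p _.
  by rewrite mulrBr expiD; ring.
Qed.

End Fejer.

(** * Gram matrices and observable tails *)

Section Gram.
Variables (R : realType) (K : completeNormedModType R[i]).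
Variable dotK : {dot K for (@Num.conj R[i])}.
Hypothesis hK : hilbert_dot dotK.

Lemma dotDr (x y z : K) : dotK x (y + z) = dotK x y + dotK x z.
Proof. exact: linearDr. Qed.

Lemma dotDl (x y z : K) : dotK (x + y) z = dotK x z + dotK y z.
Proof. exact: linearDl. Qed.

Lemma dotC (x y : K) : dotK x y = (dotK y x)^*%C.
Proof. by rewrite hermC expr0 mul1r. Qed.

Lemma dotE (x : K) : dotK x x = (rnorm x ^+ 2)%:C.
Proof. by rewrite -hK rnormE rmorphXn. Qed.

Lemma dotZl a (x y : K) : dotK (a *: x) y = a * dotK x y.
Proof. by rewrite linearZl_LR. Qed.

Lemma dotZr a (x y : K) : dotK x (a *: y) = a^*%C * dotK x y.
Proof. by rewrite dotC dotZl rmorphM /= -dotC. Qed.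

Lemma dot0r (x : K) : dotK x 0 = 0. Proof. exact: linear0r. Qed.

Lemma dot_suml (I : Type) (r : seq I) (F : I -> K) y :
  dotK (\sum_(i <- r) F i) y = \sum_(i <- r) dotK (F i) y.
Proof. exact: linear_sumlz. Qed.

Lemma mulc_conj (z : R[i]) : z * z^*%C = (rnorm z ^+ 2)%:C.
Proof. by rewrite -sqr_normc rnormcE rmorphXn. Qed.

Lemma rnorm_dot (x y : K) : rnorm (dotK x y) <= rnorm x * rnorm y.
Proof.
have [->|y0] := eqVneq y 0.
  by rewrite dot0r rnormc0 mulr_ge0 ?rnorm_ge0.
have ry : 0 < rnorm y by rewrite lt_def rnorm_ge0 rnorm_eq0 y0.
rewrite -(@ler_pXn2r _ 2) ?nnegrE ?mulr_ge0 ?rnormc_ge0 ?rnorm_ge0 //.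
pose w := (rnorm y ^+ 2)%:C *: x + (- dotK x y) *: y.
have cr (a : R) : (a%:C)^*%C = a%:C by rewrite conjc_real.
have E : dotK w w = (rnorm y ^+ 2 * ((rnorm x * rnorm y) ^+ 2 - rnorm (dotK x y) ^+ 2))%:C.
  rewrite /w dotDl !dotDr !dotZl !dotZr !dotE (dotC y x).
  rewrite cr rmorphN /=.
  rewrite [RHS]rmorphM rmorphB /= -mulc_conj exprMn !rmorphM /=.
  by move: (dotK x y) (_^*%C) => z z'; ring.
have : 0 <= rnorm y ^+ 2 * ((rnorm x * rnorm y) ^+ 2 - rnorm (dotK x y) ^+ 2).
  by rewrite -lecR -E dotE lecR sqr_ge0.
by rewrite pmulr_rge0 ?subr_ge0 // exprn_gt0.
Qed.

Lemma ell2_le_const N (d : nat -> R[i]) (c : R) : 0 <= c ->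
  (forall n, (n < N)%N -> rnorm (d n) <= c) -> ell2 N d <= N%:R * c.
Proof.
move=> c0 dc; rewrite -(@ler_pXn2r _ 2) ?nnegrE ?mulr_ge0 ?ell2_ge0 //.
rewrite ell2_sqr (@le_trans _ _ (\sum_(n < N) c ^+ 2)) //.
  by apply: ler_sum => n _; rewrite ler_pXn2r ?nnegrE ?rnormc_ge0 ?dc.
rewrite sumr_const card_ord -(mulr_natl (c ^+ 2)) exprMn ler_wpM2r ?sqr_ge0 //.
by rewrite -natrX ler_nat; case: (N) => // m; rewrite expnS expn1 leq_pmulr.
Qed.

(** The coefficients are recovered from the scalar products with the [c i] by the
    inverse of the Gram matrix, which is invertible because the family is free. *)
Lemma gram_bound k (c : nat -> K) :
  (forall d, lcomb c k d = 0 -> forall i, (i < k)%N -> d i = 0) ->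
  exists2 M, 0 <= M & forall d, ell2 k d <= M * rnorm (lcomb c k d).
Proof.
move=> free.
pose G : 'M[R[i]]_k := \matrix_(i, j) dotK (c i) (c j).
have vG (v : 'rV[R[i]]_k) (d : nat -> R[i]) : (forall i : 'I_k, v 0 i = d i) ->
    forall j, (v *m G) 0 j = dotK (lcomb c k d) (c j).
  move=> vd j; rewrite mxE dot_suml; apply: eq_bigr => i _.
  by rewrite vd mxE dotZl.
have Gu : G \in unitmx.
  rewrite -row_free_unit -kermx_eq0; apply/rowV0P => v /sub_kermxP vG0.
  pose d (i : nat) : R[i] := if insub i is Some j then v 0 j else 0.
  have vd (i : 'I_k) : v 0 i = d i by rewrite /d valK.
  have l0 : lcomb c k d = 0.
    apply/eqP; rewrite -rnorm_eq0 -sqrf_eq0 -(inj_eq (@complexI R)) -dotE.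
    rewrite {2}/lcomb dotC dot_suml big1 ?conjc0 // => j _.
    by rewrite dotZl dotC -(vG _ _ vd) vG0 mxE conjc0 mulr0.
  by apply/rowP => i; rewrite vd (free _ l0) // mxE.
pose M : R := \sum_(j < k) \sum_(i < k) rnorm (c i) * rnorm (invmx G i j).
have M0 : 0 <= M.
  by do 2 (apply: sumr_ge0 => ? _); rewrite mulr_ge0 ?rnorm_ge0 ?rnormc_ge0.
exists (k%:R * M); first by rewrite mulr_ge0.
move=> d; rewrite -mulrA; apply: ell2_le_const.
  by rewrite mulr_ge0 ?rnorm_ge0.
move=> n nk; pose v : 'rV[R[i]]_k := \row_i d i.
have vd (i : 'I_k) : v 0 i = d i by rewrite mxE.
have : v = v *m G *m invmx G by rewrite mulmxK.
move=> /(congr1 (fun w : 'rV_k => w 0 (Ordinal nk))); rewrite vd mxE /= => ->.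
rewrite (le_trans (rnormc_sum _ _ _)) // mulr_suml [leRHS](bigD1 (Ordinal nk)) //=.
rewrite -[leLHS]addr0 lerD //; last first.
  apply: sumr_ge0 => j _; rewrite mulr_ge0 ?rnorm_ge0 //.
  by apply: sumr_ge0 => i _; rewrite mulr_ge0 ?rnorm_ge0 ?rnormc_ge0.
rewrite mulr_suml; apply: ler_sum => i _.
rewrite rnormM (vG _ _ vd) mulrAC ler_wpM2r ?rnormc_ge0 // mulrC.
exact: rnorm_dot.
Qed.

End Gram.

Section Observable.
Variables (R : realType) (K : completeNormedModType R[i]).
Variables (b : nat -> K) (lam : nat -> R).

(** The constant is uniform in the number [N] of terms, so that it will pass to
    infinite sums. *)
Definition observable (n0 : nat) (T : R) := exists2 C, 0 < C &
  forall N d, (forall n, (n < n0)%N -> d n = 0) ->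
    ell2 N d <= C * obs b lam N d 0 T.

(** Translating in time only changes the phases of the coefficients. *)
Lemma observable_shift n0 T C s N d :
  (forall N d, (forall n, (n < n0)%N -> d n = 0) ->
    ell2 N d <= C * obs b lam N d 0 T) ->
  (forall n, (n < n0)%N -> d n = 0) ->
  ell2 N d <= C * obs b lam N d s (s + T).
Proof.
move=> H d0.
have := H N (fun n => expi (s * lam n) * d n).
rewrite obs_shift add0r addrC (@ell2_eq _ _ _ d) => [->//|n _]; last first.
  by rewrite rnormM rnormc_expi mul1r.
by move=> n /d0 ->; rewrite mulr0.
Qed.

Lemma multiplier_vieta (p : nat) (h mu : R) (m : nat) : 0 <= h ->
  multiplier (m%:R * h) 1 (fun x => (vieta p (h * (x - mu)) ^+ m)%:C).
Proof.
move=> h0.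
have := fejer_multiplier 1 0 mu (pkernelX m (pkernel_vieta p h0)).
rewrite /fejer !big_ord1 subrr mul0r addr0 mulr0 vieta0 expr1n invr1 mulr1.
congr (multiplier _ _ _); apply/funext => x.
by rewrite !big_ord1 mul1r subrr mul0r addr0.
Qed.

(** The range on which the product of [p] factors decays can be made to contain
    finitely many given frequencies. *)
Lemma exists_vieta_range h mu N i0 : exists2 p, (i0 <= p)%N &
  forall n, (n < N)%N -> `|h * (lam n - mu)| <= 2 ^+ p * pi.
Proof.
have [q qP] := exists_pow2 (\sum_(n < N) `|h * (lam n - mu)|).
exists (q + i0)%N; first exact: leq_addl.
move=> n nN; rewrite (@le_trans _ _ (2 ^+ q)) //.
  apply: le_trans qP; rewrite (bigD1 (Ordinal nN)) //= lerDl.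
  by apply: sumr_ge0.
have q0 : 0 < 2 ^+ q :> R by rewrite exprn_gt0.
have q1 : 1 <= 2 ^+ i0 :> R by rewrite exprn_ege1 // ler1n.
rewrite exprD -mulrA ler_peMr ?(ltW q0) //.
by have := pi_ge2 R; nra.
Qed.

End Observable.

(** * Low frequencies: Haraux's method *)

Section Haraux.
Variables (R : realType) (K : completeNormedModType R[i]).
Variable dotK : {dot K for (@Num.conj R[i])}.
Hypothesis hK : hilbert_dot dotK.
Variables (b : nat -> K) (lam : nat -> R).
Hypothesis lam0 : forall n, 0 < lam n.
Variables (e : nat) (C0 : R).
Hypothesis C00 : 0 <= C0.
Hypothesis admissible : forall N d,
  rnorm (lcomb b N d) <= C0 * ell2 N (fun n => (1 + lam n)%:C ^+ e * d n).

Lemma ell2_split N (P : pred nat) (d : nat -> R[i]) :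
  ell2 N d <= ell2 N (fun n => if P n then d n else 0) +
              ell2 N (fun n => if P n then 0 else d n).
Proof.
rewrite -(@ler_pXn2r _ 2) ?nnegrE ?addr_ge0 ?ell2_ge0 //.
apply: (@le_trans _ _ (ell2 N (fun n => if P n then d n else 0) ^+ 2 +
              ell2 N (fun n => if P n then 0 else d n) ^+ 2)).
  rewrite !ell2_sqr -big_split /=; apply: ler_sum => n _.
  by case: (P n); rewrite rnormc0 expr0n ?addr0 ?add0r.
rewrite sqrrD; set x := ell2 _ _; set y := ell2 _ _.
have : 0 <= x * y by rewrite mulr_ge0 ?ell2_ge0.
by lra.
Qed.

(** A coefficient that beats the [e] powers of the frequency lost by the
    observation makes the wave bounded at every time. *)
Lemma rnorm_wave_ell2 N d d' t (c : R) : 0 <= c ->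
  (forall n, (n < N)%N -> (1 + lam n) ^+ e * rnorm (d n) <= c * rnorm (d' n)) ->
  rnorm (wave b lam N d t) <= C0 * c * ell2 N d'.
Proof.
move=> c0 H; rewrite (le_trans (admissible _ _)) // -mulrA ler_wpM2l //.
apply: le_ell2 => // n nN.
rewrite !rnormM rnormc_expi mul1r rnormX rnorm_real ger0_norm ?H //.
by rewrite addr_ge0 // ltW.
Qed.

(** One factor of this kind gains one power of the frequency. *)
Lemma vieta_smoothing (mu eta h : R) : 0 < mu -> 0 < eta -> 0 < h ->
  exists2 A, 0 <= A & forall p x, mu + eta <= x ->
    `|h * (x - mu)| <= 2 ^+ p * pi -> (1 + x) * vieta p (h * (x - mu)) <= A.
Proof.
move=> mu0 eta0 h0; have c0 := cosgap_gt0 R.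
pose B := 2 / (cosgap R * h ^+ 2 * eta).
have ch0 : 0 < cosgap R * h ^+ 2 by rewrite mulr_gt0 // exprn_gt0.
have B0 : 0 < B by rewrite divr_gt0 // mulr_gt0.
exists (1 + mu + B); first by rewrite addr_ge0 ?addr_ge0 // ltW.
move=> p x xmu xp.
have := vieta_decay xp; set v := vieta _ _ => H.
have v0 : 0 <= v by exact: vieta_ge0.
have v1 : v <= 1 by exact: vieta_le1.
have : (x - mu) * v <= B.
  rewrite /B ler_pdivlMr; last by rewrite mulr_gt0.
  apply: le_trans H; rewrite exprMn.
  have s0 : eta <= x - mu by lra.
  rewrite (_ : _ * v = cosgap R * h ^+ 2 * ((x - mu) * v) * (x - mu)); last by ring.
  rewrite (_ : _ * (_ * eta) = cosgap R * h ^+ 2 * ((x - mu) * v) * eta); last by ring.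
  by rewrite ler_wpM2l // mulr_ge0 ?(ltW ch0) // mulr_ge0 //; lra.
have : (1 + mu) * v <= 1 + mu by rewrite ler_piMr // addr_ge0 // ltW.
by nra.
Qed.

(** Haraux's argument: [n1 .. n0 - 1] is the block of the eigenvalue [mu], which
    [eta] separates from the larger ones. *)
Lemma haraux_step (n1 n0 : nat) (mu eta T del M : R) :
  0 < eta -> (forall n, (n1 <= n < n0)%N -> lam n = mu) ->
  (forall n, (n0 <= n)%N -> mu + eta <= lam n) ->
  0 < T -> 0 < del -> 0 < mu -> 0 <= M ->
  (forall N d, (forall n, ~~ (n1 <= n < n0)%N -> d n = 0) ->
     ell2 N d <= M * rnorm (lcomb b N d)) ->
  observable b lam n0 T -> observable b lam n1 (T + del).
Proof.
move=> eta0 low high T0 del0 mu0 M0 block [C C_gt0 obsC].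
(* The kernel of the first average is carried by an interval of half length h,
   that of the second one by e times this; both must fit in the margin del / 2. *)
pose h : R := del / 2 / (e.+1)%:R.
have h0 : 0 < h by rewrite !divr_gt0.
have eh : e%:R * h + h = del / 2.
  by rewrite -[X in _ + X]mul1r -mulrDl natr1 mulrC divfK // pnatr_eq0.
have eh0 : 0 <= e%:R * h by rewrite mulr_ge0 // ltW.
have [g [i0 [g0 g1 gap]]] := vieta_gap (mulr_gt0 h0 eta0).
have [A A0 smooth] := vieta_smoothing mu0 eta0 h0.
pose C1 := C / g * (1 + 1).
have C10 : 0 < C1 by rewrite mulr_gt0 ?divr_gt0.
pose C2 := C0 * A ^+ e.
have C20 : 0 <= C2 by rewrite mulr_ge0 // exprn_ge0.
pose C3 := C1 + M / T * (1 + T * C2 * C1).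
exists C3.
  have := ltW T0; have := ltW C10 => *.
  rewrite /C3; apply: ltr_wpDr => //; apply: mulr_ge0; first exact: divr_ge0.
  by apply: addr_ge0 => //; do 2 apply: mulr_ge0 => //.
move=> N d d0.
have [p i0p prange] := exists_vieta_range lam h mu N i0.
pose dh n := if (n0 <= n)%N then d n else 0.
pose dl n := if (n0 <= n)%N then 0 else d n.
set O := obs b lam N d 0 (T + del).
have O0 : 0 <= O by exact: obs_ge0.
have highE n : (n < N)%N -> (n0 <= n)%N -> mu + eta <= lam n /\
    `|h * (lam n - mu)| <= 2 ^+ p * pi by move=> nN /high; split=> //; exact: prange.
have lowE n : ~~ (n0 <= n)%N -> d n != 0 -> lam n = mu.
  move=> nn dn; apply: low; rewrite ltnNge nn andbT leqNgt.
  by apply: contra_neqN dn; exact: d0.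
(* The symbol m1 vanishes at mu and is at least g on the larger frequencies:
   the average removes the block and costs a factor 1 / g on the rest. *)
have Hh : ell2 N dh <= C1 * O.
  pose m1 (x : R) : R[i] := 1 - (vieta p (h * (x - mu)))%:C.
  have mm1 : multiplier h (1 + 1) m1.
    apply: multiplierB; first by apply: multiplierW (ltW h0) _; exact: multiplier1.
    have := multiplier_vieta p mu 1 (ltW h0); rewrite mul1r.
    by under eq_fun do rewrite expr1.
  have := @observable_shift _ _ _ _ n0 T C (del / 2) N (fun n => m1 (lam n) * dh n) obsC.
  have md : forall n, (n < n0)%N -> m1 (lam n) * dh n = 0.
    by move=> n nn; rewrite /dh leqNgt nn mulr0.
  move/(_ md) => H1.
  have H2 : ell2 N dh <= g^-1 * ell2 N (fun n => m1 (lam n) * dh n).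
    apply: le_ell2; first by rewrite invr_ge0 ltW.
    move=> n nN; rewrite /dh; case: ifPn => [nn|_]; last by rewrite mulr0 rnormc0 mulr0.
    have [h1 h2] := highE _ nN nn.
    have xg : vieta p (h * (lam n - mu)) <= 1 - g.
      apply: gap => //; rewrite normrM (gtr0_norm h0) ler_wpM2l ?(ltW h0) //.
      by rewrite (le_trans _ (ler_norm _)) // lerBrDl.
    rewrite rnormM mulrA ler_peMl ?rnormc_ge0 // mulrC ler_pdivlMr // mul1r.
    rewrite /m1 -(rmorph1 (real_complex R)) -rmorphB rnorm_real.
    by rewrite (le_trans _ (ler_norm _)) // lerBrDl -lerBrDr.
  apply: (le_trans H2); rewrite ler_pdivrMl //.
  apply: (le_trans H1).
  rewrite (_ : g * (C1 * O) = C * ((1 + 1) * O)); last first.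
    by rewrite /C1; field; rewrite lt0r_neq0.
  rewrite ler_pM2l // (@eq_obs _ _ _ _ _ _ (fun n => m1 (lam n) * d n)); last first.
    move=> n _; rewrite /dh; case: ifPn => // nn.
    have [->|dn] := eqVneq (d n) 0; first by rewrite !mulr0.
    rewrite mulr0 (lowE _ nn dn) /m1 subrr mulr0 vieta0.
    by rewrite (rmorph1 (real_complex R)) subrr mul0r.
  apply: (le_trans (multiplier_obs _ _ _ _ _ _ mm1)).
  by rewrite ler_wpM2l // sub_obs //; lra.
(* The symbol m2 is 1 at mu and decays like the power -e of the frequency: the
   average keeps the block, whose norm does not depend on time, and turns the
   rest into a wave that is bounded at every time by the part just estimated. *)
have Hl : ell2 N dl <= M / T * (1 + T * C2 * C1) * O.
  pose m2 (x : R) : R[i] := (vieta p (h * (x - mu)) ^+ e)%:C.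
  have mm2 : multiplier (e%:R * h) 1 m2 by apply: multiplier_vieta; exact: ltW.
  pose beta := lcomb b N dl.
  have Hb : ell2 N dl <= M * rnorm beta.
    apply: block => n nn; rewrite /dl; case: ifPn => // nn0.
    have [//|dn] := eqVneq (d n) 0; exfalso; move/negP: nn; apply.
    rewrite ltnNge nn0 andbT leqNgt; apply: contra_neqN dn; exact: d0.
  apply: (le_trans Hb); rewrite -mulrA -mulrA ler_wpM2l //.
  rewrite ler_pdivlMl // mulrDl mul1r.
  have W t : rnorm beta <= rnorm (wave b lam N (fun n => m2 (lam n) * d n) t) + C2 * ell2 N dh.
    have -> : rnorm beta = rnorm (wave b lam N dl t).
      rewrite /beta -[LHS]mul1r -(rnormc_expi (t * mu)) -rnormZ -lcombZ; congr rnorm.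
      apply: eq_lcomb => n _; rewrite /dl; case: ifPn => nn; first by rewrite !mulr0.
      have [->|dn] := eqVneq (d n) 0; first by rewrite !mulr0.
      by rewrite (lowE _ nn dn).
    have -> : wave b lam N dl t = wave b lam N (fun n => m2 (lam n) * d n) t -
        wave b lam N (fun n => m2 (lam n) * dh n) t.
      rewrite /wave -lcombB; apply: eq_lcomb => n _; rewrite /dl /dh.
      case: ifPn => nn; first by rewrite subrr mulr0.
      have [->|dn] := eqVneq (d n) 0; first by rewrite !mulr0 subrr.
      rewrite !mulr0 subr0 (lowE _ nn dn) /m2 subrr mulr0 vieta0 expr1n.
      by rewrite (rmorph1 (real_complex R)) mul1r.
    rewrite (le_trans (rnormD _ _)) // rnormN lerD2l.
    apply: rnorm_wave_ell2; first exact: exprn_ge0.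
    move=> n nN; rewrite /dh; case: ifPn => nn; last by rewrite mulr0 rnormc0 !mulr0.
    have [h1 h2] := highE _ nN nn.
    rewrite rnormM mulrA ler_wpM2r ?rnormc_ge0 // rnorm_real.
    have l0 := ltW (lam0 n); have v0 := vieta_ge0 p (h * (lam n - mu)).
    rewrite ger0_norm ?exprn_ge0 // -exprMn lerXn2r ?nnegrE ?smooth //.
    by rewrite mulr_ge0 // addr_ge0.
  have : integ (del / 2) (del / 2 + T) (fun=> rnorm beta) <=
      integ (del / 2) (del / 2 + T)
        (fun t => rnorm (wave b lam N (fun n => m2 (lam n) * d n) t) + C2 * ell2 N dh).
    apply: le_integ => [x|x|t _]; first exact: cvg_cst.
      by apply: cvgD; [exact: continuous_wave|exact: cvg_cst].
    exact: W.
  rewrite integD; [|exact: continuous_wave|by move=> x; exact: cvg_cst].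
  have dT : del / 2 <= del / 2 + T by rewrite lerDl ltW.
  rewrite !integ_cst // addrAC subrr add0r mulrC => /le_trans; apply.
  apply: lerD.
    apply: (le_trans (multiplier_obs _ _ _ _ _ _ mm2)).
    by rewrite mul1r sub_obs //; lra.
  rewrite (_ : T * C2 * C1 * O = C2 * (C1 * O) * T); last by ring.
  by rewrite ler_pM2r // ler_wpM2l.
rewrite (le_trans (ell2_split N (fun n => (n0 <= n)%N) d)) // /C3 mulrDl.
exact: lerD.
Qed.

Lemma sum_block (V : zmodType) (F : nat -> V) n1 k N :
  (forall n, ~~ (n1 <= n < n1 + k)%N -> F n = 0) ->
  \sum_(n < N) F n = \sum_(i < k) (if (n1 + i < N)%N then F (n1 + i)%N else 0).
Proof.
move=> F0; elim: N => [|N IH]; first by rewrite big_ord0 big1.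
rewrite big_ord_recr /= IH.
have -> : F N = \sum_(i < k) (if (n1 + i == N)%N then F (n1 + i)%N else 0).
  have [/andP[h1 h2]|nn] := boolP (n1 <= N < n1 + k)%N.
    have iN : (N - n1 < k)%N by rewrite ltn_subLR.
    rewrite (bigD1 (Ordinal iN)) //= subnKC // eqxx big1 ?addr0 // => i.
    rewrite -val_eqE /= => ni; case: eqP => // E.
    by move: ni; rewrite -E addKn eqxx.
  rewrite F0 // big1 // => i _; case: eqP => // E; apply: F0.
  by rewrite E.
rewrite -big_split /=; apply: eq_bigr => i _.
by rewrite ltnS; case: (ltngtP (n1 + i)%N N) => _; rewrite ?addr0 ?add0r.
Qed.

(** Strong induction on [n0]: the step adds the block of the largest missing
    eigenvalue and uses up half of the remaining time. *)
Lemma haraux (UC : forall (mu : R) N (d : nat -> R[i]),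
    (forall n, (n < N)%N -> lam n != mu -> d n = 0) ->
    lcomb b N d = 0 -> forall n, (n < N)%N -> d n = 0)
  (lam_ndecr : forall m n, (m <= n)%N -> lam m <= lam n) n0 T T' :
  0 < T -> T < T' -> (n0 = 0%N \/ lam n0.-1 < lam n0) ->
  observable b lam n0 T -> observable b lam 0 T'.
Proof.
elim/ltn_ind: n0 T => -[|n0] IH T T0 TT' gapn obsT.
  case: obsT => C C0' H; exists C => // N d d0; apply: (le_trans (H N d d0)).
  by rewrite ler_pM2l // sub_obs // ltW.
case: gapn => // /= gapn.
pose mu := lam n0.
have ex : exists n, lam n == mu by exists n0.
pose n1 := ex_minn ex.
have [lam1 min1] : lam n1 = mu /\ forall n, lam n == mu -> (n1 <= n)%N.
  by rewrite /n1; case: ex_minnP => m /eqP.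
have n1n0 : (n1 <= n0)%N by apply: min1.
have lamE n : (n1 <= n < n0.+1)%N -> lam n = mu.
  move=> /andP[nn1 nn0]; apply/eqP; rewrite eq_le (lam_ndecr n n0) //=.
  by rewrite -lam1 lam_ndecr.
have TT : T < T + (T' - T) / 2 by lra.
apply: (IH n1 _ (T + (T' - T) / 2)); rewrite ?ltnS //; first by lra.
- by lra.
- case: (posnP n1) => [->|n1p]; [by left|right].
  rewrite lt_def lam_ndecr ?leq_pred // andbT.
  apply/eqP => E; have := min1 n1.-1; rewrite -E lam1 eqxx => /(_ isT).
  by case: (n1) n1p => // m _; rewrite ltnn.
pose k := (n0.+1 - n1)%N.
have kE : (n1 + k)%N = n0.+1 by rewrite /k subnKC // ltnW.
(* Unique continuation says that the block is a free family. *)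
have [d l0 i ik|M M0 HM] := @gram_bound _ _ _ hK k (fun i => b (n1 + i)%N).
  pose d' n := if (n1 <= n < n1 + k)%N then d (n - n1)%N else 0.
  have d'E j : (j < k)%N -> d' (n1 + j)%N = d j.
    by move=> jk; rewrite /d' leq_addr ltn_add2l jk addKn.
  rewrite -d'E //; apply: (UC mu n0.+1); last by rewrite -kE ltn_add2l.
    by move=> n nn; rewrite /d'; case: ifPn => //; rewrite kE => /lamE ->; rewrite eqxx.
  rewrite -[RHS]l0 /lcomb (@sum_block _ (fun n => d' n *: b n) n1 k) => [|n nn]; last first.
    by rewrite /d' (negbTE nn) scale0r.
  by apply: eq_bigr => j _; rewrite -kE ltn_add2l ltn_ord d'E.
apply: (@haraux_step n1 n0.+1 mu (lam n0.+1 - mu) T _ M) => //.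
- by rewrite subr_gt0.
- by move=> n nn; rewrite addrC subrK; exact: lam_ndecr.
- by lra.
- exact: lam0.
move=> N d; rewrite -kE => d0.
pose d' i := if (n1 + i < N)%N then d (n1 + i)%N else 0.
rewrite (_ : ell2 N d = ell2 k d'); last first.
  rewrite /ell2 (@sum_block _ (fun n => rnorm (d n) ^+ 2) n1 k) => [|n nn]; last first.
    by rewrite d0 // rnormc0 expr0n.
  congr Num.sqrt; apply: eq_bigr => i _; rewrite /d'.
  by case: ifP; rewrite // rnormc0 expr0n.
rewrite (_ : lcomb b N d = lcomb (fun i => b (n1 + i)%N) k d') //.
rewrite /lcomb (@sum_block _ (fun n => d n *: b n) n1 k) => [|n nn]; last first.
  by rewrite d0 // scale0r.
by apply: eq_bigr => i _; rewrite /d'; case: ifP; rewrite ?scale0r.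
Qed.
End Haraux.

(** * Differential calculus for holomorphic sums *)

Section ComplexDerivative.
Variable R : realType.

Definition cder (c : R -> R[i]) (t : R) (c' : R[i]) :=
  is_derive t (1 : R) (fun s => complex.Re (c s)) (complex.Re c') /\
  is_derive t (1 : R) (fun s => complex.Im (c s)) (complex.Im c').

Lemma is_derive_ext (f g : R -> R) (t df dg : R) : f =1 g -> df = dg ->
  is_derive t (1 : R) f df -> is_derive t (1 : R) g dg.
Proof. by move=> /funext -> ->. Qed.

Lemma cder_ext (c e : R -> R[i]) t c' e' : c =1 e -> c' = e' ->
  cder c t c' -> cder e t e'.
Proof. by move=> /funext -> ->. Qed.

Lemma cder_cst (a : R[i]) t : cder (fun=> a) t 0.
Proof. by split; exact: is_derive_cst. Qed.

Lemma cderD c e t c' e' : cder c t c' -> cder e t e' ->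
  cder (fun s => c s + e s) t (c' + e').
Proof.
move=> [cr ci] [er ei]; split.
  apply: is_derive_ext (is_deriveD cr er); last by case: c' e' {cr ci er ei} => ? ? [].
  by move=> s; rewrite !fctE; case: (c s) (e s) => ? ? [].
apply: is_derive_ext (is_deriveD ci ei); last by case: c' e' {cr ci er ei} => ? ? [].
by move=> s; rewrite !fctE; case: (c s) (e s) => ? ? [].
Qed.

Lemma cderM c e t c' e' : cder c t c' -> cder e t e' ->
  cder (fun s => c s * e s) t (c' * e t + c t * e').
Proof.
move=> [cr ci] [er ei]; split.
  apply: is_derive_ext (is_deriveB (is_deriveM cr er) (is_deriveM ci ei)).
    by move=> s; rewrite !fctE; case: (c s) (e s) => ? ? [].
  case: c' e' (c t) (e t) {cr ci er ei} => ? ? [? ?] [? ?] [? ?] /=.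
  by rewrite /GRing.scale /=; ring.
apply: is_derive_ext (is_deriveD (is_deriveM cr ei) (is_deriveM ci er)).
  by move=> s; rewrite !fctE; case: (c s) (e s) => ? ? [].
case: c' e' (c t) (e t) {cr ci er ei} => ? ? [? ?] [? ?] [? ?] /=.
by rewrite /GRing.scale /=; ring.
Qed.

Lemma cderZ a c t c' : cder c t c' -> cder (fun s => a * c s) t (a * c').
Proof.
move=> cc; apply: cder_ext (cderM (cder_cst a t) cc) => //.
by rewrite mul0r add0r.
Qed.

Lemma cder_ccont (c : R -> R[i]) (c' : R -> R[i]) :
  (forall t, cder c t (c' t)) -> ccont c.
Proof.
move=> cc; apply: ccontP => t; have [[d1 _] [d2 _]] := cc t;
  apply: differentiable_continuous; apply/derivable1_diffP.
  exact: d1.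
exact: d2.
Qed.

Lemma cder_expi (l t : R) : cder (fun s => expi (s * l)) t ('i * l%:C * expi (t * l)).
Proof.
have dl : is_derive t (1 : R) (fun s : R => s * l) l.
  by apply: is_derive_eq; rewrite scaler0 add0r /GRing.scale /= mulr1.
split.
  apply: is_derive_ext (@is_derive1_comp R (@cos R) (fun s : R => s * l) t _ _ (is_derive_cos _) dl) => //=.
  by ring.
apply: is_derive_ext (@is_derive1_comp R (@sin R) (fun s : R => s * l) t _ _ (is_derive_sin _) dl) => //=.
by ring.
Qed.

Lemma cder_exp (l t : R) :
  cder (fun s => (expR (- (s * l)))%:C) t ((- l)%:C * (expR (- (t * l)))%:C).
Proof.
have dl : is_derive t (1 : R) (fun s : R => - (s * l)) (- l).
  by apply: is_derive_eq; rewrite scaler0 add0r /GRing.scale /= mulr1.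
split.
  apply: is_derive_ext (@is_derive1_comp R (@expR R) (fun s : R => - (s * l)) t _ _ (is_derive_expR _) dl) => //=.
  by ring.
by apply: is_derive_ext (is_derive_cst (0 : R) t (1 : R)) => //=; ring.
Qed.

(** The function p(z) e^(i l z) at z = x + i y. *)
Definition pexp (p : {poly R[i]}) (l x y : R) : R[i] :=
  p.[x +i* y] * ((expR (- (y * l)))%:C * expi (x * l)).

(** The complex derivative of [pexp p l] is [pexp (dpexp l p) l]. *)
Definition dpexp (l : R) (p : {poly R[i]}) : {poly R[i]} :=
  p^`() + ('i * l%:C) *: p.

Lemma deriv_mulXD (p : {poly R[i]}) (c : R[i]) : (p * 'X + c%:P)^`() = p^`() * 'X + p.
Proof. by rewrite derivD derivC addr0 derivM derivX mulr1. Qed.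

Lemma cder_poly_x (p : {poly R[i]}) x y :
  cder (fun s => p.[s +i* y]) x (p^`()).[x +i* y].
Proof.
elim/poly_ind: p => [|p c IH].
  by apply: cder_ext (cder_cst 0 x) => [s|]; rewrite ?deriv0 horner0.
have cz : cder (fun s => s +i* y) x 1.
  by split; [exact: is_derive_id|exact: is_derive_cst].
apply: cder_ext (cderD (cderM IH cz) (cder_cst c x)) => [s|].
  by rewrite hornerMXaddC.
by rewrite deriv_mulXD hornerD hornerM hornerX mulr1 addr0.
Qed.

Lemma cder_poly_y (p : {poly R[i]}) x y :
  cder (fun s => p.[x +i* s]) y ('i * (p^`()).[x +i* y]).
Proof.
elim/poly_ind: p => [|p c IH].
  by apply: cder_ext (cder_cst 0 y) => [s|]; rewrite ?deriv0 horner0 ?mulr0.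
have cz : cder (fun s => x +i* s) y 'i.
  by split; [exact: is_derive_cst|exact: is_derive_id].
apply: cder_ext (cderD (cderM IH cz) (cder_cst c y)) => [s|].
  by rewrite hornerMXaddC.
rewrite deriv_mulXD hornerD hornerM hornerX addr0.
by rewrite mulrDr mulrA ['i * p.[_]]mulrC.
Qed.

Lemma pexp_x p l x y : cder (fun s => pexp p l s y) x (pexp (dpexp l p) l x y).
Proof.
apply: cder_ext (cderM (cder_poly_x p x y)
  (cderZ (expR (- (y * l)))%:C (cder_expi l x))) => //.
rewrite /pexp /dpexp hornerD hornerZ.
by move: (p.[_]) (_.[_]) (expi _) (_%:C) (_%:C) => u v w a c; ring.
Qed.

Lemma pexp_y p l x y :
  cder (fun s => pexp p l x s) y ('i * pexp (dpexp l p) l x y).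
Proof.
apply: cder_ext (cderM (cder_poly_y p x y)
  (cderM (cder_exp l y) (cder_cst (expi (x * l)) y))) => //.
rewrite /pexp /dpexp hornerD hornerZ mulr0 addr0.
have -> : (- l)%:C = 'i * ('i * l%:C) :> R[i].
  by rewrite mulrA; apply/eqP; rewrite eq_complex /=; apply/andP; split; apply/eqP; ring.
by move: (p.[_]) (_.[_]) (expi _) (expR _)%:C => u v w a; ring.
Qed.

Lemma is_derive_bigsum (N : nat) (f : nat -> R -> R) (df : nat -> R) (t : R) :
  (forall n, (n < N)%N -> is_derive t (1 : R) (f n) (df n)) ->
  is_derive t (1 : R) (fun s => \sum_(n < N) f n s) (\sum_(n < N) df n).
Proof.
elim: N => [|N IH] H.
  apply: is_derive_ext (is_derive_cst (0 : R) t (1 : R)); last by rewrite big_ord0.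
  by move=> s; rewrite big_ord0.
apply: is_derive_ext (is_deriveD (IH (fun n nN => H n (ltnW nN))) (H N (ltnSn N))).
  by move=> s; rewrite big_ord_recr.
by rewrite big_ord_recr.
Qed.

Lemma is_derive_sqrt (u : R -> R) (t u' : R) : 0 < u t ->
  is_derive t (1 : R) u u' ->
  is_derive t (1 : R) (fun s => Num.sqrt (u s)) (u' / (2 * Num.sqrt (u t))).
Proof.
move=> u0 du; have ds := is_derive1_sqrt u0.
apply: is_derive_ext (@is_derive1_comp R (@Num.sqrt R) u t _ _ ds du) => //.
by rewrite mulrC.
Qed.

Lemma is_derive_div (u v : R -> R) (t u' v' : R) : v t != 0 ->
  is_derive t (1 : R) u u' -> is_derive t (1 : R) v v' ->
  is_derive t (1 : R) (fun s => u s / v s) ((u' * v t - u t * v') / v t ^+ 2).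
Proof.
move=> v0 du dv; have di := is_deriveV v0 dv.
apply: is_derive_ext (is_deriveM du di) => // .
by rewrite /GRing.scale /=; field.
Qed.

Lemma is_derive_sqrt2 (u u1 : R -> R) (t u2 : R) : 0 < u t ->
  is_derive t (1 : R) u (u1 t) -> is_derive t (1 : R) u1 u2 ->
  is_derive t (1 : R) (fun s => u1 s / (2 * Num.sqrt (u s)))
    (u2 / (2 * Num.sqrt (u t)) - u1 t ^+ 2 / (4 * Num.sqrt (u t) ^+ 3)).
Proof.
move=> u0 du du1; have s0 : Num.sqrt (u t) != 0 by rewrite sqrtr_eq0 -ltNge.
have ds : is_derive t (1 : R) (fun s => 2 * Num.sqrt (u s)) (2 * (u1 t / (2 * Num.sqrt (u t)))).
  have := is_deriveZ (2 : R) (is_derive_sqrt u0 du).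
  exact: is_derive_ext.
have v0 : 2 * Num.sqrt (u t) != 0 by rewrite mulf_neq0.
apply: is_derive_ext (@is_derive_div u1 (fun s => 2 * Num.sqrt (u s)) t _ _ v0 du1 ds) => //.
by field.
Qed.

End ComplexDerivative.

Section Dot.
Variables (R : realType) (K : completeNormedModType R[i]).
Variable dotK : {dot K for (@Num.conj R[i])}.
Hypothesis hK : hilbert_dot dotK.
Variable b : nat -> K.

Definition rdot (x y : K) : R := complex.Re (dotK x y).

Lemma rdotE x : rdot x x = rnorm x ^+ 2.
Proof. by rewrite /rdot (dotE hK). Qed.

Lemma rdotC x y : rdot x y = rdot y x.
Proof. by rewrite /rdot dotC; case: (dotK y x). Qed.

(** Real scalar products with x and i x recover the complex one; for a holomorphic
    function they are the two partial derivatives. *)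
Lemma rdot_i_sqr x y : rdot x y ^+ 2 + rdot ('i *: x) y ^+ 2 = rnorm (dotK x y) ^+ 2.
Proof. by rewrite /rdot dotZl rnorm_sqr; case: (dotK x y) => a c /=; ring. Qed.

Lemma rdot_iNN x y : rdot ('i *: ('i *: x)) y = - rdot x y.
Proof. by rewrite /rdot !dotZl; case: (dotK x y) => a c /=; ring. Qed.

Lemma rdot_ii x y : rdot ('i *: x) ('i *: y) = rdot x y.
Proof. by rewrite /rdot dotZl dotZr; case: (dotK x y) => a c /=; ring. Qed.

Lemma rdot_lcomb N (c e : nat -> R[i]) :
  rdot (lcomb b N c) (lcomb b N e) =
  \sum_(m < N) \sum_(n < N) complex.Re (c m * ((e n)^*%C * dotK (b m) (b n))).
Proof.
rewrite /rdot dot_suml raddf_sum; apply: eq_bigr => m _.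
rewrite dotC dot_suml rmorph_sum raddf_sum; apply: eq_bigr => n _ /=.
by rewrite -[X in complex.Re X]/((dotK (e n *: b n) (c m *: b m))^*%C) -dotC dotZl dotZr.
Qed.

Lemma is_derive_rdot N (c e : nat -> R -> R[i]) (c' e' : nat -> R[i]) t :
  (forall n, cder (c n) t (c' n)) -> (forall n, cder (e n) t (e' n)) ->
  is_derive t (1 : R) (fun s => rdot (lcomb b N (c ^~ s)) (lcomb b N (e ^~ s)))
   (rdot (lcomb b N c') (lcomb b N (e ^~ t)) + rdot (lcomb b N (c ^~ t)) (lcomb b N e')).
Proof.
move=> dc de.
apply: is_derive_ext (_ : is_derive t (1 : R) (fun s => \sum_(m < N) \sum_(n < N)
   complex.Re (c m s * ((e n s)^*%C * dotK (b m) (b n))))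
   (\sum_(m < N) \sum_(n < N) complex.Re (c' m * ((e n t)^*%C * dotK (b m) (b n)) +
      c m t * ((e' n)^*%C * dotK (b m) (b n))))).
- by move=> s; rewrite rdot_lcomb.
- rewrite !rdot_lcomb -big_split; apply: eq_bigr => m _.
  by rewrite -big_split; apply: eq_bigr => n _; rewrite raddfD.
apply: (@is_derive_bigsum _ N (fun m s => \sum_(n < N)
   complex.Re (c m s * ((e n s)^*%C * dotK (b m) (b n))))
   (fun m => \sum_(n < N) complex.Re (c' m * ((e n t)^*%C * dotK (b m) (b n)) +
      c m t * ((e' n)^*%C * dotK (b m) (b n))))) => m _.
apply: (@is_derive_bigsum _ N (fun n s =>
   complex.Re (c m s * ((e n s)^*%C * dotK (b m) (b n))))
   (fun n => complex.Re (c' m * ((e n t)^*%C * dotK (b m) (b n)) +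
      c m t * ((e' n)^*%C * dotK (b m) (b n))))) => n _.
have dec : cder (fun s => (e n s)^*%C * dotK (b m) (b n)) t ((e' n)^*%C * dotK (b m) (b n)).
  have [er ei] := de n.
  have : cder (fun s => (e n s)^*%C) t (e' n)^*%C.
    split; first by apply: is_derive_ext er => [s|]; [rewrite ?fctE; case: (e n s)|case: (e' n)].
    by apply: is_derive_ext (is_deriveN ei) => [s|]; [rewrite ?fctE; case: (e n s)|case: (e' n)].
  move=> H; apply: cder_ext (cderM H (cder_cst _ t)) => //.
  by rewrite mulr0 addr0.
by have [] := cderM (dc m) dec.
Qed.

End Dot.

(** * Green's formula in a strip *)

Section MVT.
Variable R : realType.

Lemma mvt (f df : R -> R) (a b : R) : a <= b ->
  (forall x, a <= x <= b -> is_derive x (1 : R) f (df x)) ->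
  exists2 c, a <= c <= b & f b - f a = df c * (b - a).
Proof.
move=> ab df'.
have [c cab ->] : exists2 c, c \in `[a, b]%R & f b - f a = df c * (b - a).
  apply: MVT_segment => // [x|].
    by rewrite in_itv /= => /andP[/ltW ax /ltW xb]; apply: df'; rewrite ax.
  apply: derivable_within_continuous => x; rewrite in_itv /= => /df' [] //.
by exists c => //; move: cab; rewrite in_itv.
Qed.

End MVT.

Section Convexity.
Variables (R : realType) (N N1 N2 D : R -> R) (s a : R).
Hypothesis dN : forall y : R, 0 <= y <= 1 -> is_derive y (1 : R) N (N1 y).
Hypothesis dN1 : forall y : R, 0 <= y <= 1 -> is_derive y (1 : R) N1 (N2 y).
Hypothesis N0 : forall y, 0 <= N y.
Hypothesis D0 : forall y, 0 <= D y.
Hypothesis s0 : 0 <= s.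
Hypothesis a1 : N1 1 <= a.
Hypothesis a0 : 0 <= a.
Hypothesis N2D : forall y, 0 <= y <= 1 -> D y - s <= N2 y.

Let E y := N y - y * N1 y.

Let dE (y : R) : 0 <= y <= 1 -> is_derive y (1 : R) E (- (y * N2 y)).
Proof.
move=> y01; have := is_deriveB (dN y01) (is_deriveM (is_derive_id y (1 : R)) (dN1 y01)).
apply: is_derive_ext => //; rewrite /GRing.scale /= ?fctE.
by ring.
Qed.

(** The slope can only decrease by a controlled amount on the way to y = 1. *)
Lemma convex_slope y : 0 <= y <= 1 -> N1 y <= a + s.
Proof.
move=> /andP[y0 y1].
have [x /andP[yx x1]|c /andP[yc c1] E1] := @mvt _ N1 N2 y 1 y1.
  by apply: dN1; rewrite x1 (le_trans y0).
have c01 : 0 <= c <= 1 by rewrite c1 (le_trans y0).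
have := N2D c01; have := D0 c; move: E1 a1 s0; nra.
Qed.

Lemma convex_bound y : 0 <= y <= 1 -> N y <= N 0 + a + s.
Proof.
move=> /andP[y0 y1].
have [x /andP[yx x1]|c /andP[yc c1] E1] := @mvt _ N N1 0 y y0.
  by apply: dN; rewrite yx (le_trans x1).
have c01 : 0 <= c <= 1 by rewrite yc (le_trans c1).
have := convex_slope c01; move: E1 a0 s0; nra.
Qed.

(** E' = - y N2 y, so the mean value theorem bounds y D at some height by a
    difference of values of E; such differences telescope along a subdivision. *)
Lemma convex_window y1 y2 : 0 < y1 -> y1 <= y2 -> y2 <= 1 ->
  exists2 xi, y1 <= xi <= y2 &
    (y2 - y1) * (y1 * D xi) <= E y1 - E y2 + (y2 - y1) * s.
Proof.
move=> y10 y12 y21.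
have [x /andP[yx x1]|c /andP[yc c1] E1] := @mvt _ E (fun y => - (y * N2 y)) y1 y2 y12.
  by apply: dE; rewrite (le_trans (ltW y10)) // (le_trans x1).
exists c; first by rewrite yc.
have c01 : 0 <= c <= 1 by rewrite (le_trans (ltW y10)) // (le_trans c1).
have := N2D c01; have := D0 c => Dc Nc.
have -> : E y1 - E y2 = c * N2 c * (y2 - y1) by rewrite -opprB E1; ring.
have dy : 0 <= y2 - y1 by rewrite subr_ge0.
rewrite (mulrC _ s) -mulrDl mulrC ler_wpM2r //.
have := ler_wpM2r Dc yc; move: c01 => /andP[c0 c1'].
have := ler_wpM2l c0 Nc; have := ler_wpM2r s0 c1'; lra.
Qed.

Lemma convex_E_ub y : 0 <= y <= 1 -> E y <= N 0 + s.
Proof.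
move=> /andP[y0 y1].
have [x /andP[yx x1]|c /andP[yc c1] E1] := @mvt _ E (fun y => - (y * N2 y)) 0 y y0.
  by apply: dE; rewrite yx (le_trans x1).
have c01 : 0 <= c <= 1 by rewrite yc (le_trans c1).
have := N2D c01; have := D0 c => Dc Nc.
have E0 : E 0 = N 0 by rewrite /E mul0r subr0.
have : - (c * N2 c) <= s.
  have := ler_wpM2l yc Nc; move: c01 => /andP[_ c1'].
  have := ler_wpM2r s0 c1'; have := mulr_ge0 yc Dc; lra.
move=> H; have := ler_wpM2r y0 H; rewrite subr0 in E1.
by move: E1; rewrite E0; have := ler_wpM2r s0 y1; lra.
Qed.

Lemma convex_E_lb y : 0 <= y <= 1 -> - E y <= a + s.
Proof.
move=> y01; have := convex_slope y01; have := N0 y; case/andP: y01 => y0 y1.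
by rewrite /E; have := addr_ge0 a0 s0; nra.
Qed.

End Convexity.

Section Green.
Variables (R : realType) (T Mb : R) (g gx gxx gy gyy D : R -> R -> R).
Hypothesis T0 : 0 < T.
Hypothesis g0 : forall x y, 0 <= g x y.
Hypothesis dgx : forall x y, is_derive x (1 : R) (g ^~ y) (gx x y).
Hypothesis dgxx : forall x y, is_derive x (1 : R) (gx ^~ y) (gxx x y).
Hypothesis dgy : forall x y, is_derive y (1 : R) (g x) (gy x y).
Hypothesis dgyy : forall x y, is_derive y (1 : R) (gy x) (gyy x y).
Hypothesis cgxx : forall y, continuous (gxx ^~ y).
Hypothesis cgy : forall y, continuous (gy ^~ y).
Hypothesis cgyy : forall y, continuous (gyy ^~ y).
Hypothesis cD : forall y, continuous (D ^~ y).
Hypothesis bgy : forall x y, 0 <= x <= T -> -1 < y < 2 -> `|gy x y| <= Mb.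
Hypothesis bgyy : forall x y, 0 <= x <= T -> -1 < y < 2 -> `|gyy x y| <= Mb.
Hypothesis lap : forall x y, D x y <= gxx x y + gyy x y.

(** It vanishes at both ends, so that integrating twice by parts in x leaves only
    boundary values of the function and none of its derivative; it is concave,
    which gives the remaining integral the favourable sign. *)
Definition weight (x : R) := x * (T - x).

Lemma weight_ge0 x : 0 <= x <= T -> 0 <= weight x.
Proof. by move=> /andP[? ?]; rewrite mulr_ge0 // subr_ge0. Qed.

Lemma weight_le x : 0 <= x <= T -> weight x <= T ^+ 2.
Proof. by move=> /andP[? ?]; rewrite /weight; nra. Qed.

Lemma continuous_weight : continuous weight.
Proof.
by move=> x; apply: cvgM; [exact: cvg_id|apply: cvgB; [exact: cvg_cst|exact: cvg_id]].
Qed.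

Lemma continuous_weightM f : continuous f -> continuous (fun x => weight x * f x).
Proof. by move=> cf x; apply: cvgM; [exact: continuous_weight|exact: cf]. Qed.

Definition wint (f : R -> R -> R) (y : R) := integ 0 T (fun x => weight x * f x y).

Lemma is_derive_wint (f fy : R -> R -> R) (y : R) :
  (forall x y : R, is_derive y (1 : R) (f x) (fy x y)) ->
  (forall y, continuous (f ^~ y)) -> (forall y, continuous (fy ^~ y)) ->
  (forall x y, 0 <= x <= T -> -1 < y < 2 -> `|fy x y| <= Mb) ->
  -1 < y < 2 -> is_derive y (1 : R) (wint f) (wint fy y).
Proof.
move=> df cf cfy bf y12.
have d1 x z : is_derive z (1 : R) (fun y => weight x * f x y) (weight x * fy x z).
  by have := is_deriveZ (weight x) (df x z).
have p1 x z : partial1of2 (fun y x => weight x * f x y) z x = weight x * fy x z.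
  by rewrite /partial1of2 derive1E; have [] := d1 x z.
have y12' : `]-1, 2[%classic y by rewrite /= in_itv.
have Mb0 : 0 <= Mb by rewrite (le_trans _ (bf 0 y _ y12)) // lexx ltW.
have intf x : `]-1, 2[%classic x ->
   (@lebesgue_measure R).-integrable `[0, T] (EFin \o (fun x0 => weight x0 * f x0 x)).
  by move=> _; apply: continuous_integrable; exact: continuous_weightM.
have der1 x z : `]-1, 2[%classic x -> `[0, T]%classic z ->
    derivable ((fun y x => weight x * f x y) ^~ z) x 1.
  by move=> _ _; have [] := d1 z x.
have G0 (z : R) : 0 <= T ^+ 2 * Mb by rewrite mulr_ge0 // sqr_ge0.
have intG : (@lebesgue_measure R).-integrable `[0, T] (EFin \o (fun=> T ^+ 2 * Mb)).
  by apply: continuous_integrable => z; exact: cvg_cst.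
have Gub x z : `]-1, 2[%classic x -> `[0, T]%classic z ->
    `|partial1of2 (fun y x => weight x * f x y) x z| <= T ^+ 2 * Mb.
  rewrite /= !in_itv /= => x12 z0T; rewrite p1 normrM ger0_norm ?weight_ge0 //.
  by rewrite ler_pM ?weight_ge0 ?weight_le ?bf.
split.
  exact: (@derivable_under_integral R _ _ (@lebesgue_measure R)
     (fun y x => weight x * f x y) `[0, T] _ y (-1) 2 y12' intf der1
     (fun=> T ^+ 2 * Mb) G0 intG Gub).
rewrite -derive1E.
rewrite (@differentiation_under_integral R _ _ (@lebesgue_measure R)
     (fun y x => weight x * f x y) `[0, T] _ y (-1) 2 y12' intf der1
     (fun=> T ^+ 2 * Mb) G0 intG Gub) //.
by apply: eq_Rintegral => x _; rewrite p1.
Qed.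

(** Two integrations by parts; the second derivative of the weight is -2. *)
Lemma wint_gxx y : wint gxx y <= T * (g 0 y + g T y).
Proof.
have cg : continuous (g ^~ y) by exact: continuous_derive (dgx ^~ y).
(* P is the boundary term of the two integrations by parts. *)
pose P x := weight x * gx x y - (T - 2 * x) * g x y.
have dP x : is_derive x (1 : R) P (weight x * gxx x y + 2 * g x y).
  have dw : is_derive x (1 : R) weight (T - 2 * x).
    have := is_deriveM (is_derive_id x (1 : R))
      (is_deriveB (is_derive_cst T x (1 : R)) (is_derive_id x (1 : R))).
    by apply: is_derive_ext => //; rewrite /GRing.scale /= ?fctE; ring.
  have dw' : is_derive x (1 : R) (fun x => T - 2 * x) (- 2).
    have := is_deriveB (is_derive_cst T x (1 : R)) (is_deriveZ 2 (is_derive_id x (1 : R))).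
    by apply: is_derive_ext => //; rewrite /GRing.scale /= ?fctE; ring.
  have := is_deriveB (is_deriveM dw (dgxx x y)) (is_deriveM dw' (dgx x y)).
  by apply: is_derive_ext => //; rewrite /GRing.scale /= ?fctE; ring.
have cw : continuous (fun x => weight x * gxx x y) by exact: continuous_weightM.
have c2 : continuous (fun x => 2 * g x y).
  by move=> x; apply: cvgM; [exact: cvg_cst|exact: cg].
have c3 : continuous (fun x => weight x * gxx x y + 2 * g x y).
  by move=> x; apply: cvgD; [exact: cw|exact: c2].
have := integ_FTC (ltW T0) c3 dP; rewrite integD // /wint.
have : 0 <= integ 0 T (fun x => 2 * g x y).
  by apply: integ_ge0 => x _; rewrite mulr_ge0.
set u := integ _ _ _; set v := integ _ _ _ => v0.
rewrite /P /weight !subrr !mul0r mulr0 mul0r; lra.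
Qed.

(** The second y-derivative is at least D minus the second x-derivative, and the
    integral of the latter is bounded by the values on the sides. *)
Lemma wint_gyy y : wint D y - T * (g 0 y + g T y) <= wint gyy y.
Proof.
rewrite lerBlDr addrC -lerBlDr (le_trans _ (wint_gxx y)) // lerBlDr.
rewrite /wint -integD; try exact: continuous_weightM.
apply: le_integ.
- exact: continuous_weightM.
- by move=> x; apply: cvgD; exact: continuous_weightM.
- by move=> x x0T; rewrite -mulrDr ler_wpM2l ?weight_ge0.
Qed.

Lemma wint_g_derive (y : R) : -1 < y < 2 -> is_derive y (1 : R) (wint g) (wint gy y).
Proof.
apply: is_derive_wint => // z; first exact: continuous_derive (dgx ^~ z).
Qed.

Lemma wint_gy_derive (y : R) : -1 < y < 2 -> is_derive y (1 : R) (wint gy) (wint gyy y).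
Proof. exact: is_derive_wint. Qed.

End Green.

(** * The regularized modulus of the holomorphic extension *)

Section Regularized.
Variables (R : realType) (K : completeNormedModType R[i]).
Variable dotK : {dot K for (@Num.conj R[i])}.
Hypothesis hK : hilbert_dot dotK.
Variables (b : nat -> K) (lam : nat -> R).
Hypothesis lam0 : forall n, 0 < lam n.
Variables (N : nat) (d : nat -> R[i]) (q : {poly R[i]}) (T eps : R).
Hypothesis T0 : 0 < T.
Hypothesis eps0 : 0 < eps.

(** The k-th complex derivative of q(z) F(z), where F is the holomorphic extension
    of the wave of coefficients [d]. *)
Definition hext k x y : K :=
  lcomb b N (fun n => d n * pexp (iter k (dpexp (lam n)) q) (lam n) x y).

Let rd k l x y := rdot dotK (hext k x y) (hext l x y).
Let ri k l x y := rdot dotK ('i *: hext k x y) (hext l x y).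

Lemma hext_i k x y : 'i *: hext k x y =
  lcomb b N (fun n => 'i * (d n * pexp (iter k (dpexp (lam n)) q) (lam n) x y)).
Proof. by rewrite lcombZ. Qed.

Let cx k n x y := @cderZ _ (d n) _ _ _ (pexp_x (iter k (dpexp (lam n)) q) (lam n) x y).
Let cy k n x y := @cderZ _ (d n) _ _ _ (pexp_y (iter k (dpexp (lam n)) q) (lam n) x y).

Lemma hext_iS k x y : lcomb b N (fun n => d n * ('i * pexp (dpexp (lam n) (iter k (dpexp (lam n)) q)) (lam n) x y))
  = 'i *: hext k.+1 x y.
Proof. by rewrite hext_i; apply: eq_lcomb => n _; rewrite mulrCA. Qed.

Lemma rd_x k l x y : is_derive x (1 : R) (rd k l ^~ y) (rd k.+1 l x y + rd k l.+1 x y).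
Proof. exact: (is_derive_rdot dotK b N (cx k ^~ x ^~ y) (cx l ^~ x ^~ y)). Qed.

Lemma ri_x k l x y : is_derive x (1 : R) (ri k l ^~ y) (ri k.+1 l x y + ri k l.+1 x y).
Proof.
have H := is_derive_rdot dotK b N (fun n => cderZ 'i (cx k n x y)) (fun n => cx l n x y).
apply: is_derive_ext H => [s|]; first by rewrite /ri hext_i.
by rewrite /ri !hext_i.
Qed.

Lemma rd_y k l x y : is_derive y (1 : R) (rd k l x) (ri k.+1 l x y + ri l.+1 k x y).
Proof.
have H := is_derive_rdot dotK b N (fun n => cy k n x y) (fun n => cy l n x y).
apply: is_derive_ext H => //.
by rewrite !hext_iS /ri; congr (_ + _); rewrite rdotC.
Qed.

(** The Cauchy-Riemann equations: a derivative in y is i times a derivative in x. *)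
Lemma ri_y k l x y : is_derive y (1 : R) (ri k l x) (- rd k.+1 l x y + rd k l.+1 x y).
Proof.
have H := is_derive_rdot dotK b N (fun n => cderZ 'i (cy k n x y)) (fun n => cy l n x y).
apply: is_derive_ext H => [s|]; first by rewrite /ri hext_i.
rewrite lcombZ !hext_iS rdot_iNN; congr (_ + _).
by rewrite -hext_i rdot_ii.
Qed.

Lemma rdS k x y : rd k k x y = rnorm (hext k x y) ^+ 2.
Proof. exact: rdotE. Qed.

Let u x y := eps ^+ 2 + rd 0 0 x y.
(** A smooth substitute for the modulus of G = [hext 0], which is not
    differentiable at the zeros of G. *)
Definition reg x y : R := Num.sqrt (eps ^+ 2 + rnorm (hext 0 x y) ^+ 2).
Let g := reg.
Let u1x x y := 2 * rd 1 0 x y.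
Let u1y x y := 2 * ri 1 0 x y.
Let u2x x y := 2 * (rd 2 0 x y + rd 1 1 x y).
Let u2y x y := 2 * (- rd 2 0 x y + rd 1 1 x y).
Let gx x y := u1x x y / (2 * g x y).
Definition reg_y x y := 2 * rdot dotK ('i *: hext 1 x y) (hext 0 x y) / (2 * reg x y).
Let gy := reg_y.
Let gxx x y := u2x x y / (2 * g x y) - u1x x y ^+ 2 / (4 * g x y ^+ 3).
Let gyy x y := u2y x y / (2 * g x y) - u1y x y ^+ 2 / (4 * g x y ^+ 3).

Let gE x y : g x y = Num.sqrt (u x y).
Proof. by rewrite /g /reg /u rdS. Qed.

Let u0 x y : 0 < u x y.
Proof. by rewrite /u rdS ltr_wpDr ?sqr_ge0 // exprn_gt0. Qed.

Lemma reg_sqr x y : g x y ^+ 2 = eps ^+ 2 + rnorm (hext 0 x y) ^+ 2.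
Proof. by rewrite /g /reg sqr_sqrtr // addr_ge0 ?sqr_ge0. Qed.

Lemma reg_ge0 x y : 0 <= g x y. Proof. exact: sqrtr_ge0. Qed.

Lemma reg_ge x y : eps <= g x y.
Proof.
rewrite -(@ler_pXn2r _ 2) ?nnegrE ?reg_ge0 ?(ltW eps0) // reg_sqr.
by rewrite lerDl sqr_ge0.
Qed.

Lemma reg_gt0 x y : 0 < g x y.
Proof. exact: lt_le_trans eps0 (reg_ge x y). Qed.

Lemma rnorm_le_reg x y : rnorm (hext 0 x y) <= g x y.
Proof.
rewrite -(@ler_pXn2r _ 2) ?nnegrE ?reg_ge0 ?rnorm_ge0 // reg_sqr.
by rewrite lerDr sqr_ge0.
Qed.

Lemma reg_le x y : g x y <= eps + rnorm (hext 0 x y).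
Proof.
rewrite -(@ler_pXn2r _ 2) ?nnegrE ?reg_ge0 ?addr_ge0 ?rnorm_ge0 ?(ltW eps0) //.
rewrite reg_sqr sqrrD addrAC lerDl mulrn_wge0 // mulr_ge0 ?rnorm_ge0 //.
exact: ltW.
Qed.

Let ux x y : is_derive x (1 : R) (u ^~ y) (u1x x y).
Proof.
have := is_deriveD (is_derive_cst (eps ^+ 2) x (1 : R)) (rd_x 0 0 x y).
apply: is_derive_ext => //; rewrite add0r /u1x /rd [X in _ + X]rdotC.
by ring.
Qed.

Let uy x y : is_derive y (1 : R) (u x) (u1y x y).
Proof.
have := is_deriveD (is_derive_cst (eps ^+ 2) y (1 : R)) (rd_y 0 0 x y).
by apply: is_derive_ext => //; rewrite add0r /u1y; ring.
Qed.

Let uxx x y : is_derive x (1 : R) (u1x ^~ y) (u2x x y).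
Proof.
have := is_deriveZ 2 (rd_x 1 0 x y).
exact: is_derive_ext.
Qed.

Let uyy x y : is_derive y (1 : R) (u1y x) (u2y x y).
Proof.
have := is_deriveZ 2 (ri_y 1 0 x y).
exact: is_derive_ext.
Qed.

Lemma is_derive_reg_x x y : is_derive x (1 : R) (g ^~ y) (gx x y).
Proof.
have := @is_derive_sqrt _ (u ^~ y) x _ (u0 x y) (ux x y).
by apply: is_derive_ext => [s|]; rewrite /gx gE.
Qed.

Lemma is_derive_reg_y x y : is_derive y (1 : R) (g x) (gy x y).
Proof.
have := @is_derive_sqrt _ (u x) y _ (u0 x y) (uy x y).
by apply: is_derive_ext => [s|]; rewrite /gy /reg_y -/g gE.
Qed.

Lemma is_derive_reg_xx x y : is_derive x (1 : R) (gx ^~ y) (gxx x y).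
Proof.
have := @is_derive_sqrt2 _ (u ^~ y) (u1x ^~ y) x _ (u0 x y) (ux x y) (uxx x y).
by apply: is_derive_ext => [s|]; rewrite /gx /gxx !gE.
Qed.

Lemma is_derive_reg_yy x y : is_derive y (1 : R) (gy x) (gyy x y).
Proof.
have := @is_derive_sqrt2 _ (u x) (u1y x) y _ (u0 x y) (uy x y) (uyy x y).
by apply: is_derive_ext => [s|]; rewrite /gy /reg_y -/g /gyy !gE.
Qed.

Let D x y := rnorm (hext 1 x y) ^+ 2 / g x y.

(** Subharmonicity of the modulus, in quantitative form. The Laplacian of |G|^2 is
    4 |G'|^2, and its gradient is controlled by the scalar product of G' and G;
    Cauchy-Schwarz in [K] leaves at least half of the first term. *)
Lemma reg_laplacian x y : D x y <= gxx x y + gyy x y.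
Proof.
have g0 := reg_gt0 x y; have gs := reg_sqr x y.
have cs : rd 1 0 x y ^+ 2 + ri 1 0 x y ^+ 2 <= rnorm (hext 1 x y) ^+ 2 * g x y ^+ 2.
  rewrite rdot_i_sqr -exprMn lerXn2r ?nnegrE ?mulr_ge0 ?rnorm_ge0 ?reg_ge0 ?rnormc_ge0 //.
  rewrite (le_trans (rnorm_dot hK _ _)) // ler_wpM2l ?rnorm_ge0 //.
  exact: rnorm_le_reg.
have -> : gxx x y + gyy x y = 2 * rnorm (hext 1 x y) ^+ 2 / g x y -
    (rd 1 0 x y ^+ 2 + ri 1 0 x y ^+ 2) / g x y ^+ 3.
  rewrite /gxx /gyy /u2x /u2y /u1x /u1y rdS; field.
  by rewrite lt0r_neq0.
have : (rd 1 0 x y ^+ 2 + ri 1 0 x y ^+ 2) / g x y ^+ 3 <=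
    rnorm (hext 1 x y) ^+ 2 * g x y ^+ 2 / g x y ^+ 3.
  by rewrite ler_pM2r // invr_gt0 exprn_gt0.
rewrite (_ : _ * _ / _ ^+ 3 = D x y); last by rewrite /D; field; rewrite lt0r_neq0.
rewrite /D -mulrA; lra.
Qed.

Lemma abs_rdot (x y : K) : `|rdot dotK x y| <= rnorm x * rnorm y.
Proof.
rewrite (le_trans _ (rnorm_dot hK _ _)) // /rdot.
rewrite -(@ler_pXn2r _ 2) ?nnegrE ?rnormc_ge0 // (real_normK (num_real _)) rnorm_sqr.
by rewrite lerDl sqr_ge0.
Qed.

Lemma rnormi (x : K) : rnorm ('i *: x) = rnorm x.
Proof. by rewrite rnormZ rnorm_i mul1r. Qed.

Lemma abs_reg_y x y : `|gy x y| <= rnorm (hext 1 x y).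
Proof.
have g0 := reg_gt0 x y.
rewrite /gy /reg_y -/g -mulf_div divff // mul1r normrM normfV (gtr0_norm g0).
rewrite ler_pdivrMr // (le_trans (abs_rdot _ _)) // rnormi ler_wpM2l ?rnorm_ge0 //.
exact: rnorm_le_reg.
Qed.

Definition polybound (p : {poly R[i]}) (r : R) : R :=
  \sum_(i < size p) rnorm (p`_i) * r ^+ i.

Lemma polybound_ge0 p r : 0 <= r -> 0 <= polybound p r.
Proof. by move=> r0; apply: sumr_ge0 => i _; rewrite mulr_ge0 ?rnormc_ge0 ?exprn_ge0. Qed.

Lemma rnorm_horner p (z : R[i]) r : rnorm z <= r -> rnorm p.[z] <= polybound p r.
Proof.
move=> zr; rewrite horner_coef (le_trans (rnormc_sum _ _ _)) //.
apply: ler_sum => i _; rewrite rnormM rnormX ler_wpM2l ?rnormc_ge0 //.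
by rewrite lerXn2r ?nnegrE ?rnormc_ge0 // (le_trans (rnormc_ge0 z)).
Qed.

Lemma hext_bound k : exists2 B, 0 <= B & forall x y, 0 <= x <= T -> -1 < y < 2 ->
  rnorm (hext k x y) <= B.
Proof.
pose B := \sum_(n < N) (rnorm (d n) * (polybound (iter k (dpexp (lam n)) q) (T + 2) * expR (lam n)) * rnorm (b n)).
have T20 : 0 <= T + 2 by rewrite addr_ge0 // ltW.
exists B.
  apply: sumr_ge0 => n _; rewrite !mulr_ge0 ?rnorm_ge0 ?rnormc_ge0 ?polybound_ge0 // expR_ge0.
move=> x y /andP[x0 xT] /andP[y1 y2].
rewrite (le_trans (rnorm_lcomb_le _ _ _)) //; apply: ler_sum => n _.
rewrite ler_wpM2r ?rnorm_ge0 // rnormM ler_wpM2l ?rnormc_ge0 //.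
rewrite /pexp rnormM rnormM rnormc_expi mulr1 rnorm_real ger0_norm ?expR_ge0 //.
rewrite ler_pM ?rnormc_ge0 ?expR_ge0 //.
  apply: rnorm_horner; rewrite (le_trans (rnorm_le_ReIm _)) //=.
  rewrite lerD //; first by rewrite ger0_norm.
  by rewrite ler_norml; apply/andP; split; lra.
rewrite ler_expR; have := lam0 n; nra.
Qed.

(** For differentiating twice under the integral sign. *)
Lemma reg_derivatives_bound : exists M : R, forall x y : R, 0 <= x <= T -> -1 < y < 2 ->
  `|gy x y| <= M /\ `|gyy x y| <= M.
Proof.
have [B0 B00 HB0] := hext_bound 0; have [B1 B10 HB1] := hext_bound 1.
have [B2 B20 HB2] := hext_bound 2.
pose M := (B2 * B0 + B1 * B1) / eps + (B1 * B0) ^+ 2 / eps ^+ 3.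
have M1 : 0 <= (B2 * B0 + B1 * B1) / eps.
  by rewrite divr_ge0 ?addr_ge0 ?mulr_ge0 // ltW.
have M2 : 0 <= (B1 * B0) ^+ 2 / eps ^+ 3.
  by rewrite divr_ge0 ?sqr_ge0 // exprn_ge0 // ltW.
exists (B1 + M) => x y x0T y12; split.
  rewrite (le_trans (abs_reg_y x y)) // (le_trans (HB1 _ _ x0T y12)) // lerDl.
  by rewrite addr_ge0.
have g0 := reg_gt0 x y; have ge := reg_ge x y.
have h1 : `|u2y x y / (2 * g x y)| <= (B2 * B0 + B1 * B1) / eps.
  rewrite /u2y -mulf_div divff // mul1r normrM normfV (gtr0_norm g0).
  rewrite ler_pM ?invr_ge0 ?(ltW g0) //; last by rewrite lef_pV2 ?posrE.
  rewrite (le_trans (ler_normD _ _)) // normrN lerD // (le_trans (abs_rdot _ _)) //.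
    by rewrite ler_pM ?rnorm_ge0 ?HB2 ?HB0.
  by rewrite ler_pM ?rnorm_ge0 ?HB1.
have h2 : `|u1y x y ^+ 2 / (4 * g x y ^+ 3)| <= (B1 * B0) ^+ 2 / eps ^+ 3.
  rewrite (_ : _ / _ = ri 1 0 x y ^+ 2 / g x y ^+ 3); last first.
    by rewrite /u1y; field; rewrite lt0r_neq0.
  rewrite normrM normfV normrX (gtr0_norm (exprn_gt0 3 g0)).
  rewrite ler_pM ?invr_ge0 ?exprn_ge0 ?(ltW g0) //.
    rewrite lerXn2r ?nnegrE ?mulr_ge0 // (le_trans (abs_rdot _ _)) // rnormi.
    by rewrite ler_pM ?rnorm_ge0 ?HB1 ?HB0.
  by rewrite lef_pV2 ?posrE ?exprn_gt0 // lerXn2r ?nnegrE ?(ltW eps0) ?(ltW g0).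
rewrite /gyy (le_trans (ler_normB _ _)) // (le_trans (lerD h1 h2)) //.
by rewrite lerDr.
Qed.

Let crd k l y : continuous (rd k l ^~ y).
Proof. exact: continuous_derive (fun x => rd_x k l x y). Qed.

Let cri k l y : continuous (ri k l ^~ y).
Proof. exact: continuous_derive (fun x => ri_x k l x y). Qed.

Let cg y : continuous (g ^~ y).
Proof. exact: continuous_derive (fun x => is_derive_reg_x x y). Qed.

Let g20 x y : 2 * g x y != 0.
Proof. by rewrite mulf_neq0 // lt0r_neq0 // reg_gt0. Qed.

Let g43 x y : 4 * g x y ^+ 3 != 0.
Proof. by rewrite mulf_neq0 // expf_neq0 // lt0r_neq0 // reg_gt0. Qed.

Lemma continuous_reg_xx y : continuous (gxx ^~ y).
Proof.
apply: continuousBc; apply: continuous_div => //.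
- apply: continuousMc; first exact: continuous_cstc.
  by apply: continuousDc; exact: crd.
- by apply: continuousMc; [exact: continuous_cstc|exact: cg].
- by apply: continuousXc; apply: continuousMc; [exact: continuous_cstc|exact: crd].
- by apply: continuousMc; [exact: continuous_cstc|apply: continuousXc; exact: cg].
Qed.

Lemma continuous_reg_yy y : continuous (gyy ^~ y).
Proof.
apply: continuousBc; apply: continuous_div => //.
- apply: continuousMc; first exact: continuous_cstc.
  apply: continuousDc; last exact: crd.
  by move=> x; apply: cvgN; exact: crd.
- by apply: continuousMc; [exact: continuous_cstc|exact: cg].
- by apply: continuousXc; apply: continuousMc; [exact: continuous_cstc|exact: cri].
- by apply: continuousMc; [exact: continuous_cstc|apply: continuousXc; exact: cg].
Qed.

Lemma continuous_reg_y y : continuous (gy ^~ y).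
Proof.
apply: continuous_div => //.
- by apply: continuousMc; [exact: continuous_cstc|exact: cri].
- by apply: continuousMc; [exact: continuous_cstc|exact: cg].
Qed.

Lemma continuous_hext k y : continuous (fun x => rnorm (hext k x y)).
Proof.
apply: continuous_rnorm_lcomb => n _; apply: cder_ccont => x; exact: cx.
Qed.

Lemma continuous_reg_energy y : continuous (D ^~ y).
Proof.
apply: continuous_div => [||x]; [|exact: cg|by rewrite lt0r_neq0 // reg_gt0].
by apply: continuousXc; exact: continuous_hext.
Qed.

(** A nonpositive discriminant, for a parameter restricted to nonnegative values. *)
Lemma quadratic_cs (M D' N' : R) : 0 <= M -> 0 <= D' -> 0 <= N' ->
  (forall t, 0 <= t -> 2 * t * M <= D' + t ^+ 2 * N') -> M ^+ 2 <= D' * N'.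
Proof.
move=> M0 D0; rewrite le_eqVlt => /predU1P[<- H|N0 H].
  rewrite mulr0; move: M0; rewrite le_eqVlt => /predU1P[<-|M0]; first by rewrite expr0n.
  have := H ((D' + 1) / M) (divr_ge0 (addr_ge0 D0 ler01) (ltW M0)).
  rewrite mulr0 addr0 -mulrA divfK ?lt0r_neq0 //; lra.
have := H (M / N') (divr_ge0 M0 (ltW N0)).
rewrite (_ : 2 * (M / N') * M = 2 * (M ^+ 2 / N')); last by ring.
rewrite (_ : (M / N') ^+ 2 * N' = M ^+ 2 / N'); last by field; rewrite lt0r_neq0.
by move=> H1; rewrite -ler_pdivrMr //; lra.
Qed.

Let w01 (y : R) : 0 <= y <= 1 -> -1 < y < 2.
Proof. by move=> /andP[? ?]; apply/andP; split; lra. Qed.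

(** |G'| is the product of |G'| / sqrt g and sqrt g. *)
Lemma wint_cauchy_schwarz y :
  wint T (fun x y => rnorm (hext 1 x y)) y ^+ 2 <= wint T D y * wint T g y.
Proof.
have Wge (f : R -> R -> R) : (forall x, 0 <= f x y) -> 0 <= wint T f y.
  by move=> f0; apply: integ_ge0 => x x0T; rewrite mulr_ge0 ?weight_ge0.
apply: quadratic_cs; try apply: Wge => x.
- exact: rnorm_ge0.
- by rewrite divr_ge0 ?sqr_ge0 ?reg_ge0.
- exact: reg_ge0.
move=> t t0; rewrite /wint -!integZ -?integD.
- apply: le_integ.
  + apply: continuousMc; first exact: continuous_cstc.
    by apply: continuous_weightM; exact: continuous_hext.
  + apply: continuousDc; first by apply: continuous_weightM; exact: continuous_reg_energy.
    apply: continuousMc; first exact: continuous_cstc.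
    by apply: continuous_weightM; exact: cg.
  move=> x x0T; have g0 := reg_gt0 x y.
  have W0 := weight_ge0 x0T.
  rewrite [leLHS]mulrCA [X in _ + X]mulrCA -mulrDr ler_wpM2l //.
  set r := rnorm _; rewrite /D -/r.
  have -> : r ^+ 2 / g x y + t ^+ 2 * g x y = 2 * t * r + (r - t * g x y) ^+ 2 / g x y.
    by field; rewrite lt0r_neq0.
  by rewrite lerDl divr_ge0 ?sqr_ge0 ?ltW.
- by apply: continuous_weightM; exact: continuous_reg_energy.
- apply: continuousMc; first exact: continuous_cstc.
  by apply: continuous_weightM; exact: cg.
- by apply: continuous_weightM; exact: cg.
- by apply: continuous_weightM; exact: continuous_hext.
Qed.

(** Here [s] bounds the contribution of the vertical sides and [a] the slope at
    the top of the strip. The first conclusion bounds the integrals over horizontal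
    lines by the one on the real axis, the second one is the telescoping form of
    the square function estimate. *)
Lemma reg_green (s a : R) : 0 <= s -> 0 <= a ->
  (forall y, 0 <= y <= 1 -> T * (g 0 y + g T y) <= s) ->
  wint T gy 1 <= a ->
  (forall y, 0 <= y <= 1 -> wint T g y <= wint T g 0 + a + s) /\
  exists E : R -> R,
  [/\ forall y, 0 <= y <= 1 -> E y <= wint T g 0 + s,
      forall y, 0 <= y <= 1 -> - E y <= a + s &
      forall y1 y2, 0 < y1 -> y1 <= y2 -> y2 <= 1 -> exists2 xi, y1 <= xi <= y2 &
        (y2 - y1) * (y1 * wint T D xi) <= E y1 - E y2 + (y2 - y1) * s].
Proof.
move=> s0 a0 sides top.
have [M HM] := reg_derivatives_bound.
have dN (y : R) : 0 <= y <= 1 -> is_derive y (1 : R) (wint T g) (wint T gy y).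
  move=> y01; apply: (@wint_g_derive _ T M g gx gy T0 is_derive_reg_x is_derive_reg_y continuous_reg_y) => [x z x0T z12|]; last exact: w01.
  by have [] := HM _ _ x0T z12.
have dN1 (y : R) : 0 <= y <= 1 -> is_derive y (1 : R) (wint T gy) (wint T gyy y).
  move=> y01; apply: (@wint_gy_derive _ T M gy gyy T0 is_derive_reg_yy continuous_reg_y continuous_reg_yy) => [x z x0T z12|]; last exact: w01.
  by have [] := HM _ _ x0T z12.
have Wge (f : R -> R -> R) y : (forall x, 0 <= f x y) -> 0 <= wint T f y.
  by move=> f0; apply: integ_ge0 => x x0T; rewrite mulr_ge0 ?weight_ge0.
have N0 y : 0 <= wint T g y by apply: Wge => x; exact: reg_ge0.
have D0 y : 0 <= wint T D y.
  by apply: Wge => x; rewrite divr_ge0 ?sqr_ge0 ?reg_ge0.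
have N2D y : 0 <= y <= 1 -> wint T D y - s <= wint T gyy y.
  move=> y01; apply: le_trans (wint_gyy T0 reg_ge0 is_derive_reg_x is_derive_reg_xx continuous_reg_xx continuous_reg_yy continuous_reg_energy reg_laplacian y).
  by rewrite lerD2l lerN2 sides.
split; first exact: (convex_bound dN dN1 D0 s0 top a0 N2D).
exists (fun y => wint T g y - y * wint T gy y); split.
- exact: (convex_E_ub dN dN1 D0 s0 N2D).
- exact: (convex_E_lb dN1 N0 D0 s0 top a0 N2D).
- exact: (convex_window dN dN1 D0 s0 N2D).
Qed.

End Regularized.

(** * Kernels concentrated on a frequency band *)

Section Band.
Variable R : realType.
Implicit Types (h w c x : R).

(** At least half of the grid points j have j + k in the grid, so the translate by
    -k w enters the average with weight at least 1/2. *)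
Lemma fejer_lb (X : R -> R) J (k : nat) x w v : (0 < J)%N -> (2 * k <= J)%N ->
  (forall y, 0 <= X y) -> 0 <= v -> v <= X (x - k%:R * w) ->
  v / 2 <= fejer X J x w.
Proof.
move=> J0 kJ X0 v0 vX; rewrite /fejer ler_pdivlMl ?ltr0n //.
apply: (@le_trans _ _ (\sum_(j < J) if (j < J - k)%N then v else 0)).
  rewrite -big_mkcond /= (big_ord_narrow (leq_subr k J)) /= sumr_const card_ord.
  rewrite -[v *+ _]mulr_natl natrB; last by rewrite (leq_trans _ kJ) // leq_pmull.
  have : 2 * k%:R <= J%:R :> R by rewrite -natrM ler_nat.
  by nra.
apply: ler_sum => j _; case: ifP => jJ; last by apply: sumr_ge0 => l _; exact: X0.
have lJ : (j + k < J)%N by rewrite addnC -ltn_subRL.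
rewrite (bigD1 (Ordinal lJ)) //= -[leLHS]addr0 lerD ?sumr_ge0 //.
by rewrite natrD opprD addrA subrr add0r mulNr.
Qed.

Lemma fejer_ub (X : R -> R) J x w v : (0 < J)%N ->
  (forall j l, (j < J)%N -> (l < J)%N -> X (x + (j%:R - l%:R) * w) <= v) ->
  fejer X J x w <= J%:R * v.
Proof.
move=> J0 Xv; rewrite /fejer ler_pdivrMl ?ltr0n //.
apply: (@le_trans _ _ (\sum_(j < J) \sum_(l < J) v)).
  by apply: ler_sum => j _; apply: ler_sum => l _; apply: Xv; exact: ltn_ord.
by rewrite !sumr_const !card_ord -(mulr_natl (v *+ J)) -(mulr_natl v).
Qed.

Lemma fejer_ge0 (X : R -> R) J x w : (forall y, 0 <= X y) -> 0 <= fejer X J x w.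
Proof.
move=> X0; rewrite mulr_ge0 ?invr_ge0 //.
by apply: sumr_ge0 => j _; apply: sumr_ge0 => l _; exact: X0.
Qed.

(** The step is the distance of the zeros of the symbol: only the diagonal terms
    survive at 0, so that the mass is 1 for every size of the grid. *)
Lemma vieta_fejer0 p h m J : 0 < h -> (0 < m)%N -> (0 < J)%N -> (2 * J <= 2 ^ p)%N ->
  fejer (fun x => vieta p (h * x) ^+ m) J 0 (2 * pi / h) = 1.
Proof.
move=> h0 m0 J0 Jp; rewrite /fejer.
have E (j l : 'I_J) : vieta p (h * (0 + (j%:R - l%:R) * (2 * pi / h))) ^+ m
    = (j == l)%:R :> R.
  rewrite add0r (_ : h * _ = (j%:R - l%:R) * (2 * pi)); last first.
    by move: (pi) => q; field; rewrite lt0r_neq0.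
  have [->|jl] := eqVneq j l; first by rewrite subrr mul0r vieta0 expr1n.
  suff -> : vieta p ((j%:R - l%:R) * (2 * pi)) = 0 :> R by rewrite expr0n eqn0Ngt m0.
  have {}jl : (j : nat) != l by [].
  wlog jl' : j l jl / (l < j)%N => [H|].
    move: (jl); rewrite neq_ltn => /orP[lj|lj]; last exact: H.
    have := H l j; rewrite eq_sym => /(_ jl lj); rewrite -opprB mulNr.
    by rewrite /vieta; under eq_bigr do rewrite mulNr cosN.
  apply: (@vieta_zero _ p _ (j - l)%N); first by rewrite subn_gt0.
    rewrite (leq_trans _ Jp) // leq_pmul2l // (leq_trans (leq_subr _ _)) // ltnW //.
  rewrite natrB ?(ltnW jl') // ger0_norm; first by rewrite mulrC.
  by rewrite mulr_ge0 ?subr_ge0 ?ler_nat ?(ltnW jl') // mulr_ge0 // pi_ge0.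
under eq_bigr do under eq_bigr do rewrite E.
rewrite (eq_bigr (fun=> 1)) => [|j _]; last first.
  rewrite (bigD1 j) //= eqxx big1 ?addr0 // => l /negbTE.
  by rewrite eq_sym => ->.
by rewrite sumr_const card_ord mulVf // pnatr_eq0 -lt0n.
Qed.

(** A plateau of width about [ep * c] around [c]. The size of the grid is
    proportional to [c], whereas the support and the mass of the measure, hence the
    cost of the average, do not depend on [c]. The bound [lmax] only serves to
    choose the number of factors of the product. *)
Lemma band_kernel (ep h : R) (m : nat) : 0 < ep -> ep <= 1 / 4 -> 0 < h -> (0 < m)%N ->
  exists c1 C1 L0 : R, [/\ 0 < c1, 0 <= C1 & forall c lmax, L0 <= c -> 0 < c ->
    exists kap : R -> R[i], [/\ multiplier (m%:R * h) 1 kap,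
      forall l, c <= l -> l <= (1 + ep) * c -> c1 <= rnorm (kap l) &
      forall l, 0 <= l -> l <= lmax -> 4 * ep * c <= `|l - c| ->
        rnorm (kap l) * Num.max l c ^+ (2 * m) <= C1 * c]].
Proof.
move=> ep0 ep4 h0 m0; have c0 := cosgap_gt0 R.
pose w : R := 2 * pi / h.
have w0 : 0 < w by rewrite divr_gt0 // mulr_gt0 // pi_gt0.
have hw : h * (w / 2) = pi.
  by rewrite /w; move: (pi) => q; field; rewrite lt0r_neq0.
pose A : R := 8 / (cosgap R * h ^+ 2 * ep ^+ 2).
have A0 : 0 < A by rewrite divr_gt0 // !mulr_gt0 // exprn_gt0.
exists ((2 * cosgap R) ^+ m / 2), (3 * ep / w * A ^+ m), (2 * w / ep); split.
- by rewrite divr_gt0 // exprn_gt0 // mulr_gt0.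
- by rewrite mulr_ge0 ?exprn_ge0 ?(ltW A0) // divr_ge0 ?(ltW w0) // mulr_ge0 // ltW.
move=> c lmax Lc cc0.
have epw : 2 <= ep * c / w.
  by rewrite ler_pdivlMr // -ler_pdivrMl // mulrC.
pose J := (Num.truncn (2 * (ep * c / w))).+2.
have /andP[J1 J2] : (J%:R - 2 <= 2 * (ep * c / w)) && (2 * (ep * c / w) <= J%:R - 1).
  have x0 : 0 <= 2 * (ep * c / w) by lra.
  have := truncn_itv x0 => /andP[h1 h2].
  have n1 (n : nat) : n.+1%:R = n%:R + 1 :> R by rewrite natr1.
  move: h1 h2; rewrite /J; set n := Num.truncn _; set t := 2 * _.
  by rewrite (n1 n.+1) (n1 n) => h1 h2; apply/andP; split; lra.
have Jw : J%:R * w <= 3 * (ep * c).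
  have : J%:R <= 3 * (ep * c / w) by lra.
  move=> /(ler_wpM2r (ltW w0)); rewrite (_ : 3 * (ep * c / w) * w = 3 * (ep * c)) //.
  by field; rewrite lt0r_neq0.
have [p1 p1P] := @exists_pow2 R (`|h| * (`|lmax| + c + J%:R * w)).
have [p2 p2P] := @exists_pow2 R (2 * J%:R).
pose p := (p1 + p2)%N.
have pJ : (2 * J <= 2 ^ p)%N.
  have : (2 * J <= 2 ^ p2)%N by rewrite -(ler_nat R) natrM natrX.
  by move=> /leq_trans; apply; rewrite leq_exp2l // leq_addl.
have pr : `|h| * (`|lmax| + c + J%:R * w) <= 2 ^+ p * pi.
  apply: (le_trans p1P); rewrite exprD.
  have q1 : 0 < 2 ^+ p1 :> R by rewrite exprn_gt0.
  have q2 : 1 <= 2 ^+ p2 :> R by rewrite exprn_ege1 // ler1n.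
  by rewrite -mulrA ler_peMr ?(ltW q1) //; have := pi_ge2 R; nra.
pose X x : R := vieta p (h * x) ^+ m.
have X0 x : 0 <= X x by rewrite exprn_ge0 // vieta_ge0.
exists (fun x => (fejer X J (x - c) w)%:C); split.
- have := fejer_multiplier J w c (pkernelX m (pkernel_vieta p (ltW h0))).
  by rewrite vieta_fejer0.
- move=> l cl lc; rewrite rnorm_real ger0_norm; last exact: fejer_ge0.
  have x0 : 0 <= (l - c) / w + 1 / 2 by rewrite addr_ge0 // divr_ge0 ?subr_ge0 // ltW.
  have := truncn_itv x0; set k := Num.truncn _ => /andP[k1 k2].
  have xw : (l - c) / w <= ep * c / w by rewrite ler_pM2r ?invr_gt0 //; lra.
  apply: (@fejer_lb X J k) => //.
  + by rewrite -(ler_nat R) natrM; lra.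
  + by rewrite exprn_ge0 // mulr_ge0 // ltW.
  rewrite /X lerXn2r ?nnegrE ?vieta_ge0 ?mulr_ge0 ?(ltW c0) // vieta_lb //.
  rewrite normrM (gtr0_norm h0) -hw ler_pM2l // ler_norml.
  have E : l - c - k%:R * w = ((l - c) / w - k%:R) * w by field; rewrite lt0r_neq0.
  rewrite E (_ : w / 2 = 1 / 2 * w); last by lra.
  rewrite -mulNr !ler_pM2r //; move: k2; rewrite -[k.+1%:R]natr1 => k2.
  by apply/andP; split; lra.
- move=> l l0 ll far; set mu := Num.max l c.
  have lmu : l <= mu by rewrite le_max lexx.
  have cmu : c <= mu by rewrite le_max lexx orbT.
  have mulc : mu = l \/ mu = c.
    by rewrite /mu; case: (leP l c) => _; [right|left].
  rewrite rnorm_real ger0_norm; last exact: fejer_ge0.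
  have mu0 : 0 < mu by exact: lt_le_trans cmu.
  (* Far from c, the distance to c is comparable to the larger of l and c. *)
  have xmu : 2 * ep * mu <= `|l - c|.
    have [l2c|c2l] := leP l (2 * c).
      case: mulc => ->; last by move: far; nra.
      by move: far; nra.
    rewrite ger0_norm; last by lra.
    by case: mulc => ->; nra.
  pose v := A ^+ m / mu ^+ (2 * m).
  have H : fejer X J (l - c) w <= J%:R * v.
    apply: fejer_ub => // j k jJ kJ; rewrite /X /v exprM -expr_div_n.
    have jk : `|(j%:R - k%:R) * w| <= J%:R * w.
      rewrite normrM (gtr0_norm w0) ler_pM2r // ler_norml.
      have jJ' : j%:R <= J%:R :> R by rewrite ler_nat ltnW.
      have kJ' : k%:R <= J%:R :> R by rewrite ler_nat ltnW.
      have j0 : 0 <= j%:R :> R by []. have k0 : 0 <= k%:R :> R by [].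
      by apply/andP; split; lra.
    set z := l - c + _.
    (* The translates move the symbol by at most 3 ep c, that is at most three
       quarters of the distance to c. *)
    have zl : `|l - c| / 4 <= `|z|.
      have := lerB_dist (l - c) (- ((j%:R - k%:R) * w)); rewrite opprK normrN -/z.
      by lra.
    have zr : `|h * z| <= 2 ^+ p * pi.
      apply: le_trans pr; rewrite normrM ler_wpM2l // (le_trans (ler_normD _ _)) //.
      rewrite lerD // (le_trans (ler_normB _ _)) // (ger0_norm l0) (gtr0_norm cc0) lerD2r.
      by rewrite (le_trans ll) // ler_norm.
    have := vieta_decay zr; have := vieta_ge0 p (h * z); set V := vieta _ _ => V0 VD.
    have Amu : 0 <= A / mu ^+ 2 by rewrite divr_ge0 ?sqr_ge0 // ltW.
    rewrite lerXn2r ?nnegrE //.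
    rewrite ler_pdivlMr ?exprn_gt0 // /A ler_pdivlMr; last first.
      by rewrite !mulr_gt0 // exprn_gt0.
    have z2 : ep ^+ 2 * mu ^+ 2 / 4 <= z ^+ 2.
      rewrite -(real_normK (num_real z)).
      have : (ep * mu / 2) ^+ 2 <= `|z| ^+ 2.
        rewrite lerXn2r ?nnegrE ?divr_ge0 ?mulr_ge0 ?(ltW ep0) ?(ltW mu0) //; lra.
      by rewrite (_ : (ep * mu / 2) ^+ 2 = ep ^+ 2 * mu ^+ 2 / 4) //; field.
    have : cosgap R * h ^+ 2 * V * (ep ^+ 2 * mu ^+ 2 / 4) <= cosgap R * h ^+ 2 * V * z ^+ 2.
      by rewrite ler_wpM2l // mulr_ge0 // mulr_ge0 ?sqr_ge0 // ltW.
    by move: VD; rewrite exprMn; lra.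
  have mu2 : 0 < mu ^+ (2 * m) by rewrite exprn_gt0.
  apply: (@le_trans _ _ (J%:R * v * mu ^+ (2 * m))); first by rewrite ler_pM2r.
  rewrite /v -mulrA divfK ?lt0r_neq0 //.
  rewrite mulrAC ler_wpM2r ?exprn_ge0 ?(ltW A0) //.
  rewrite mulrAC ler_pdivlMr // -mulrA //.
Qed.

End Band.

(** * High frequencies *)

Section Geometric.
Variables (R : realType) (r : R).

Lemma exists_geometric (x : R) : 1 < r -> exists k, x < r ^+ k.
Proof.
move=> r1; pose ep := r - 1; have ep0 : 0 < ep by rewrite subr_gt0.
have H k : 1 + k%:R * ep <= r ^+ k.
  elim: k => [|k IH]; first by rewrite mul0r addr0 expr0.
  have r0 : 0 <= r by rewrite (le_trans ler01) // ltW.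
  rewrite exprS -[k.+1%:R]natr1 (le_trans _ (ler_wpM2l r0 IH)) //.
  have : 0 <= k%:R * ep * ep by rewrite !mulr_ge0 // ltW.
  have -> : r = 1 + ep by rewrite /ep addrC subrK.
  by lra.
exists (Num.Def.archi_bound (`|x| / ep)).
have := archi_boundP (divr_ge0 (normr_ge0 x) (ltW ep0)); set k := Num.Def.archi_bound _.
rewrite ltr_pdivrMr // => xk.
by rewrite (le_lt_trans (ler_norm x)) // (lt_le_trans xk) // (le_trans _ (H k)) // lerDr.
Qed.

Lemma geometric_bracket j0 J (x : R) : r ^+ j0 <= x -> x < r ^+ (j0 + J) ->
  exists2 i, (i < J)%N & r ^+ (j0 + i) <= x < r * r ^+ (j0 + i).
Proof.
move=> xj; elim: J => [|J IH]; first by rewrite addn0 ltNge xj.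
rewrite addnS exprS => xJ; have [xl|xg] := ltP x (r ^+ (j0 + J)).
  by have [i iJ H] := IH xl; exists i => //; exact: ltnW.
by exists J => //; rewrite xg.
Qed.

End Geometric.

Section Decay.
Variable R : realType.

(** Raise t / m <= e^(t / m) to the power m. *)
Lemma exp_decay (m : nat) (t : R) : 0 <= t ->
  t ^+ m * expR (- t) <= m%:R ^+ m.
Proof.
move=> t0; case: m => [|m]; first by rewrite !expr0 mul1r -[leRHS]expR0 ler_expR oppr_le0.
have m0 : 0 < m.+1%:R :> R by rewrite ltr0n.
have tm : t / m.+1%:R <= expR (t / m.+1%:R).
  by rewrite (le_trans _ (expR_ge1Dx _)) // lerDr.
have : (t / m.+1%:R) ^+ m.+1 <= expR t.
  have -> : expR t = expR (t / m.+1%:R) ^+ m.+1.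
    by rewrite -expRM_natl; congr expR; rewrite mulrC divfK // lt0r_neq0.
  by rewrite lerXn2r ?nnegrE ?divr_ge0 ?expR_ge0.
rewrite expr_div_n ler_pdivrMr ?exprn_gt0 // mulrC => H.
by rewrite expRN ler_pdivrMr ?expR_gt0.
Qed.

(** The exponential pays for e + 1 powers of the frequency with as many powers of
    the height, one of which becomes the gain 1 / L. *)
Lemma side_decay (e : nat) (L l y : R) : 1 <= L -> L <= l -> 0 <= y ->
  y ^+ e.+1 * (1 + l) ^+ e * expR (- (y * l)) <= 2 ^+ e * e.+1%:R ^+ e.+1 / L.
Proof.
move=> L1 Ll y0; have l1 : 1 <= l by exact: le_trans Ll.
have l0 : 0 < l by exact: lt_le_trans ltr01 l1.
have L0 : 0 < L by exact: lt_le_trans ltr01 L1.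
have yl : 0 <= y * l by rewrite mulr_ge0 // ltW.
have H := exp_decay e.+1 yl.
apply: (@le_trans _ _ (y ^+ e.+1 * (2 * l) ^+ e * expR (- (y * l)))).
  rewrite ler_wpM2r ?expR_ge0 // ler_wpM2l ?exprn_ge0 //.
  by rewrite lerXn2r ?nnegrE ?addr_ge0 ?mulr_ge0 ?(ltW l0) //; lra.
have -> : y ^+ e.+1 * (2 * l) ^+ e * expR (- (y * l)) =
    2 ^+ e * ((y * l) ^+ e.+1 * expR (- (y * l))) / l.
  by rewrite !exprMn exprS (exprS l); field; rewrite lt0r_neq0.
rewrite ler_pM ?invr_ge0 ?(ltW l0) ?mulr_ge0 ?exprn_ge0 ?expR_ge0 //.
  by rewrite ler_wpM2l ?exprn_ge0.
by rewrite lef_pV2 ?posrE.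
Qed.

End Decay.

Section Weight.
Variables (R : realType) (S : R) (M : nat).
Hypothesis S0 : 0 < S.

(** It vanishes to the order [M] at the lower corners 0 and [S] of the strip, so it
    is O(y^M) on the vertical sides; being holomorphic, it can multiply the
    extension of the wave. *)
Definition cornerpoly : {poly R[i]} := ('X * ((S%:C)%:P - 'X)) ^+ M.
Let q := cornerpoly.

Lemma horner_corner (z : R[i]) : q.[z] = (z * (S%:C - z)) ^+ M.
Proof. by rewrite /q /cornerpoly horner_exp hornerM hornerX hornerD hornerN hornerX hornerC. Qed.

Lemma rnorm_corner_lb (th x y : R) : 0 <= th -> th <= x -> x <= S - th ->
  th ^+ (2 * M) <= rnorm q.[x +i* y].
Proof.
move=> th0 xth xS; rewrite horner_corner rnormX rnormM exprM.
rewrite lerXn2r ?nnegrE ?exprn_ge0 ?mulr_ge0 ?rnormc_ge0 //.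
rewrite expr2 ler_pM //; rewrite (le_trans _ (abs_Re_le_rnorm _)) //=.
  by rewrite (le_trans xth) // ler_norm.
by rewrite (le_trans _ (ler_norm _)) // ; lra.
Qed.

Lemma rnorm_z_le (x y : R) : 0 <= x <= S -> 0 <= y <= 1 -> rnorm (x +i* y) <= S + 1.
Proof.
move=> /andP[? ?] /andP[? ?]; rewrite (le_trans (rnorm_le_ReIm _)) //=.
by rewrite lerD // ger0_norm.
Qed.

Lemma rnorm_Im (y : R) : 0 <= y -> rnorm (0 +i* y) = y.
Proof. by move=> y0; rewrite /rnorm normc_def /= expr0n add0r sqrtr_sqr ger0_norm. Qed.

Lemma rnorm_corner_left (y : R) : 0 <= y <= 1 -> rnorm q.[0 +i* y] <= y ^+ M * (S + 1) ^+ M.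
Proof.
move=> y01; case/andP: (y01) => y0 y1; rewrite horner_corner rnormX rnormM -exprMn rnorm_Im //.
rewrite lerXn2r ?nnegrE ?mulr_ge0 ?rnormc_ge0 ?addr_ge0 ?(ltW S0) //.
rewrite ler_wpM2l //.
have -> : S%:C - 0 +i* y = - (- S +i* y).
  by apply/eqP; rewrite eq_complex /= opprK subr0 sub0r !eqxx.
rewrite /rnorm normrN -/(rnorm (- S +i* y)) (le_trans (rnorm_le_ReIm _)) //=.
by rewrite normrN lerD // ger0_norm // ltW.
Qed.

Lemma rnorm_corner_right (y : R) : 0 <= y <= 1 -> rnorm q.[S +i* y] <= y ^+ M * (S + 1) ^+ M.
Proof.
move=> y01; case/andP: (y01) => y0 y1; rewrite horner_corner rnormX rnormM -exprMn.
rewrite lerXn2r ?nnegrE ?mulr_ge0 ?rnormc_ge0 ?addr_ge0 ?(ltW S0) //.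
have -> : S%:C - S +i* y = - (0 +i* y).
  by apply/eqP; rewrite eq_complex /= subrr oppr0 sub0r !eqxx.
rewrite [X in _ * X](_ : _ = y); last by rewrite /rnorm normrN -/(rnorm _) rnorm_Im.
rewrite mulrC ler_wpM2l // rnorm_z_le // lexx andbT; exact: ltW.
Qed.

End Weight.

Section High.
Variables (R : realType) (K : completeNormedModType R[i]).
Variable dotK : {dot K for (@Num.conj R[i])}.
Hypothesis hK : hilbert_dot dotK.
Variables (b : nat -> K) (lam : nat -> R).
Hypothesis lam0 : forall n, 0 < lam n.
Variables (e : nat) (C0 : R).
Hypothesis C00 : 0 <= C0.
Hypothesis admissible : forall N d,
  rnorm (lcomb b N d) <= C0 * ell2 N (fun n => (1 + lam n)%:C ^+ e * d n).
Variables (T th : R).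
Hypothesis T0 : 0 < T.
Hypothesis th0 : 0 < th.

(** On each side, a margin [th] keeps away from the corners and another one makes
    room for the support of the band kernel. *)
Definition horizon : R := T + 4 * th.
Let S := horizon.
Let q := cornerpoly S e.+1.

Let S0 : 0 < S. Proof. by rewrite /S /horizon addr_gt0 // mulr_gt0. Qed.

(** Coefficients of the extension at height [y], and of its derivative divided
    by i. *)
Definition damp (y : R) (d : nat -> R[i]) n : R[i] := (expR (- (y * lam n)))%:C * d n.
Definition damp1 (y : R) (d : nat -> R[i]) n : R[i] := (lam n)%:C * damp y d n.

Lemma hext0E N d x y : hext b lam N d q 0 x y =
  q.[x +i* y] *: wave b lam N (damp y d) x.
Proof.
rewrite /hext /wave -lcombZ; apply: eq_lcomb => n _.
rewrite /= /pexp /damp; move: (q.[_]) (expR _)%:C (expi _) => u v w; ring.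
Qed.

Lemma hext1E N d x y : hext b lam N d q 1 x y =
  q^`().[x +i* y] *: wave b lam N (damp y d) x +
  ('i * q.[x +i* y]) *: wave b lam N (damp1 y d) x.
Proof.
rewrite /hext /wave -!lcombZ -lcombD; apply: eq_lcomb => n _.
rewrite /= /pexp /dpexp hornerD hornerZ /damp1 /damp.
move: (q.[_]) (q^`().[_]) (expR _)%:C (expi _) (_%:C) => u u' v w l; ring.
Qed.

Let Q0 := polybound q (S + 1).
Let Q1 := polybound q^`() (S + 1).

Let Q00 : 0 <= Q0. Proof. by apply: polybound_ge0; rewrite addr_ge0 // ltW. Qed.
Let Q10 : 0 <= Q1. Proof. by apply: polybound_ge0; rewrite addr_ge0 // ltW. Qed.

Lemma corner_ub x y : 0 <= x <= S -> 0 <= y <= 1 -> rnorm q.[x +i* y] <= Q0.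
Proof. by move=> xS y1; apply: rnorm_horner; exact: rnorm_z_le. Qed.

Lemma dcorner_ub x y : 0 <= x <= S -> 0 <= y <= 1 -> rnorm q^`().[x +i* y] <= Q1.
Proof. by move=> xS y1; apply: rnorm_horner; exact: rnorm_z_le. Qed.

Lemma rnorm_damp y d n : rnorm (damp y d n) = expR (- (y * lam n)) * rnorm (d n).
Proof. by rewrite /damp rnormM rnorm_real ger0_norm // expR_ge0. Qed.

Lemma rnorm_damp1 y d n : rnorm (damp1 y d n) = lam n * expR (- (y * lam n)) * rnorm (d n).
Proof. by rewrite /damp1 rnormM rnorm_damp rnorm_real ger0_norm ?(ltW (lam0 n)) // mulrA. Qed.

Let cs : R := (S + 1) ^+ e.+1 * C0 * (2 ^+ e * e.+1%:R ^+ e.+1).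

(** The powers of y given by the zeros of [q] at the corners are what
    [side_decay] requires. *)
Lemma hext_side N d (L x y : R) : 1 <= L -> 0 <= y <= 1 -> x = 0 \/ x = S ->
  (forall n, (n < N)%N -> d n != 0 -> L <= lam n) ->
  rnorm (hext b lam N d q 0 x y) <= cs * (ell2 N d / L).
Proof.
move=> L1 y01 xx dL; have y0 : 0 <= y by case/andP: y01.
have L0 : 0 < L by exact: lt_le_trans L1.
have S10 : 0 <= (S + 1) ^+ e.+1 by rewrite exprn_ge0 // addr_ge0 // ltW.
have H : rnorm q.[x +i* y] <= y ^+ e.+1 * (S + 1) ^+ e.+1.
  by case: xx => ->; [exact: rnorm_corner_left|exact: rnorm_corner_right].
rewrite hext0E rnormZ (le_trans (ler_wpM2r (rnorm_ge0 _) H)) //.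
rewrite [_ * (S + 1) ^+ _]mulrC -!mulrA ler_wpM2l //.
have -> : y ^+ e.+1 * rnorm (wave b lam N (damp y d) x) =
    rnorm (wave b lam N (fun n => (y ^+ e.+1)%:C * damp y d n) x).
  rewrite -[y ^+ e.+1 in LHS]ger0_norm ?exprn_ge0 // -rnorm_real -rnormZ -lcombZ.
  by congr rnorm; apply: eq_lcomb => n _; rewrite mulrCA.
rewrite (le_trans (rnorm_wave_ell2 lam0 C00 admissible (c := 2 ^+ e * e.+1%:R ^+ e.+1 / L) (d' := d) x _ _)) //.
- by rewrite divr_ge0 ?(ltW L0) // mulr_ge0 // exprn_ge0.
- move=> n nN; have [dn|dn] := eqVneq (d n) 0.
    by rewrite rnormM rnorm_damp dn rnormc0 !mulr0.
  rewrite rnormM rnorm_damp rnorm_real ger0_norm ?exprn_ge0 //.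
  rewrite !mulrA ler_wpM2r ?rnormc_ge0 //.
  rewrite [X in X * expR _]mulrC; exact: side_decay (dL _ nN dn) y0.
- by rewrite -!mulrA; do 3 (rewrite ler_wpM2l ?exprn_ge0 //); rewrite mulrC.
Qed.

Let ct : R := (Q0 + Q1) * C0 * (2 ^+ e.+1 * e.+2%:R ^+ e.+2).

(** At height 1 the exponential alone is enough. *)
Lemma hext_top N d (L x : R) : 1 <= L -> 0 <= x <= S ->
  (forall n, (n < N)%N -> d n != 0 -> L <= lam n) ->
  rnorm (hext b lam N d q 1 x 1) <= ct * (ell2 N d / L).
Proof.
move=> L1 xS dL; have L0 : 0 < L by exact: lt_le_trans L1.
have y01 : 0 <= (1 : R) <= 1 by rewrite ler01 lexx.
pose c : R := 2 ^+ e.+1 * e.+2%:R ^+ e.+2 / L.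
have c0 : 0 <= c by rewrite divr_ge0 ?(ltW L0) // mulr_ge0 // exprn_ge0.
have Hd n : (n < N)%N -> d n != 0 -> (1 + lam n) ^+ e.+1 * expR (- (1 * lam n)) <= c.
  move=> nN dn; have := side_decay e.+1 L1 (dL _ nN dn) ler01.
  by rewrite expr1n mul1r.
have H0 : rnorm (wave b lam N (damp 1 d) x) <= C0 * c * ell2 N d.
  apply: (rnorm_wave_ell2 lam0 C00 admissible) => // n nN.
  have [dn|dn] := eqVneq (d n) 0; first by rewrite rnorm_damp dn rnormc0 !mulr0.
  rewrite rnorm_damp mulrA ler_wpM2r ?rnormc_ge0 // (le_trans _ (Hd n nN dn)) //.
  rewrite ler_wpM2r ?expR_ge0 // exprS ler_peMl ?exprn_ge0 ?addr_ge0 ?(ltW (lam0 n)) //.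
  by rewrite lerDl ltW.
have H1 : rnorm (wave b lam N (damp1 1 d) x) <= C0 * c * ell2 N d.
  apply: (rnorm_wave_ell2 lam0 C00 admissible) => // n nN.
  have [dn|dn] := eqVneq (d n) 0; first by rewrite rnorm_damp1 dn rnormc0 !mulr0.
  rewrite rnorm_damp1 mulrA ler_wpM2r ?rnormc_ge0 // (le_trans _ (Hd n nN dn)) //.
  rewrite mulrA ler_wpM2r ?expR_ge0 // exprSr ler_wpM2l ?exprn_ge0 ?addr_ge0 ?(ltW (lam0 n)) //.
  by rewrite lerDr.
rewrite hext1E (le_trans (rnormD _ _)) // !rnormZ rnormM rnorm_i mul1r.
have -> : ct * (ell2 N d / L) = Q1 * (C0 * c * ell2 N d) + Q0 * (C0 * c * ell2 N d).
  by rewrite /ct /c; move: Q0 Q1 => ? ?; field; rewrite lt0r_neq0.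
by rewrite lerD // ler_pM ?rnormc_ge0 ?rnorm_ge0 ?dcorner_ub ?corner_ub.
Qed.

Variables (ep Cd L1 : R).
Hypothesis ep0 : 0 < ep.
Hypothesis ep4 : ep <= 1 / 4.
Hypothesis Cd0 : 0 < Cd.
Hypothesis dyadic : forall c N d, L1 <= c ->
  (forall n, (n < N)%N -> ~~ (`|lam n - c| < 4 * ep * c) -> d n = 0) ->
  ell2 N d <= Cd * obs b lam N d 0 T.

Let k0 : R := th ^+ (2 * e.+1).
Let k00 : 0 < k0. Proof. by rewrite exprn_gt0. Qed.
Let P : R := (k0 * th ^+ 2)^-1.
Let P0 : 0 < P. Proof. by rewrite invr_gt0 mulr_gt0 // exprn_gt0. Qed.

Let hx N d := hext b lam N d q.
Let rg N d eta := reg b lam N d q eta.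

(** q F' = G' - q' F, and away from the sides both [q] and the weight are bounded
    below. *)
Lemma damp1_le N d eta x y : 0 < eta -> th <= x -> x <= S - th -> 0 <= y <= 1 ->
  rnorm (wave b lam N (damp1 y d) x) <=
  P * (weight S x * rnorm (hx N d 1 x y) + Q1 / k0 * (weight S x * rg N d eta x y)).
Proof.
move=> eta0 xth xS y01.
have x0S : 0 <= x <= S by apply/andP; split; have := th0; lra.
have kq := rnorm_corner_lb (S := S) e.+1 y (ltW th0) xth xS.
set w1 := wave b lam N (damp1 y d) x; set w0 := wave b lam N (damp y d) x.
have H0 : k0 * rnorm w0 <= rg N d eta x y.
  apply: le_trans (rnorm_le_reg _ _ _ _ _ _ _ _).
  by rewrite hext0E rnormZ ler_wpM2r ?rnorm_ge0.
have H1 : k0 * rnorm w1 <= rnorm (hx N d 1 x y) + Q1 * rnorm w0.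
  have -> : hx N d 1 x y = q^`().[x +i* y] *: w0 + ('i * q.[x +i* y]) *: w1 by exact: hext1E.
  apply: (@le_trans _ _ (rnorm (('i * q.[x +i* y]) *: w1))).
    by rewrite rnormZ rnormM rnorm_i mul1r ler_wpM2r ?rnorm_ge0.
  set u := q^`().[_] *: w0; set v := _ *: w1.
  have vE : v = (u + v) - u by rewrite addrAC subrr add0r.
  rewrite {1}vE (le_trans (rnormD _ _)) // rnormN lerD2l /u rnormZ.
  by rewrite ler_wpM2r ?rnorm_ge0 // dcorner_ub.
have W : th ^+ 2 <= weight S x.
  by rewrite /weight expr2 ler_pM ?(ltW th0) //; lra.
have H2 : rnorm w0 <= rg N d eta x y / k0 by rewrite ler_pdivlMr // mulrC.
have H3 : k0 * rnorm w1 <= rnorm (hx N d 1 x y) + Q1 / k0 * rg N d eta x y.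
  apply: (le_trans H1); rewrite lerD2l -mulrA [k0^-1 * _]mulrC.
  by rewrite ler_wpM2l.
rewrite ler_pdivlMl; last by rewrite mulr_gt0 // exprn_gt0.
rewrite [X in _ + X]mulrCA -mulrDr [k0 * _]mulrC -mulrA.
rewrite ler_pM ?sqr_ge0 //.
by rewrite mulr_ge0 ?rnorm_ge0 ?(ltW k00).
Qed.

Lemma obs_damp1 N d eta y : 0 < eta -> 0 <= y <= 1 ->
  obs b lam N (damp1 y d) th (S - th) <=
  P * (wint S (fun x y => rnorm (hx N d 1 x y)) y + Q1 / k0 * wint S (rg N d eta) y).
Proof.
move=> eta0 y01.
have c1 : continuous (fun x => weight S x * rnorm (hx N d 1 x y)).
  by apply: continuous_weightM; exact: continuous_hext.
have c2 : continuous (fun x => weight S x * rg N d eta x y).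
  apply: continuous_weightM; apply: continuous_derive => x; exact: (is_derive_reg_x hK).
have c3 : continuous (fun x => Q1 / k0 * (weight S x * rg N d eta x y)).
  by apply: continuousMc; first exact: continuous_cstc.
have c4 : continuous (fun x => P * (weight S x * rnorm (hx N d 1 x y) +
   Q1 / k0 * (weight S x * rg N d eta x y))).
  apply: continuousMc; first exact: continuous_cstc.
  exact: continuousDc.
rewrite /wint -integZ // -integD // -integZ; last exact: continuousDc.
apply: (@le_trans _ _ (integ th (S - th) (fun x => P * (weight S x * rnorm (hx N d 1 x y) +
   Q1 / k0 * (weight S x * rg N d eta x y))))).
  apply: le_integ => // [|x /andP[x1 x2]]; first exact: continuous_wave.
  exact: damp1_le.
apply: sub_integ => // [x x0S||]; first 1 last.
- exact: ltW.
- by rewrite gerBl ltW.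
rewrite mulr_ge0 ?(ltW P0) // addr_ge0 // mulr_ge0 ?weight_ge0 ?rnorm_ge0 //.
  by rewrite divr_ge0 // ltW.
by rewrite mulr_ge0 ?weight_ge0 // reg_ge0.
Qed.

(** The derivative of the extension at height [y] has coefficients of size about
    [c * d n] in the band, because y c <= 1. The average by the band kernel is
    split: the part near [c] goes into the dyadic hypothesis, and the remainder has
    coefficients bounded by those of [d], in spite of the observation, thanks to
    the decay of the symbol. *)
Lemma window_bound : exists A L0 : R, 0 < A /\ forall c N d eta y, L0 <= c -> 1 <= c ->
  0 < eta -> 0 <= y <= 1 -> y * c <= 1 ->
  c * ell2 N (fun n => if c <= lam n < (1 + ep) * c then d n else 0) <=
  A * (wint S (fun x y => rnorm (hx N d 1 x y)) y + wint S (rg N d eta) y + ell2 N d).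
Proof.
(* The decay of the power e + 2 of the product beats the e powers lost by the
   observation, the frequency brought by the derivative and the factor c of
   band_kernel; the support fits in th. *)
pose h : R := th / e.+2%:R.
have h0 : 0 < h by rewrite divr_gt0 // ltr0n.
have mh : e.+2%:R * h = th by rewrite mulrC divfK // pnatr_eq0.
have [c1 [C1 [L0 [c10 C10 band]]]] := band_kernel ep0 ep4 h0 (ltn0Sn e.+1).
pose c3 : R := 2 ^+ e.+1 * C1.
have c30 : 0 <= c3 by rewrite mulr_ge0 // exprn_ge0.
have C0c : 0 <= T * C0 * c3 by rewrite !mulr_ge0 // ltW.
pose A : R := expR 2 / c1 * Cd * (P + P * (Q1 / k0) + T * C0 * c3).
have P00 := ltW P0.
have Qk : 0 <= Q1 / k0 by rewrite divr_ge0 // ltW.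
have PQ : 0 <= P * (Q1 / k0) by rewrite mulr_ge0.
have E0 : 0 < expR 2 / c1 * Cd by rewrite mulr_gt0 // divr_gt0 // expR_gt0.
exists A, (Num.max L0 L1); split.
  by rewrite mulr_gt0 // ltr_wpDr // ltr_wpDr.
move=> c N d eta y; rewrite ge_max => /andP[L0c L1c] c1' eta0 y01 yc.
have c0 : 0 < c by exact: lt_le_trans ltr01 c1'.
have [y0 y1] := andP y01.
pose lmax := \sum_(n < N) lam n.
have lmaxP n : (n < N)%N -> lam n <= lmax.
  move=> nN; rewrite /lmax (bigD1 (Ordinal nN)) //= lerDl.
  by apply: sumr_ge0 => i _; exact: ltW.
have [kap [mkap core tail]] := band c lmax L0c c0.
pose near n := `|lam n - c| < 4 * ep * c.
pose d1 n : R[i] := if near n then kap (lam n) * damp1 y d n else 0.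
pose d2 n : R[i] := if near n then 0 else kap (lam n) * damp1 y d n.
set ell := ell2 N d; have ell0 : 0 <= ell by exact: ell2_ge0.
set MM := wint S _ y; set NN := wint S _ y.
have H1 : c * ell2 N (fun n => if c <= lam n < (1 + ep) * c then d n else 0) <=
    expR 2 / c1 * ell2 N d1.
  rewrite -ler_pdivlMl // mulrA; apply: le_ell2.
    by rewrite mulr_ge0 ?invr_ge0 ?divr_ge0 ?expR_ge0 ?(ltW c0) ?(ltW c10).
  move=> n nN; case: ifP => [/andP[cl lc]|_]; last first.
    by rewrite rnormc0 mulr_ge0 ?rnormc_ge0 // mulr_ge0 ?invr_ge0 ?divr_ge0 ?expR_ge0 ?(ltW c0) ?(ltW c10).
  have nn : near n by rewrite /near ger0_norm ?subr_ge0 //; have := ep0; nra.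
  rewrite /d1 nn rnormM rnorm_damp1.
  have hc := core _ cl (ltW lc).
  (* y lam n <= (1 + ep) y c <= 2. *)
  have he : expR (- 2) <= expR (- (y * lam n)).
    rewrite ler_expR lerN2; have : y * lam n <= y * ((1 + ep) * c) by rewrite ler_wpM2l // ltW.
    have := ep0; have := ep4; nra.
  have H : c1 * (c * expR (- 2)) <= rnorm (kap (lam n)) * (lam n * expR (- (y * lam n))).
    have ee := expR_ge0 (- 2 : R).
    rewrite ler_pM ?(ltW c10) ?mulr_ge0 ?(ltW c0) //.
    by rewrite ler_pM // ltW.
  rewrite [X in _ * X]mulrA mulrA -[leLHS]mul1r ler_wpM2r ?rnormc_ge0 //.
  rewrite -mulrA ler_pdivlMl // mulr1 mulrAC ler_pdivlMr //.
  have := ler_wpM2l (expR_ge0 2) H.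
  rewrite (expRN 2); have e2 : expR 2 != 0 :> R by rewrite gt_eqF // expR_gt0.
  rewrite (_ : expR 2 * (c1 * (c * (expR 2)^-1)) = c * c1) //.
  by field.
have H2 : ell2 N d1 <= Cd * obs b lam N d1 (2 * th) (2 * th + T).
  have := @dyadic c N (fun n => expi (2 * th * lam n) * d1 n) L1c.
  rewrite obs_shift add0r [T + _]addrC (@ell2_eq _ _ _ d1) => [|n _]; last first.
    by rewrite rnormM rnormc_expi mul1r.
  by apply => n nN nn; rewrite /d1 /near (negbTE nn) mulr0.
have H3 t : rnorm (wave b lam N d1 t) <=
    rnorm (wave b lam N (fun n => kap (lam n) * damp1 y d n) t) + C0 * c3 * ell.
  have -> : wave b lam N d1 t = wave b lam N (fun n => kap (lam n) * damp1 y d n) t -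
      wave b lam N d2 t.
    rewrite /wave -lcombB; apply: eq_lcomb => n _; rewrite /d1 /d2.
    by case: ifP; rewrite ?mulr0 ?subr0 // subrr.
  rewrite (le_trans (rnormD _ _)) // rnormN lerD2l.
  apply: (rnorm_wave_ell2 lam0 C00 admissible) => // n nN.
  rewrite /d2; case: ifPn => [_|nn].
    by rewrite rnormc0 mulr0 mulr_ge0 ?rnormc_ge0.
  pose mu := Num.max (lam n) c.
  have mul : lam n <= mu by rewrite le_max lexx.
  have muc : c <= mu by rewrite le_max lexx orbT.
  have mu1 : 1 <= mu by exact: le_trans muc.
  have mu0 : 0 < mu by exact: lt_le_trans ltr01 mu1.
  have kt : rnorm (kap (lam n)) * mu ^+ (2 * e.+2) <= C1 * c.
    by rewrite /mu; apply: (tail (lam n)); [exact: ltW|exact: lmaxP|rewrite leNgt].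
  rewrite rnormM rnorm_damp1 !mulrA ler_wpM2r ?rnormc_ge0 //.
  have kk := rnormc_ge0 (kap (lam n)).
  have l1 : (1 + lam n) ^+ e * lam n <= 2 ^+ e.+1 * mu ^+ e.+1.
    rewrite -exprMn exprSr ler_pM ?exprn_ge0 ?addr_ge0 ?(ltW (lam0 n)) //; last by lra.
    by rewrite lerXn2r ?nnegrE ?addr_ge0 ?mulr_ge0 ?(ltW (lam0 n)) ?(ltW mu0) //; lra.
  have kmu : rnorm (kap (lam n)) * mu ^+ e.+1 <= C1.
    rewrite -(ler_pM2r mu0) (le_trans _ (ler_wpM2l C10 muc)) // (le_trans _ kt) //.
    rewrite -mulrA -exprSr ler_wpM2l // ler_weXn2l //.
    by rewrite mul2n -addnn leq_addr.
  apply: (@le_trans _ _ (rnorm (kap (lam n)) * ((1 + lam n) ^+ e * lam n))).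
    rewrite (mulrC (rnorm _)) -!mulrA ler_wpM2l ?exprn_ge0 ?addr_ge0 ?(ltW (lam0 n)) //.
    rewrite [leRHS]mulrC ler_wpM2l // ler_piMr ?(ltW (lam0 n)) //.
    by rewrite -[leRHS]expR0 ler_expR oppr_le0 mulr_ge0 // ltW.
  rewrite /c3 (le_trans (ler_wpM2l kk l1)) // mulrCA ler_wpM2l ?exprn_ge0 //.
have H4 : obs b lam N d1 (2 * th) (2 * th + T) <=
    obs b lam N (damp1 y d) th (S - th) + T * C0 * c3 * ell.
  apply: (@le_trans _ _ (integ (2 * th) (2 * th + T) (fun t =>
    rnorm (wave b lam N (fun n => kap (lam n) * damp1 y d n) t) + C0 * c3 * ell))).
    apply: le_integ => [||t _]; [exact: continuous_wave| |exact: H3].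
    by apply: continuousDc; [exact: continuous_wave|exact: continuous_cstc].
  rewrite integD; [|exact: continuous_wave|exact: continuous_cstc].
  rewrite integ_cst ?lerDl ?(ltW T0) // lerD //.
    apply: (le_trans (multiplier_obs _ _ _ _ _ _ mkap)).
    by rewrite mul1r mh sub_obs // /S /horizon; have := th0; lra.
  by rewrite addrAC subrr add0r mulrC !mulrA.
have H5 := obs_damp1 N d eta0 y01.
have MM0 : 0 <= MM.
  by apply: integ_ge0 => x xS; rewrite mulr_ge0 ?weight_ge0 ?rnorm_ge0.
have NN0 : 0 <= NN.
  by apply: integ_ge0 => x xS; rewrite mulr_ge0 ?weight_ge0 // reg_ge0.
have H6 : obs b lam N d1 (2 * th) (2 * th + T) <=
    (P + P * (Q1 / k0) + T * C0 * c3) * (MM + NN + ell).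
  apply: (le_trans H4); apply: (le_trans (lerD H5 (lexx _))).
  rewrite mulrDr mulrA.
  move: PQ C0c P00; move: (P * (Q1 / k0)) (T * C0 * c3) P => a1 a2 a3 a10 a20 a30.
  have := mulr_ge0 a10 MM0; have := mulr_ge0 a10 ell0; have := mulr_ge0 a20 MM0.
  have := mulr_ge0 a20 NN0; have := mulr_ge0 a30 NN0; have := mulr_ge0 a30 ell0.
  by rewrite -/MM -/NN; lra.
apply: (le_trans H1).
rewrite (_ : A * (MM + NN + ell) = expR 2 / c1 *
    (Cd * ((P + P * (Q1 / k0) + T * C0 * c3) * (MM + NN + ell)))); last first.
  by rewrite /A !mulrA.
rewrite ler_pM2l ?divr_gt0 ?expR_gt0 // (le_trans H2) // ler_pM2l //.
Qed.

Let r : R := 1 + ep.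
Let r1 : 1 < r. Proof. by rewrite /r ltrDl. Qed.
Let r0 : 0 < r. Proof. exact: lt_trans ltr01 r1. Qed.
Let r2 : r <= 2. Proof. by rewrite /r; have := ep4; lra. Qed.

Let band_coef d (j : nat) n : R[i] := if r ^+ j <= lam n < r * r ^+ j then d n else 0.

Lemma ell2_bands N d j0 J : (forall n, (n < N)%N -> d n != 0 ->
    r ^+ j0 <= lam n < r ^+ (j0 + J)) ->
  ell2 N d ^+ 2 <= \sum_(i < J) ell2 N (band_coef d (j0 + i)) ^+ 2.
Proof.
move=> H; rewrite ell2_sqr; under [leRHS]eq_bigr do rewrite ell2_sqr.
rewrite exchange_big /=; apply: ler_sum => n _.
have [dn|dn] := eqVneq (d n) 0.
  by rewrite dn rnormc0 expr0n /=; apply: sumr_ge0 => i _; exact: sqr_ge0.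
have /andP[l1 l2] := H n (ltn_ord n) dn.
have [i iJ iP] := geometric_bracket l1 l2.
rewrite (bigD1 (Ordinal iJ)) //= /band_coef iP lerDl.
by apply: sumr_ge0 => k _; exact: sqr_ge0.
Qed.

(** At consecutive heights tj > tj1 close to 1 / rj, the bound M^2 <= Dw Nn turns
    [window_bound] into an estimate of the square of the norm [bj] of a band, by
    terms that telescope or sum up with the lengths tj - tj1. *)
Lemma window_algebra (A L rj bj M Nn Dw B tj tj1 E1 E0 s ell : R) :
  0 < A -> 0 <= tj1 -> rj * tj = 1 -> tj = r * tj1 -> tj <= L^-1 -> 0 <= bj ->
  0 <= M -> 0 <= Nn -> 0 <= Dw -> 0 <= ell -> 0 < L^-1 ->
  rj * bj <= A * (M + Nn + ell) -> M ^+ 2 <= Dw * Nn -> Nn <= B ->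
  (tj - tj1) * (tj1 * Dw) <= E1 - E0 + (tj - tj1) * s ->
  bj ^+ 2 <= 3 * A ^+ 2 * (4 / ep * B * (E1 - E0) +
    (tj - tj1) * (4 / ep * B * s + 2 / ep * L^-1 * (B ^+ 2 + ell ^+ 2))).
Proof.
move=> A0 t1 rt tr tL b0 M0 N0 D0 l0 Li H1 MD NB H2.
have B0 : 0 <= B by exact: le_trans NB.
have tj0 : 0 <= tj by rewrite tr mulr_ge0 // ltW.
have b1 : bj <= tj * (A * (M + Nn + ell)).
  have -> : bj = tj * (rj * bj) by rewrite mulrA [tj * _]mulrC rt mul1r.
  exact: ler_wpM2l.
have b2 : bj ^+ 2 <= 3 * A ^+ 2 * (tj ^+ 2 * (Dw * B + B ^+ 2 + ell ^+ 2)).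
  apply: (@le_trans _ _ ((tj * (A * (M + Nn + ell))) ^+ 2)).
    by rewrite lerXn2r // nnegrE // (le_trans b0).
  rewrite (_ : (tj * _) ^+ 2 = A ^+ 2 * tj ^+ 2 * (M + Nn + ell) ^+ 2); last by ring.
  rewrite (_ : 3 * _ * _ = A ^+ 2 * tj ^+ 2 * (3 * (Dw * B + B ^+ 2 + ell ^+ 2))); last by ring.
  rewrite ler_wpM2l ?mulr_ge0 ?sqr_ge0 ?(ltW A0) //.
  have : Dw * Nn <= Dw * B by rewrite ler_wpM2l.
  have : Nn ^+ 2 <= B ^+ 2 by rewrite lerXn2r ?nnegrE.
  have := sqr_ge0 (M - Nn); have := sqr_ge0 (M - ell); have := sqr_ge0 (Nn - ell).
  lra.
apply: (le_trans b2); rewrite ler_wpM2l ?mulr_ge0 ?sqr_ge0 ?(ltW A0) //.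
have dt : tj - tj1 = ep * tj1 by rewrite tr /r; ring.
have ee : 0 <= ep^-1 by rewrite invr_ge0 ltW.
have epn : ep != 0 by rewrite gt_eqF.
have Ln : L != 0 by rewrite -invr_eq0 gt_eqF.
have h1 : tj ^+ 2 * Dw <= 4 / ep * (E1 - E0 + (tj - tj1) * s).
  apply: (@le_trans _ _ (4 / ep * ((tj - tj1) * (tj1 * Dw)))).
    rewrite dt (_ : 4 / ep * _ = 4 * (tj1 ^+ 2 * Dw)); last by field.
    rewrite tr exprMn -mulrA ler_wpM2r ?mulr_ge0 ?sqr_ge0 //.
    by have := r0; have := r2; nra.
  by rewrite ler_wpM2l // mulr_ge0.
have h2 : tj ^+ 2 <= 2 / ep * L^-1 * (tj - tj1).
  rewrite dt (_ : 2 / ep * L^-1 * (ep * tj1) = L^-1 * (2 * tj1)); last first.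
    by move: (L^-1) => l; field.
  rewrite expr2 ler_pM // tr ler_wpM2r //.
have := ler_wpM2r B0 h1.
have := ler_wpM2r (addr_ge0 (sqr_ge0 B) (sqr_ge0 ell)) h2.
lra.
Qed.

Lemma high_frequency : exists C' j0, 0 < C' /\ forall N d,
  (forall n, (n < N)%N -> d n != 0 -> r ^+ j0 <= lam n) ->
  ell2 N d <= C' * obs b lam N d 0 S.
Proof.
have [A [L0 [A0 win]]] := window_bound.
have cs0 : 0 <= cs.
  have S1 : 0 <= S + 1 by rewrite addr_ge0 ?(ltW S0).
  by do 2 (apply: mulr_ge0 => //); try apply: mulr_ge0; exact: exprn_ge0.
have ct0 : 0 <= ct.
  have QQ : 0 <= Q0 + Q1 by exact: addr_ge0.
  by do 2 (apply: mulr_ge0 => //); exact: exprn_ge0.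
pose ks := S * (2 + 2 * cs); pose ka := S ^+ 3 * ct.
have ks0 : 0 <= ks by rewrite /ks mulr_ge0 ?(ltW S0) // addr_ge0 // mulr_ge0.
have ka0 : 0 <= ka by rewrite /ka mulr_ge0 // exprn_ge0 // ltW.
have SQ : 0 <= S ^+ 2 * Q0 by rewrite mulr_ge0 ?sqr_ge0.
have S3 : 0 <= S ^+ 3 by rewrite exprn_ge0 ?(ltW S0).
pose kB := S ^+ 2 * Q0 + S ^+ 3 + ka + ks.
have kB0 : 0 <= kB by rewrite /kB !addr_ge0.
pose kk := 3 * A ^+ 2 * (14 / ep).
have A2 : 0 <= 3 * A ^+ 2 by apply: mulr_ge0 => //; exact: sqr_ge0.
have kk0 : 0 <= kk by rewrite /kk mulr_ge0 // divr_ge0 // ltW.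
pose k2 := kk * (2 * kB ^+ 2 + 1).
have k20 : 0 <= k2.
  by rewrite /k2 mulr_ge0 // addr_ge0 //; apply: mulr_ge0 => //; exact: sqr_ge0.
have [j0 j0P] := exists_geometric (`|L0| + 1 + 2 * k2) r1.
pose L := r ^+ j0.
have [LL0 L1' Lk] : [/\ L0 <= L, 1 <= L & 2 * k2 <= L].
  have := ler_norm L0; have := normr_ge0 L0; rewrite /L => h1 h2.
  by split; lra.
have Lp : 0 < L by exact: lt_le_trans ltr01 L1'.
exists (2 * k2 + 1), j0; split; first by rewrite ltr_wpDl // mulr_ge0.
move=> N d dL; set O := obs _ _ _ _ _ _; set ell := ell2 N d.
have O0 : 0 <= O by exact: obs_ge0.
have := ell2_ge0 N d; rewrite -/ell le_eqVlt => /predU1P[<-|ell0].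
  by rewrite mulr_ge0 // addr_ge0 // mulr_ge0.
(* The regularization adds terms of the size of v to the bounds; at this scale
   they are absorbed together with the boundary terms. *)
pose v := ell / L.
have v0 : 0 < v by rewrite divr_gt0.
pose s := ks * v; pose a := ka * v.
have s0 : 0 <= s by rewrite /s mulr_ge0 // ltW.
have a0 : 0 <= a by rewrite /a mulr_ge0 // ltW.
have W2 x : 0 <= x <= S -> weight S x <= S ^+ 2 by exact: weight_le.
have sides y : 0 <= y <= 1 -> S * (rg N d v 0 y + rg N d v S y) <= s.
  move=> y01; rewrite /s /ks -mulrA ler_pM2l //.
  have h0 := reg_le b lam N d q v0 0 y; have hS := reg_le b lam N d q v0 S y.
  have g0 := hext_side L1' y01 (or_introl (erefl 0)) dL.
  have gS := hext_side L1' y01 (or_intror (erefl S)) dL.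
  by rewrite /rg; move: h0 hS g0 gS; rewrite -/ell -/v; lra.
have top : wint S (reg_y dotK b lam N d q v) 1 <= a.
  have -> : a = integ 0 S (fun=> S ^+ 2 * (ct * v)).
    by rewrite integ_cst ?(ltW S0) // /a /ka subr0 (exprS S 2); ring.
  apply: le_integ.
  - apply: continuous_weightM; exact: (continuous_reg_y hK).
  - exact: continuous_cstc.
  move=> x xS; have H := hext_top L1' xS dL.
  have h1 := abs_reg_y hK b lam N d q v0 x 1.
  have h2 : reg_y dotK b lam N d q v x 1 <= ct * v.
    by rewrite (le_trans (ler_norm _)) // (le_trans h1).
  apply: (@le_trans _ _ (weight S x * (ct * v))); first by rewrite ler_wpM2l // weight_ge0.
  by rewrite ler_wpM2r ?W2 // mulr_ge0 // ltW.
have N0le : wint S (rg N d v) 0 <= S ^+ 3 * v + S ^+ 2 * Q0 * O.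
  have -> : S ^+ 3 * v = integ 0 S (fun=> S ^+ 2 * v).
    by rewrite integ_cst ?(ltW S0) // subr0 (exprS S 2); ring.
  rewrite /O /obs -integZ; last exact: continuous_wave.
  rewrite -integD; [|exact: continuous_cstc|]; last first.
    by apply: continuousMc; [exact: continuous_cstc|exact: continuous_wave].
  apply: le_integ.
  - apply: continuous_weightM; apply: continuous_derive => x; exact: (is_derive_reg_x hK).
  - apply: continuousDc; first exact: continuous_cstc.
    by apply: continuousMc; [exact: continuous_cstc|exact: continuous_wave].
  move=> x xS; have y01 : 0 <= (0 : R) <= 1 by rewrite lexx ler01.
  have h0 := reg_le b lam N d q v0 x 0.
  have h1 : rnorm (hext b lam N d q 0 x 0) <= Q0 * rnorm (wave b lam N d x).
    rewrite hext0E rnormZ; have -> : wave b lam N (damp 0 d) x = wave b lam N d x.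
      by apply: eq_wave => n _; rewrite /damp mul0r oppr0 expR0 mul1r.
    by rewrite ler_wpM2r ?rnorm_ge0 // corner_ub.
  rewrite -mulrA -mulrDr.
  have H : rg N d v x 0 <= v + Q0 * rnorm (wave b lam N d x).
    by rewrite (le_trans h0) // lerD2l.
  rewrite ler_pM ?weight_ge0 ?W2 // reg_ge0 //.
have [Nub [E [Eub Elb Ewin]]] := reg_green hK lam0 S0 v0 s0 a0 sides top.
pose B := kB * (O + v).
have v0' := ltW v0.
have BE : wint S (rg N d v) 0 + a + s <= B.
  rewrite /B /kB /a /s; have := mulr_ge0 SQ v0'; have := mulr_ge0 S3 O0.
  have := mulr_ge0 ka0 O0; have := mulr_ge0 ks0 O0; lra.
have N00 : 0 <= wint S (rg N d v) 0.
  by apply: integ_ge0 => x xS; rewrite mulr_ge0 ?weight_ge0 // reg_ge0.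
have B0 : 0 <= B by rewrite (le_trans _ BE) // !addr_ge0.
pose t j : R := (r ^+ j)^-1.
have rj j : 0 < r ^+ j by rewrite exprn_gt0.
have t0 j : 0 < t j by rewrite invr_gt0.
have tS j : t j = r * t j.+1.
  by rewrite /t exprS invfM mulrA divff ?mul1r // lt0r_neq0.
have tle j : (j0 <= j)%N -> t j <= L^-1.
  by move=> jj; rewrite /t lef_pV2 ?posrE // /L ler_weXn2l // ltW.
have L11 : L^-1 <= 1 by rewrite invf_le1.
have Linv : 0 < L^-1 by rewrite invr_gt0.
pose c0 := 4 / ep * B * s + 2 / ep * L^-1 * (B ^+ 2 + ell ^+ 2).
(* The band j is estimated at a height between t j.+1 and t j, which is where
   its frequencies are damped by a bounded factor. *)
have step j : (j0 <= j)%N -> ell2 N (band_coef d j) ^+ 2 <=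
    3 * A ^+ 2 * (4 / ep * B * (E (t j.+1) - E (t j)) + (t j - t j.+1) * c0).
  move=> jj; have rjL : L <= r ^+ j by rewrite /L ler_weXn2l // ltW.
  have tj1 : t j <= 1 by rewrite (le_trans (tle _ jj)).
  have tt : t j.+1 <= t j by rewrite [leRHS]tS ler_peMl ?(ltW (t0 _)) // ltW.
  have [xi /andP[xi1 xi2] Dxi] := Ewin _ _ (t0 j.+1) tt tj1.
  have xi0 : 0 < xi by exact: lt_le_trans (t0 _) xi1.
  have xi01 : 0 <= xi <= 1 by rewrite ltW // (le_trans xi2).
  have xic : xi * r ^+ j <= 1 by rewrite -ler_pdivlMr // mul1r.
  have := win (r ^+ j) N d v xi (le_trans LL0 rjL) (le_trans L1' rjL) v0 xi01 xic.
  have cs' := wint_cauchy_schwarz hK b lam N d q S v0 xi.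
  have Nb : wint S (rg N d v) xi <= B by exact: le_trans (Nub _ xi01) BE.
  have N0' : 0 <= wint S (rg N d v) xi.
    by apply: integ_ge0 => x xS; rewrite mulr_ge0 ?weight_ge0 // reg_ge0.
  have M0 : 0 <= wint S (fun x y => rnorm (hx N d 1 x y)) xi.
    by apply: integ_ge0 => x xS; rewrite mulr_ge0 ?weight_ge0 // rnorm_ge0.
  have D0 : 0 <= wint S (fun x y => rnorm (hext b lam N d q 1 x y) ^+ 2 / rg N d v x y) xi.
    by apply: integ_ge0 => x xS; rewrite mulr_ge0 ?weight_ge0 // divr_ge0 ?sqr_ge0 ?reg_ge0.
  move=> H.
  have rt : r ^+ j * t j = 1 by rewrite /t divff // lt0r_neq0.
  exact: (window_algebra A0 (ltW (t0 j.+1)) rt (tS j) (tle j jj) (ell2_ge0 _ _) M0 N0' D0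
    (ltW ell0) Linv H cs' Nb Dxi).
have sum J : \sum_(i < J) ell2 N (band_coef d (j0 + i)) ^+ 2 <=
    3 * A ^+ 2 * (4 / ep * B * (E (t (j0 + J)%N) - E (t j0)) + (t j0 - t (j0 + J)%N) * c0).
  elim: J => [|J IH]; first by rewrite big_ord0 addn0 !subrr mulr0 mul0r addr0 mulr0.
  rewrite big_ord_recr /= (le_trans (lerD IH (step _ (leq_addr _ _)))) // addnS.
  by rewrite -mulrDr le_eqVlt; apply/orP; left; apply/eqP; ring.
(* All frequencies are below their sum, so finitely many bands cover them. *)
have [J JP] := exists_geometric (\sum_(n < N) lam n) r1.
have HJ : ell ^+ 2 <= 3 * A ^+ 2 * (4 / ep * B * (E (t (j0 + J)%N) - E (t j0)) +
    (t j0 - t (j0 + J)%N) * c0).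
  apply: le_trans (sum J); apply: ell2_bands => n nN dn; rewrite dL //=.
  apply: (@le_lt_trans _ _ (\sum_(n < N) lam n)).
    rewrite (bigD1 (Ordinal nN)) //= lerDl.
    by apply: sumr_ge0 => i _; exact: ltW.
  by rewrite (lt_le_trans JP) // ler_weXn2l ?leq_addl // ltW.
have tj01 : 0 <= t j0 <= 1 by rewrite (ltW (t0 _)) (le_trans (tle _ (leqnn _))).
have tJ01 : 0 <= t (j0 + J)%N <= 1.
  by rewrite (ltW (t0 _)) (le_trans (tle _ (leq_addr _ _))).
have E1 := Eub _ tJ01; have E2 := Elb _ tj01.
have EB : E (t (j0 + J)%N) - E (t j0) <= 2 * B by lra.
have sB : s <= B by lra.
have ee : 0 <= ep^-1 by rewrite invr_ge0 ltW.
have c00 : 0 <= c0.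
  apply: addr_ge0; first by do 3 (apply: mulr_ge0 => //).
  apply: mulr_ge0; last by rewrite addr_ge0 ?sqr_ge0.
  by apply: mulr_ge0; [apply: mulr_ge0|exact: ltW].
have main : ell ^+ 2 <= kk * (B ^+ 2 + v ^+ 2).
  rewrite (le_trans HJ) // (_ : kk * _ = 3 * A ^+ 2 * (14 / ep * (B ^+ 2 + v ^+ 2))); last by rewrite [RHS]mulrA.
  apply: ler_wpM2l => //.
  apply: (@le_trans _ _ (4 / ep * B * (2 * B) + L^-1 * c0)).
    apply: lerD; first by rewrite ler_wpM2l // mulr_ge0 ?divr_ge0 ?(ltW ep0).
    rewrite ler_wpM2r //; have := tle _ (leqnn j0); have := t0 (j0 + J)%N; lra.
  have LB : L^-1 * (B * s) <= B ^+ 2.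
    have : L^-1 * (B * s) <= 1 * (B * B) by apply: (ler_pM (ltW Linv) (mulr_ge0 B0 s0) L11); exact: ler_wpM2l.
    by rewrite mul1r expr2.
  have L2 : L^-1 ^+ 2 * B ^+ 2 <= B ^+ 2 by rewrite ler_piMl ?sqr_ge0 // expr_le1 // ltW.
  have v2 : v ^+ 2 = L^-1 ^+ 2 * ell ^+ 2 by rewrite /v exprMn mulrC.
  have := ler_wpM2l ee LB; have := ler_wpM2l ee L2.
  have := mulr_ge0 ee (sqr_ge0 v); have := mulr_ge0 ee (sqr_ge0 B).
  rewrite /c0 v2; move: (B) (s) (L^-1) (ep^-1) (ell) => x1 x2 x3 x4 x5.
  by lra.
(* The choice of L makes the boundary terms absorbable. *)
have L2k : k2 * v ^+ 2 <= ell ^+ 2 / 2.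
  rewrite /v exprMn mulrCA ler_wpM2l ?sqr_ge0 // exprVn ler_pdivrMr ?exprn_gt0 //.
  have : L <= L ^+ 2 by rewrite expr2 ler_peMl // ltW.
  by lra.
have fin : ell ^+ 2 <= k2 * (O ^+ 2 + v ^+ 2).
  rewrite (le_trans main) // (_ : k2 * _ = kk * ((2 * kB ^+ 2 + 1) * (O ^+ 2 + v ^+ 2))); last by rewrite [RHS]mulrA.
  rewrite /B exprMn; apply: ler_wpM2l => //.
  have := mulr_ge0 (sqr_ge0 kB) (sqr_ge0 (O - v)); have := sqr_ge0 O; have := sqr_ge0 v.
  lra.
have k21 : 0 <= 2 * k2 + 1 by rewrite addr_ge0 // mulr_ge0.
rewrite -(@ler_pXn2r _ 2) ?nnegrE ?(ltW ell0) ?(mulr_ge0 k21 O0) //.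
have H2 : ell ^+ 2 <= 2 * k2 * O ^+ 2 by lra.
rewrite (le_trans H2) // exprMn ler_wpM2r ?sqr_ge0 //.
by have := sqr_ge0 k2; lra.
Qed.

End High.

(** * From finite sums to the spaces D(A^s) *)

Section FiniteObservability.
Variables (R : realType) (K : completeNormedModType R[i]).
Variable dotK : {dot K for (@Num.conj R[i])}.
Hypothesis hK : hilbert_dot dotK.
Variables (b : nat -> K) (lam : nat -> R).
Hypothesis lam0 : forall n, 0 < lam n.
Hypothesis lam_ndecr : forall m n, (m <= n)%N -> lam m <= lam n.
Hypothesis lam_infty : lam n @[n --> \oo] --> +oo.
Variables (e : nat) (C0 : R).
Hypothesis C00 : 0 <= C0.
Hypothesis admissible : forall N d,
  rnorm (lcomb b N d) <= C0 * ell2 N (fun n => (1 + lam n)%:C ^+ e * d n).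
Hypothesis UC : forall (mu : R) N (d : nat -> R[i]),
  (forall n, (n < N)%N -> lam n != mu -> d n = 0) ->
  lcomb b N d = 0 -> forall n, (n < N)%N -> d n = 0.

(** The sums of high frequency are observable in an intermediate time; n0 is the
    first index of high frequency, so it starts a block of equal eigenvalues and
    Haraux's method applies. *)
Lemma finite_observability (T ep Cd L1 : R) :
  0 < T -> 0 < ep -> ep <= 1 / 4 -> 0 < Cd ->
  (forall c N d, L1 <= c ->
    (forall n, (n < N)%N -> ~~ (`|lam n - c| < 4 * ep * c) -> d n = 0) ->
    ell2 N d <= Cd * obs b lam N d 0 T) ->
  forall T', T < T' -> observable b lam 0 T'.
Proof.
move=> T0 ep0 ep4 Cd0 dyadic T' TT.
have th0 : 0 < (T' - T) / 8 by rewrite divr_gt0 // subr_gt0.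
have hor : horizon T ((T' - T) / 8) = T + (T' - T) / 2 by rewrite /horizon; lra.
have [C' [j0 [C'0 high]]] :=
  high_frequency hK lam0 C00 admissible T0 th0 ep0 ep4 Cd0 dyadic.
rewrite hor in high.
have ex : exists n, (1 + ep) ^+ j0 <= lam n.
  have /cvgryPge /(_ ((1 + ep) ^+ j0)) [n _ H] := lam_infty.
  by exists n; exact: (H n (leqnn n)).
have [n0 n0P n0min] := ex_minnP ex.
apply: (haraux hK lam0 C00 admissible UC lam_ndecr (n0 := n0)
  (T := T + (T' - T) / 2)).
- by lra.
- by lra.
- case: n0 n0P n0min => [|n] nP nmin; first by left.
  by right; apply: lt_le_trans nP; rewrite ltNge; apply/negP => /nmin; rewrite ltnn.
exists C' => // N d dz; apply: high => n nN dn.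
apply: (le_trans n0P); apply: lam_ndecr; rewrite leqNgt; apply/negP => nn0.
by rewrite dz ?eqxx in dn.
Qed.

End FiniteObservability.

Section Sequences.
Variables (R : realType) (lam : nat -> R).
Hypothesis lam0 : forall n, 0 < lam n.
Implicit Types (u v w : nat -> R[i]) (s p : R).

Definition trunc N u : nat -> R[i] := fun n => if (n < N)%N then u n else 0.

Lemma powR_double s n : lam n `^ (2 * s) = (lam n `^ s) ^+ 2.
Proof. by rewrite mulrC powRrM powR_mulrn ?powR_ge0. Qed.

Lemma sqnormDA_trunc s N u : sqnormDA lam s (trunc N u) =
  (ell2 N (fun n => (lam n `^ s)%:C * u n) ^+ 2)%:E.
Proof.
rewrite /sqnormDA (nneseries_split 0 N); last by move=> n _; exact: sqnormDA_term_ge0.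
rewrite add0n eseries0 ?adde0; last first.
  move=> n Nn _; rewrite /trunc ltnNge Nn /= rnormc0 expr0n /= mulr0 //.
rewrite sumEFin ell2_sqr big_mkord; congr (_%:E); apply: eq_bigr => n _.
rewrite /trunc ltn_ord rnormM exprMn rnorm_real ger0_norm ?powR_ge0 //.
by rewrite powR_double.
Qed.

Lemma normDA_trunc s N u :
  normDA lam s (trunc N u) = ell2 N (fun n => (lam n `^ s)%:C * u n).
Proof. by rewrite /normDA sqnormDA_trunc /= sqrtr_sqr ger0_norm ?ell2_ge0. Qed.

Lemma DA_trunc s N u : DA lam s (trunc N u).
Proof. by rewrite /DA /= sqnormDA_trunc ltry. Qed.

Lemma DA_le s p (c : R) u v : 0 <= c ->
  (forall n, lam n `^ (2 * s) * rnorm (v n) ^+ 2 <=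
     c * (lam n `^ (2 * p) * rnorm (u n) ^+ 2)) ->
  DA lam p u -> DA lam s v.
Proof.
move=> c0 uv Du; apply: le_lt_trans (DA_Z c0 Du).
by apply: lee_nneseries => n _; [move=> _; exact: sqnormDA_term_ge0|rewrite lee_fin].
Qed.

Lemma DAZ s a u : DA lam s u -> DA lam s (a *: u).
Proof.
apply: (@DA_le _ _ (rnorm a ^+ 2)) => [|n]; first exact: sqr_ge0.
by rewrite !fctE rnormM exprMn mulrCA.
Qed.

Lemma DAD s u v : DA lam s u -> DA lam s v -> DA lam s (u + v).
Proof.
rewrite /DA /= => Du Dv; apply: (@le_lt_trans _ _
  (sqnormDA lam s (fun n => (2 * u n)%R) + sqnormDA lam s (fun n => (2 * v n)%R))%E).
  rewrite /sqnormDA -nneseriesD; try by move=> n _ _; rewrite lee_fin mulr_ge0 ?powR_ge0 ?sqr_ge0.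
  apply: lee_nneseries => n _; first by move=> _; exact: sqnormDA_term_ge0.
  rewrite -EFinD lee_fin -mulrDr ler_wpM2l ?powR_ge0 //.
  rewrite !rnorm_sqr !fctE; case: (u n) (v n) => a1 a2 [b1 b2] /=.
  by have := sqr_ge0 (a1 - b1); have := sqr_ge0 (a2 - b2); nra.
by rewrite lte_add_pinfty //; exact: (DAZ 2).
Qed.

Lemma DAB s u v : DA lam s u -> DA lam s v -> DA lam s (u - v).
Proof. by move=> Du Dv; rewrite -scaleN1r; apply: DAD => //; exact: DAZ. Qed.

Lemma DA_flow s u t : DA lam s u -> DA lam s (schrodinger_flow lam u t).
Proof.
by apply: (@DA_le _ _ 1) => // n; rewrite rnorm_flow mul1r.
Qed.

Lemma normDA_ge0 s u : 0 <= normDA lam s u. Proof. exact: sqrtr_ge0. Qed.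

(** The hypothesis is essential: [normDA] is 0 when the series diverges. *)
Lemma coef_le_normDA s w n : DA lam s w ->
  lam n `^ s * rnorm (w n) <= normDA lam s w.
Proof.
move=> Dw; have fn : sqnormDA lam s w \is a fin_num.
  by rewrite ge0_fin_numE // sqnormDA_ge0.
rewrite -(@ler_pXn2r _ 2) ?nnegrE ?mulr_ge0 ?powR_ge0 ?rnormc_ge0 ?normDA_ge0 //.
rewrite sqr_sqrtr ?fine_ge0 ?sqnormDA_ge0 // -lee_fin fineK //.
rewrite exprMn -powR_double.
rewrite /sqnormDA (nneseries_split 0 n.+1); last first.
  by move=> k _; exact: sqnormDA_term_ge0.
rewrite add0n big_nat_recr //= -addeA addeCA; apply: leeDl.
apply: adde_ge0.
  by apply: sume_ge0 => k _; exact: sqnormDA_term_ge0.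
by apply: nneseries_ge0 => k _ _; exact: sqnormDA_term_ge0.
Qed.

Lemma flow_trunc N u t : schrodinger_flow lam (trunc N u) t =
  trunc N (schrodinger_flow lam u t).
Proof.
by apply/funext => n; rewrite /schrodinger_flow /trunc; case: ifP; rewrite ?mulr0.
Qed.

Lemma normDA_tail s u (eps : R) N0 : DA lam s u -> 0 < eps ->
  exists2 N, (N0 <= N)%N & normDA lam s (u - trunc N u) <= eps.
Proof.
move=> Du eps0.
have e2 : 0 < eps ^+ 2 by rewrite exprn_gt0.
have := @nneseries_tail_cvg R _ xpredT Du (fun n _ => sqnormDA_term_ge0 lam s u n).
move/(_ [set x | (x < (eps ^+ 2)%:E)%E]) => [].
  by apply: open_nbhs_nbhs; split; [exact: open_ereal_lt_ereal|rewrite /= lte_fin].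
move=> N1 _ tN; exists (maxn N0 N1); first exact: leq_maxl.
have /= H := tN _ (leq_maxr N0 N1); set N := maxn N0 N1 in H *.
have {}H : (sqnormDA lam s (u - trunc N u)%R < (eps ^+ 2)%:E)%E.
  apply: le_lt_trans H; rewrite /sqnormDA (nneseries_split 0 N); last first.
    by move=> n _; exact: sqnormDA_term_ge0.
  rewrite add0n big1_seq ?add0e => [|n]; last first.
    rewrite mem_index_iota => /andP[_ /andP[_ nN]].
    by rewrite !fctE /trunc nN subrr rnormc0 expr0n /= mulr0.
  apply: lee_nneseries => n _; first by move=> _; exact: sqnormDA_term_ge0.
  rewrite lee_fin !fctE /trunc; case: ifP => _; last by rewrite subr0.
  by rewrite subrr rnormc0 expr0n /= mulr0 mulr_ge0 ?powR_ge0 ?sqr_ge0.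
have fn : sqnormDA lam s (u - trunc N u) \is a fin_num.
  by rewrite ge0_fin_numE ?sqnormDA_ge0 // (lt_trans H) // ltry.
rewrite -(@ler_pXn2r _ 2) ?nnegrE ?normDA_ge0 ?(ltW eps0) //.
by rewrite sqr_sqrtr ?fine_ge0 ?sqnormDA_ge0 // -lee_fin fineK // ltW.
Qed.

End Sequences.

(** * Solutions and their observation *)

Section Uniqueness.
Variables (R : realType) (lam : nat -> R).
Hypothesis lam0 : forall n, 0 < lam n.
Hypothesis lam_ndecr : forall m n, (m <= n)%N -> lam m <= lam n.

Lemma cder_quotient (f : R -> R[i]) t c :
  rnorm ((h^-1)%:C * (f (t + h) - f t) - c) @[h --> (0 : R)^'] --> (0 : R) ->
  cder f t c.
Proof.
move=> H.
have key (F : R -> R) (l : R) : (forall h, `|h^-1 * (F (t + h) - F t) - l| <=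
    rnorm ((h^-1)%:C * (f (t + h) - f t) - c)) -> is_derive t (1 : R) F l.
  move=> Fl; have FH : h^-1 * (F (t + h) - F t) @[h --> (0 : R)^'] --> l.
    apply/cvgrPdist_le => eps eps0; move/cvgr0Pnorm_le: H => /(_ _ eps0) H.
    near=> h; rewrite distrC (le_trans (Fl h)) // (le_trans (ler_norm _)) //.
    by near: h.
  have FH' : h^-1 *: ((F \o shift t) (h *: (1 : R)) - F t) @[h --> (0 : R)^'] --> l.
    suff -> : (fun h => h^-1 *: ((F \o shift t) (h *: (1 : R)) - F t)) =
      (fun h => h^-1 * (F (t + h) - F t)) by exact: FH.
    by apply/funext => h /=; rewrite [h *: _]mulr1 [t + h]addrC.
  split; last exact: cvg_lim FH'.
  by apply/cvg_ex; exists l.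
split; apply: key => h.
  apply: le_trans (abs_Re_le_rnorm _); rewrite le_eqVlt; apply/orP; left; apply/eqP.
  by congr `|_|; move: (f (t + h)) (f t) (c) => [? ?] [? ?] [? ?] /=; ring.
apply: le_trans (abs_Im_le_rnorm _); rewrite le_eqVlt; apply/orP; left; apply/eqP.
by congr `|_|; move: (f (t + h)) (f t) (c) => [? ?] [? ?] [? ?] /=; ring.
Unshelve. all: by end_near.
Qed.

Lemma cder_eq0 (f : R -> R[i]) : (forall t, cder f t 0) -> forall x y, f x = f y.
Proof.
move=> f0 x y.
have H1 := @is_derive_0_is_cst _ _ x y (fun t => (f0 t).1).
have H2 := @is_derive_0_is_cst _ _ x y (fun t => (f0 t).2).
by apply/eqP; rewrite eq_complex H1 H2 !eqxx.
Qed.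

(** The eigenvalues are bounded below by the first one. *)
Lemma DA_pred (p : R) (u : nat -> R[i]) : DA lam p u -> DA lam (p - 1) u.
Proof.
apply: (@DA_le _ _ _ _ (lam 0 ^+ 2)^-1) => [|n]; first by rewrite invr_ge0 sqr_ge0.
rewrite mulrA ler_wpM2r ?sqr_ge0 // ler_pdivlMl ?exprn_gt0 //.
have -> : lam n `^ (2 * p) = lam n ^+ 2 * lam n `^ (2 * (p - 1)).
  rewrite -powR_mulrn ?ltW // -powRD; last by apply/implyP => _; rewrite gt_eqF.
  by congr (_ `^ _); ring.
by rewrite ler_wpM2r ?powR_ge0 // lerXn2r ?nnegrE ?(ltW (lam0 _)) // lam_ndecr.
Qed.

(** Convergence in D(A^(p-1)) implies convergence of each coefficient, since all
    terms of the difference quotient do belong to this space. The coefficient of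
    index n solves c' = i lam_n c, so e^(- i lam_n t) c(t) is constant. *)
Lemma schrodinger_unique p u0 u : schrodinger_solution lam p u0 u ->
  u = schrodinger_flow lam u0.
Proof.
move=> [u00 [uD uc] [du [[duD _] duH duE]]].
apply/funext => t; apply/funext => n.
have lp : 0 < lam n `^ (p - 1) by rewrite powR_gt0.
have du_n s : du s n = 'i * ((lam n)%:C * u s n).
  have := congr1 (fun v => v n) (duE s); rewrite !fctE /powA powRr1 ?ltW //.
  by move/eqP; rewrite subr_eq0 => /eqP.
have cu s : cder (fun s => u s n) s ('i * ((lam n)%:C * u s n)).
  apply: cder_quotient; rewrite -du_n.
  apply: (@squeeze_cvgr _ _ _ _ (fun=> 0) (fun h => (lam n `^ (p - 1))^-1 *
    normDA lam (p - 1) ((h^-1)%:C *: (u (s + h) - u s) - du s))).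
  - near=> h; rewrite rnormc_ge0 /= ler_pdivlMl //.
    apply: (@coef_le_normDA _ _ (p - 1)
      ((h^-1)%:C *: (u (s + h) - u s) - du s) n).
    by apply: DAB => //; apply: DAZ => //; apply: DAB => //; apply: DA_pred; exact: uD.
  - exact: cvg_cst.
  - by apply: cvg0M; exact: duH.
pose f s := expi (s * - lam n) * u s n.
have f0 s : cder f s 0.
  apply: cder_ext (cderM (cder_expi (- lam n) s) (cu s)) => //.
  by rewrite rmorphN /=; ring.
have := cder_eq0 f0 t 0; rewrite /f mul0r expi0 mul1r u00 => E0.
rewrite /schrodinger_flow -E0 mulrA -expiD -mulrDr subrr mulr0 expi0 mul1r //.
Unshelve. all: by end_near.
Qed.

End Uniqueness.

Section Observation.
Variables (R : realType) (lam : nat -> R).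
Hypothesis lam0 : forall n, 0 < lam n.
Variables (K : completeNormedModType R[i]) (m0 : R) (L : (nat -> R[i]) -> K).
Hypothesis L_linear : forall (a : R[i]) u v, DA lam m0 u -> DA lam m0 v ->
  L (a *: u + v) = a *: L u + L v.
Implicit Types (u v w : nat -> R[i]).

Let delta n : nat -> R[i] := fun k => (k == n)%:R.

Lemma trunc0 u : trunc 0 u = 0.
Proof. by apply/funext => n. Qed.

Lemma truncS N u : trunc N.+1 u = u N *: delta N + trunc N u.
Proof.
apply/funext => n; rewrite /trunc /delta !fctE ltnS leq_eqVlt.
have [->|nN] /= := eqVneq n N; first by rewrite ltnn mulr1n addr0 [_ *: _]mulr1.
by rewrite mulr0n [_ *: _]mulr0 add0r.
Qed.

Lemma DA_delta n : DA lam m0 (delta n).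
Proof.
have -> : delta n = trunc n.+1 (delta n); last exact: DA_trunc.
by apply/funext => k; rewrite /trunc /delta; case: ltnP => // nk; rewrite gtn_eqF.
Qed.

Lemma observation_trunc N u : L (trunc N u) = lcomb (fun n => L (delta n)) N u.
Proof.
elim: N => [|N IH].
  rewrite trunc0 /lcomb big_ord0; have D0 : DA lam m0 0 by rewrite -(trunc0 u); exact: DA_trunc.
  have := L_linear 1 D0 D0; rewrite scale1r addr0 scale1r => /esym/eqP.
  by rewrite -subr_eq0 addrK => /eqP.
rewrite truncS L_linear ?IH; [|exact: DA_delta|exact: DA_trunc].
by rewrite /lcomb big_ord_recr /= addrC.
Qed.

(** Observed eigenvectors, normalized so that the l2 norm of the coefficients is
    the norm of D(A^p). *)
Definition obs_vector (p : R) n : K := (lam n `^ (- p))%:C *: L (delta n).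

Lemma observation_lcomb p N u :
  L (trunc N u) = lcomb (obs_vector p) N (fun n => (lam n `^ p)%:C * u n).
Proof.
rewrite observation_trunc /lcomb; apply: eq_bigr => n _.
rewrite /obs_vector scalerA mulrAC -rmorphM /= powRN mulfV ?mul1r //.
by rewrite gt_eqF // powR_gt0.
Qed.

Lemma observation_wave p N u t : L (schrodinger_flow lam (trunc N u) t) =
  wave (obs_vector p) lam N (fun n => (lam n `^ p)%:C * u n) t.
Proof.
rewrite flow_trunc (observation_lcomb p) /wave; apply: eq_lcomb => n _.
by rewrite /schrodinger_flow mulrCA.
Qed.

Lemma observed_trunc p N u T : observed L T (schrodinger_flow lam (trunc N u)) =
  (obs (obs_vector p) lam N (fun n => (lam n `^ p)%:C * u n) 0 T)%:E.
Proof.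
rewrite /obs -integE; last exact: continuous_wave.
by apply: eq_integral => t _; rewrite (observation_wave p).
Qed.

Variable C0 : R.
Hypothesis C00 : 0 <= C0.
Hypothesis L_bounded : forall u, DA lam m0 u -> rnorm (L u) <= C0 * normDA lam m0 u.

(** The observation loses m0 - p powers of the frequency on normalized
    coefficients. *)
Lemma obs_vector_admissible p (e : nat) N (d : nat -> R[i]) : p <= m0 -> m0 - p <= e%:R ->
  rnorm (lcomb (obs_vector p) N d) <=
    C0 * ell2 N (fun n => (1 + lam n)%:C ^+ e * d n).
Proof.
move=> pm me; pose u n := (lam n `^ (- p))%:C * d n.
have -> : lcomb (obs_vector p) N d =
    lcomb (obs_vector p) N (fun n => (lam n `^ p)%:C * u n).
  apply: eq_lcomb => n _; rewrite /u mulrA -rmorphM /= powRN mulfV ?mul1r //.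
  by rewrite gt_eqF // powR_gt0.
rewrite -observation_lcomb (le_trans (L_bounded (DA_trunc lam m0 N u))) // normDA_trunc.
rewrite ler_wpM2l // -[leRHS]mul1r; apply: le_ell2 => // n _.
rewrite mul1r /u mulrA -rmorphM /= -powRD; last by apply/implyP => _; rewrite gt_eqF.
rewrite -rmorphXn !rnormM !rnorm_real ler_wpM2r ?rnormc_ge0 //.
have l1 : 0 <= 1 + lam n by rewrite addr_ge0 // ltW.
rewrite !ger0_norm ?powR_ge0 ?exprn_ge0 //.
apply: (@le_trans _ _ ((1 + lam n) `^ (m0 - p))).
  by apply: ge0_ler_powR; rewrite ?nnegrE ?subr_ge0 ?(ltW (lam0 n)) // lerDr.
by rewrite -powR_mulrn //; apply: ler_powR => //; rewrite lerDl ltW.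
Qed.

Lemma observation_dist u v : DA lam m0 u -> DA lam m0 v ->
  rnorm (L u - L v) <= C0 * normDA lam m0 (u - v).
Proof.
move=> Du Dv; have -> : L u - L v = L (u - v).
  by rewrite addrC -scaleN1r -L_linear // scaleN1r addrC.
by apply: L_bounded; exact: DAB.
Qed.

Lemma continuous_observation (u : R -> nat -> R[i]) : continuous_in lam m0 u ->
  continuous (fun t => rnorm (L (u t))).
Proof.
move=> [uD uc] t.
have H : C0 * normDA lam m0 (u t' - u t) @[t' --> t] --> (0 : R).
  by apply: cvg0M; exact: uc.
apply/cvgrPdist_le => eps eps0; move/cvgr0Pnorm_le: H => /(_ _ eps0) H.
near=> t'; rewrite distrC (le_trans (rnorm_dist _ _)) //.
rewrite (le_trans (observation_dist (uD _) (uD _))) // (le_trans (ler_norm _)) //.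
by near: t'.
Unshelve. all: by end_near.
Qed.

(** Density of the truncated solutions: the observation of the difference is
    bounded, uniformly in time, by the tail of the series of D(A^m0). *)
Lemma observable_flow p T C u0 : 0 <= T -> 0 <= C -> DA lam m0 u0 ->
  (forall N d, ell2 N d <= C * obs (obs_vector p) lam N d 0 T) ->
  ((normDA lam p u0)%:E <= C%:E * observed L T (schrodinger_flow lam u0))%E.
Proof.
move=> T0 C0' Du H.
have [_ cu _] := schrodinger_flow_solution lam0 Du.
have cg := continuous_observation cu.
rewrite /observed integE // -EFinM lee_fin; set G := integ _ _ _.
have G0 : 0 <= G by apply: integ_ge0 => t _; exact: rnorm_ge0.
have part N : ell2 N (fun n => (lam n `^ p)%:C * u0 n) <= C * G.
  apply/ler_addgt0Pr => eps eps0; pose k := C * (C0 * T) + 1.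
  have k0 : 0 < k by rewrite ltr_wpDl // !mulr_ge0.
  (* The tail is chosen so that C * (C0 * T) * tail <= eps. *)
  have [M NM tail] := normDA_tail N Du (divr_gt0 eps0 k0).
  apply: (@le_trans _ _ (ell2 M (fun n => (lam n `^ p)%:C * u0 n))).
    rewrite -(@ler_pXn2r _ 2) ?nnegrE ?ell2_ge0 // !ell2_sqr.
    rewrite -!(big_mkord xpredT (fun n => rnorm ((lam n `^ p)%:C * u0 n) ^+ 2)).
    rewrite (big_cat_nat (leq0n N) NM) //= lerDl.
    by apply: sumr_ge0 => n _; exact: sqr_ge0.
  rewrite (le_trans (H _ _)) //.
  apply: (@le_trans _ _ (C * (G + C0 * (eps / k) * T))); last first.
    rewrite mulrDr lerD2l (_ : C * (C0 * _ * T) = C * (C0 * T) * (eps / k)); last by ring.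
    rewrite mulrA ler_pdivrMr // mulrC ler_wpM2l ?(ltW eps0) // lerDl //.
  rewrite ler_wpM2l // (_ : _ * T = C0 * (eps / k) * (T - 0)); last by rewrite subr0.
  rewrite -integ_cst // -integD //; last by move=> x; exact: cvg_cst.
  apply: le_integ; first exact: continuous_wave.
    by move=> x; apply: cvgD; [exact: cg|exact: cvg_cst].
  move=> t _; rewrite -(observation_wave p).
  set w := schrodinger_flow _ _ _; set w' := schrodinger_flow _ _ _.
  have Dw : DA lam m0 w by apply: DA_flow => //; exact: DA_trunc.
  have Dw' : DA lam m0 w' by exact: DA_flow.
  rewrite -lerBlDl (le_trans (ler_norm _)) // (le_trans (rnorm_dist _ _)) //.
  rewrite rnormB_sym (le_trans (observation_dist Dw' Dw)) // ler_wpM2l //.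
  apply: le_trans tail; rewrite le_eqVlt; apply/orP; left; apply/eqP.
  congr Num.sqrt; congr fine; apply: eq_eseriesr => n _; congr (_ * _)%:E.
  by rewrite /w /w' flow_trunc !fctE /trunc /schrodinger_flow; case: ifP => _;
    rewrite ?subrr // !subr0 rnormM rnormc_expi mul1r.
have CG : 0 <= C * G by rewrite mulr_ge0.
rewrite -(@ler_pXn2r _ 2) ?nnegrE ?normDA_ge0 // sqr_sqrtr ?fine_ge0 ?sqnormDA_ge0 //.
(* The bound on partial sums also shows that the series of D(A^p) converges. *)
suff S : (sqnormDA lam p u0 <= ((C * G) ^+ 2)%:E)%E.
  rewrite -lee_fin fineK // ge0_fin_numE ?sqnormDA_ge0 //.
  by rewrite (le_lt_trans S) // ltry.
apply: lime_le.
  by apply: is_cvg_nneseries => n _ _; exact: sqnormDA_term_ge0.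
near=> N; rewrite sumEFin lee_fin.
apply: (@le_trans _ _ (ell2 N (fun n => (lam n `^ p)%:C * u0 n) ^+ 2)); last first.
  by rewrite ler_pXn2r ?nnegrE ?ell2_ge0.
rewrite ell2_sqr big_mkord; apply: ler_sum => n _.
by rewrite rnormM exprMn rnorm_real ger0_norm ?powR_ge0 // powR_double.
Unshelve. all: by end_near.
Qed.

End Observation.

(** * Eigenvectors, dyadic blocks and the observability inequality *)

Section Orthonormal.
Variables (R : realType) (E : completeNormedModType R[i]).
Variable dotp : {dot E for (@Num.conj R[i])}.
Hypothesis hE : hilbert_dot dotp.
Variable e : nat -> E.
Hypothesis orthonormal : forall m n, dotp (e m) (e n) = (m == n)%:R.

Lemma coef_lcomb N (c : nat -> R[i]) : coef dotp e (lcomb e N c) = trunc N c.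
Proof.
apply/funext => n; rewrite /coef /lcomb dot_suml /trunc.
under eq_bigr do rewrite dotZl orthonormal.
have [nN|Nn] := ltnP n N; last first.
  rewrite big1 // => k _; rewrite ltn_eqF ?mulr0 //.
  exact: leq_trans (ltn_ord k) Nn.
rewrite (bigD1 (Ordinal nN)) //= eqxx mulr1 big1 ?addr0 // => k kn.
suff -> : (k == n :> nat) = false by rewrite mulr0.
by apply: contraNF kn => /eqP kn; apply/eqP/val_inj.
Qed.

Lemma rnorm_lcomb N (c : nat -> R[i]) : rnorm (lcomb e N c) = ell2 N c.
Proof.
suff H : rnorm (lcomb e N c) ^+ 2 = ell2 N c ^+ 2.
  have := congr1 (@Num.sqrt R) H.
  by rewrite !sqrtr_sqr !ger0_norm ?ell2_ge0 ?rnorm_ge0.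
apply: (@complexI R); rewrite -(dotE hE) {1}/lcomb dot_suml ell2_sqr rmorph_sum /=.
apply: eq_bigr => n _; rewrite dotZl dotC.
have := congr1 (fun u => u (val n)) (coef_lcomb N c).
by rewrite /coef /trunc ltn_ord => ->; rewrite mulc_conj.
Qed.

End Orthonormal.

Section Eigenvectors.
Variables (R : realType) (E : completeNormedModType R[i]).
Variables (domA : set E) (A : E -> E).
Hypothesis A_linear : linear_on domA A.
Variables (e : nat -> E) (lam : nat -> R).
Hypothesis e_eigen : forall n, domA (e n) /\ A (e n) = (lam n)%:C *: e n.

Lemma lcomb_domain N (c : nat -> R[i]) : domA (lcomb e N c) /\
  A (lcomb e N c) = lcomb e N (fun n => (lam n)%:C * c n).
Proof.
have [D0 lin] := A_linear.
elim: N => [|N [IH1 IH2]].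
  rewrite /lcomb !big_ord0; split => //.
  have [_] := lin 1 0 0 D0 D0; rewrite scale1r addr0 scale1r => /esym/eqP.
  by rewrite -subr_eq0 addrK => /eqP.
have [De Ae] := e_eigen N; have [H1 H2] := lin (c N) _ _ De IH1.
have -> : lcomb e N.+1 c = c N *: e N + lcomb e N c.
  by rewrite /lcomb big_ord_recr /= addrC.
split => //; rewrite H2 IH2 Ae scalerA [RHS]big_ord_recr /= addrC.
by rewrite [_ * c N]mulrC.
Qed.

End Eigenvectors.

Section Main.
Variables (R : realType) (E : completeNormedModType R[i]).
Variable dotp : {dot E for (@Num.conj R[i])}.
Hypothesis hE : hilbert_dot dotp.
Variables (e : nat -> E) (lam : nat -> R).
Hypothesis orthonormal : forall m n, dotp (e m) (e n) = (m == n)%:R.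
Hypothesis lam0 : forall n, 0 < lam n.
Variables (K : completeNormedModType R[i]) (m0 : R) (L : (nat -> R[i]) -> K).
Hypothesis L_linear : forall (a : R[i]) u v, DA lam m0 u -> DA lam m0 v ->
  L (a *: u + v) = a *: L u + L v.

Let obs_vectorK p n (z : R[i]) : (lam n `^ p)%:C * ((lam n `^ (- p))%:C * z) = z.
Proof.
by rewrite mulrA -rmorphM /= powRN mulfV ?mul1r // gt_eqF // powR_gt0.
Qed.

(** A nontrivial relation between the vectors of one eigenvalue would yield an
    eigenvector that the observation annihilates. *)
Lemma eigenvector_separation (domA : set E) (A : E -> E) (p mu : R) N (d : nat -> R[i]) :
  linear_on domA A ->
  (forall n, domA (e n) /\ A (e n) = (lam n)%:C *: e n) ->
  (forall v : E, eigenvector domA A v -> L (coef dotp e v) <> 0) ->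
  (forall n, (n < N)%N -> lam n != mu -> d n = 0) ->
  lcomb (obs_vector lam L p) N d = 0 -> forall n, (n < N)%N -> d n = 0.
Proof.
move=> A_linear e_eigen uc dmu d0 n nN.
pose c k := (lam k `^ (- p))%:C * d k; pose v := lcomb e N c.
have [Dv Av] := lcomb_domain A_linear e_eigen N c.
have v0 : v = 0.
  apply/eqP/negPn/negP => v0; apply: (uc v); last first.
    rewrite coef_lcomb // (observation_lcomb lam0 L_linear p) -[RHS]d0.
    by apply: eq_lcomb => k _; rewrite /c obs_vectorK.
  split => //; exists mu%:C; rewrite Av -lcombZ; apply: eq_lcomb => k kN.
  have [->//|lk] := eqVneq (lam k) mu.
  by rewrite /c (dmu k kN lk) !mulr0.
have := congr1 (fun u => u n) (coef_lcomb orthonormal N c).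
rewrite -/v v0 /coef /trunc nN => cn.
have : c n = 0 by rewrite -cn; exact: linear0l.
by move/(congr1 (fun z => (lam n `^ p)%:C * z)); rewrite /c obs_vectorK mulr0.
Qed.

Variables (alpha rho : R).
Hypothesis alpha_gt0 : 0 < alpha.
Hypothesis alpha_lt1 : alpha < 1.
Hypothesis rho_gt1 : 1 < rho.
Hypothesis rho_lt : rho < alpha^-1.

(** Consecutive blocks overlap since rho alpha < 1: every number lies well inside
    one of them, with a relative margin 4 ep. *)
Lemma band_in_block : exists ep : R, [/\ 0 < ep, ep <= 1 / 4 & forall k c l : R,
  0 < k -> k <= c < rho * k -> `|l - c| < 4 * ep * c ->
  alpha * k <= l < k / alpha].
Proof.
have ra : 0 < rho * alpha by rewrite mulr_gt0 // (lt_trans ltr01).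
have ra1 : rho * alpha < 1 by rewrite -ltr_pdivlMr // div1r.
pose x := Num.min (1 - alpha) ((rho * alpha)^-1 - 1).
have x0 : 0 < x by rewrite lt_min !subr_gt0 alpha_lt1 invf_gt1.
have [x1 x2] : x <= 1 - alpha /\ x <= (rho * alpha)^-1 - 1.
  by rewrite /x !ge_min !lexx orbT.
exists (x / 4); split; [by rewrite divr_gt0|by have := alpha_gt0; lra|].
move=> k c l k0 /andP[kc ck]; have -> : 4 * (x / 4) = x by field.
rewrite ltr_norml => /andP[h1 h2].
have c0 : 0 < c by exact: lt_le_trans kc.
apply/andP; split.
  have : alpha * k <= (1 - x) * c by rewrite ler_pM ?(ltW k0) ?(ltW alpha_gt0) //; lra.
  by lra.
rewrite ltr_pdivlMr //.
apply: (@lt_le_trans _ _ ((1 + x) * c * alpha)).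
  by rewrite ltr_pM2r //; lra.
have H : (1 + x) * (rho * alpha) <= 1 by rewrite -ler_pdivlMr // div1r; lra.
apply: (@le_trans _ _ ((1 + x) * (rho * k) * alpha)).
  by rewrite ler_pM2r // ler_pM2l ?(ltW ck) //; lra.
rewrite (_ : _ * alpha = (1 + x) * (rho * alpha) * k); last by ring.
by rewrite ler_piMl // ltW.
Qed.

(** The coefficients of a band are those of an element of one block, scaled into
    the unit ball; both sides are homogeneous. *)
Lemma dyadic_band (p C T : R) (k0 : nat) (ep : R) :
  (forall U : nat -> E, BS lam e alpha rho U ->
     forall k : nat, (k0 <= k)%N ->
       ((normDA lam p (coef dotp e (U k)))%:E <=
          C%:E * observed L T (schrodinger_flow lam (coef dotp e (U k))))%E) ->
  (forall k c l : R, 0 < k -> k <= c < rho * k -> `|l - c| < 4 * ep * c ->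
     alpha * k <= l < k / alpha) ->
  forall c N (d : nat -> R[i]), rho ^+ k0 <= c ->
    (forall n, (n < N)%N -> ~~ (`|lam n - c| < 4 * ep * c) -> d n = 0) ->
    ell2 N d <= C * obs (obs_vector lam L p) lam N d 0 T.
Proof.
move=> dyadic block c N d ck dc.
have [J cJ] := exists_geometric c rho_gt1.
have [i _ ic] : exists2 i, (i < J)%N & rho ^+ (k0 + i) <= c < rho * rho ^+ (k0 + i).
  apply: geometric_bracket => //; apply: (lt_le_trans cJ).
  by rewrite ler_weXn2l ?leq_addl // ltW.
set k := (k0 + i)%N in ic.
pose u n := (lam n `^ (- p))%:C * d n.
(* The factor (1 + M)^-1 brings the norm below 1 and makes sense for M = 0. *)
pose M := ell2 N u; pose s := (1 + M)^-1.
have M1 : 0 < 1 + M by rewrite ltr_pwDl // ell2_ge0.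
have s0 : 0 < s by rewrite invr_gt0.
pose U j := if j == k then lcomb e N (fun n => s%:C * u n) else 0.
have Uk : U k = lcomb e N (fun n => s%:C * u n) by rewrite /U eqxx.
have BU : BS lam e alpha rho U.
  move=> j _; rewrite /U; have [->|_] := eqVneq j k; last first.
    by split; [exists 0%N, (fun=> 0); rewrite big_ord0|rewrite rnorm0 ler01].
  split.
    exists N, (fun n => s%:C * u n); rewrite /lcomb [RHS]big_mkcond /=.
    apply: eq_bigr => n _; case: ifPn => // nJ.
    rewrite /u dc ?mulr0 ?scale0r //; apply: contra nJ => /block.
    by apply => //; rewrite exprn_gt0 // (lt_trans ltr01).
  rewrite (rnorm_lcomb hE) // ell2Z ?(ltW s0) // -/M /s mulrC ler_pdivrMr // mul1r.
  by rewrite lerDr.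
have := dyadic U BU k (leq_addr _ _); rewrite Uk coef_lcomb // normDA_trunc.
rewrite (observed_trunc lam0 L_linear p) -EFinM lee_fin.
have E1 n : (lam n `^ p)%:C * (s%:C * u n) = s%:C * d n.
  by rewrite mulrCA /u obs_vectorK.
under [X in ell2 _ X]eq_fun do rewrite E1.
under [X in obs _ _ _ X]eq_fun do rewrite E1.
by rewrite ell2Z ?(ltW s0) // obsZ ?(ltW s0) // mulrCA ler_pM2l.
Qed.

End Main.

Theorem theorem3p7 (R : realType)
    (E : completeNormedModType R[i])
    (dotE : {dot E for (@Num.conj R[i])})
    (hE : hilbert_dot dotE)
    (domA : set E) (A : E -> E)
    (A_linear : linear_on domA A) (A_dense : closure domA = setT)
    (A_selfadjoint : selfadjoint dotE domA A)
    (A_positive : positive_operator dotE domA A)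
    (e : nat -> E) (lam : nat -> R)
    (e_basis : hilbert_basis dotE e)
    (e_eigen : forall n, domA (e n) /\ A (e n) = (lam n)%:C *: e n)
    (lam_ndecr : forall m n, (m <= n)%N -> lam m <= lam n)
    (lam_gt0 : forall n, 0 < lam n)
    (lam_infty : lam n @[n --> \oo] --> +oo)
    (alpha rho : R) (alpha_gt0 : 0 < alpha) (alpha_lt1 : alpha < 1)
    (rho_gt1 : 1 < rho) (rho_lt : rho < alpha^-1)
    (K : completeNormedModType R[i])
    (dotK : {dot K for (@Num.conj R[i])})
    (hK : hilbert_dot dotK)
    (m0 : R) (L : (nat -> R[i]) -> K)
    (L_bounded : bounded_observation lam m0 L)
    (p1 : R) (p1_le : p1 <= m0)
    (C : R) (C_gt0 : 0 < C) (k0 : nat) (k0_gt0 : (0 < k0)%N)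
    (T : R) (T_gt0 : 0 < T)
    (dyadic_observability :
       forall U : nat -> E, BS lam e alpha rho U ->
       forall k : nat, (k0 <= k)%N ->
         ((normDA lam p1 (coef dotE e (U k)))%:E <=
            C%:E *
              observed L T (schrodinger_flow lam (coef dotE e (U k))))%E)
    (unique_continuation :
       forall v : E, eigenvector domA A v -> L (coef dotE e v) <> 0) :
  forall T' : R, T < T' ->
  exists C' : R, 0 < C' /\
    forall (u0 : nat -> R[i]) (u : R -> nat -> R[i]),
      DA lam m0 u0 ->
      schrodinger_solution lam m0 u0 u ->
      ((normDA lam p1 u0)%:E <= C'%:E * observed L T' u)%E.
Proof.
move=> T' TT'; have [orthonormal _] := e_basis.
have [L_linear [C0 L_le]] := L_bounded.
have {}L_le u : DA lam m0 u -> rnorm (L u) <= `|C0| * normDA lam m0 u.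
  move=> /L_le /le_trans; apply.
  by rewrite ler_wpM2r ?normDA_ge0 // ler_norm.
have [ep [ep0 ep4 block]] :=
  band_in_block alpha_gt0 alpha_lt1 rho_gt1 rho_lt.
have dyadic := dyadic_band hE orthonormal lam_gt0 L_linear
  rho_gt1 dyadic_observability block.
(* An integer bound for the powers of the frequency lost by the observation. *)
pose m := Num.Def.archi_bound (m0 - p1).
have mm : m0 - p1 <= m%:R.
  by rewrite ltW // archi_boundP // subr_ge0.
have [C' C'0 H] := finite_observability hK lam_gt0 lam_ndecr lam_infty
  (normr_ge0 C0)
  (fun N d => obs_vector_admissible lam_gt0 L_linear (normr_ge0 C0) L_le
     N d p1_le mm)
  (fun mu N d => @eigenvector_separation _ _ _ _ _ orthonormal lam_gt0 _ _ _
     L_linear _ _ p1 mu N d A_linear e_eigen unique_continuation)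
  T_gt0 ep0 ep4 C_gt0 dyadic TT'.
exists C'; split => // u0 u Du0 /(schrodinger_unique lam_gt0 lam_ndecr) ->.
apply: (observable_flow lam_gt0 L_linear (normr_ge0 C0) L_le) => //.
- by rewrite ltW // (lt_trans T_gt0).
- exact: ltW.
- by move=> N d; apply: H.
Qed.
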